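(* Let $H(x)=-x\log_2 x-(1-x)\log_2(1-x)$ be the binary entropy function and let $\alpha_\star\approx 0.227$ be the unique solution of $\alpha=1-H(\alpha)$ in $(0,1)$. For every $\alpha<\alpha_\star$ and all sufficiently large $k$ there exists a local computation algorithm that, in time polylogarithmic in $n$ per query, with probability $1-O(1/n)$ solves the problem of proper two coloring for $k$-uniform hypergraphs on $n$ vertices whose maximum edge degree $\Delta$ satisfies \[ 2\mathrm{e}(\Delta+1)<2^{\alpha k}. \] In the notation of local computation algorithms, it is a $(\mathrm{polylog}(n),O(n),O(1/n))$-local computation algorithm.
   Context: A hypergraph is $k$-uniform if every edge has exactly $k$ vertices; $n$ denotes the number of vertices and $m$ the number of edges, and hypergraphs are assumed to have no isolated vertices. The edge degree of an edge $f$ is the number of other edges intersecting $f$; $\Delta$ is the maximum edge degree. A two coloring of the vertices is proper if no edge is monochromatic. $k$ is fixed while $n\to\infty$, so asymptotic notation ($O(\cdot)$, polylog) is in terms of $n$. A $(t,s,\delta)$-local computation algorithm (LCA) for this problem is a randomized algorithm with random access to the input hypergraph, to a tape of random bits, and to a local computation memory (which may be preserved between queries), that receives an arbitrary sequence of queries, each a vertex, and must answer each query with a color of that vertex such that each query is answered in time $t(n)$, at most $s(n)$ local computation memory is used, and, with probability at least $1-\delta(n)$ over the whole sequence of queries, all answers are consistent with a single proper two coloring of the hypergraph (in particular, repeated queries of the same vertex get the same answer). *)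

(* Defs.v *)
From mathcomp Require Import all_boot all_order all_algebra.
From mathcomp Require Import all_classical all_reals all_analysis.

Set Implicit Arguments.
Unset Strict Implicit.
Unset Printing Implicit Defensive.

Import Order.TTheory GRing.Theory Num.Theory.
Import numFieldNormedType.Exports.

Local Open Scope nat_scope.

Definition hypergraph (n : nat) : Type := {set {set 'I_n}}.

Definition uniform n (k : nat) (E : hypergraph n) : bool :=
  [forall f in E, #|f| == k].

Definition no_isolated_vertex n (E : hypergraph n) : bool :=
  [forall v : 'I_n, exists f in E, v \in f].

Definition edge_degree n (E : hypergraph n) (f : {set 'I_n}) : nat :=
  #|[set g in E | (g != f) && ~~ [disjoint g & f]]|.

Definition max_edge_degree n (E : hypergraph n) : nat :=
  \max_(f in E) edge_degree E f.

Definition proper_coloring n (E : hypergraph n) (c : {ffun 'I_n -> bool}) : bool :=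
  [forall f in E, ~~ [exists b : bool, [forall v in f, c v == b]]].

(* A representation of E by adjacency lists: edges are numbered 0, 1, ..., m-1,
   [edge_list] lists the vertices of each edge and [incidence_list] the numbers
   of the edges at each vertex.  All the orderings are arbitrary; an algorithm
   has to work with every representation. *)
Record representation n (E : hypergraph n) := Representation {
  edge_list : seq (seq 'I_n);
  incidence_list : n.-tuple (seq nat);
  edge_listP : perm_eq [seq [set v in e] | e : seq 'I_n <- edge_list] (enum E);
  edge_list_uniq : all uniq edge_list;
  incidence_listP : forall v : 'I_n,
    perm_eq (tnth incidence_list v)
            [seq j <- iota 0 (size edge_list) | v \in nth [::] edge_list j] }.

Inductive binop := OpAdd | OpSub | OpMul | OpDiv | OpMod | OpEq | OpLt.

Definition eval_binop (o : binop) (a b : nat) : nat :=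
  match o with
  | OpAdd => a + b
  | OpSub => a - b
  | OpMul => a * b
  | OpDiv => a %/ b
  | OpMod => a %% b
  | OpEq => nat_of_bool (a == b)
  | OpLt => nat_of_bool (a < b)
  end.

(* x, y, z are names of registers.  Positions are counted from 0, and reading the
   input or the tape out of range gives 0. *)
Inductive cmd :=
  | Skip
  | Const (x c : nat)            (* x := c *)
  | Op (o : binop) (x y z : nat) (* x := y o z *)
  | ReadMem (x y : nat)          (* x := memory[y] *)
  | WriteMem (x y : nat)         (* memory[x] := y *)
  | RandomBit (x y : nat)        (* x := tape[y] *)
  | NumVertices (x : nat)        (* x := n *)
  | NumEdges (x : nat)           (* x := m *)
  | Degree (x y : nat)           (* x := number of edges containing vertex y *)
  | Edge (x y z : nat)           (* x := z-th edge containing vertex y *)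
  | Vertex (x y z : nat)         (* x := z-th vertex of edge y *)
  | Seq (p q : cmd)
  | If (x : nat) (p q : cmd)     (* runs p when x is nonzero, q otherwise *)
  | While (x : nat) (p : cmd).   (* repeats p as long as x is nonzero *)

(* A program runs on words of [word_factor * (floor (log2 n) + 1)] bits, that is
   of O(log n) bits. *)
Record program := Program { code : cmd; word_factor : nat }.

Definition word_bits (A : program) (n : nat) : nat :=
  word_factor A * (trunc_log 2 n).+1.

(* The finite tape has one random bit for every address that fits in a word. *)
Definition tape (w : nat) : Type := (2 ^ w).-tuple bool.

Definition store := nat -> nat.

Definition update (f : store) (x a : nat) : store :=
  fun y => if y == x then a else f y.

Record state := State { regs : store; memory : store }.

Definition set_reg (w : nat) (st : state) (x a : nat) : state :=
  State (update (regs st) x (a %% 2 ^ w)) (memory st).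

Section Execution.
Context {n : nat} {E : hypergraph n}.
Implicit Types (G : representation E) (st : state).

(* One step of the execution of the first command of a list of pending commands,
   on a machine with w-bit words and s words of local memory.  The result is
   [None] on an attempt to use a memory address outside of 0, ..., s-1. *)
Definition step (w s : nat) G (r : tape w) (p : cmd) (todo : seq cmd) st
    : option (seq cmd * state) :=
  let R := regs st in
  let assign x a := Some (todo, set_reg w st x a) in
  match p with
  | Skip => Some (todo, st)
  | Const x c => assign x c
  | Op o x y z => assign x (eval_binop o (R y) (R z))
  | ReadMem x y => if R y < s then assign x (memory st (R y)) else None
  | WriteMem x y =>
      if R x < s then Some (todo, State R (update (memory st) (R x) (R y)))
      else None
  | RandomBit x y => assign x (nat_of_bool (nth false r (R y)))
  | NumVertices x => assign x n
  | NumEdges x => assign x (size (edge_list G))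
  | Degree x y => assign x (size (nth [::] (incidence_list G) (R y)))
  | Edge x y z => assign x (nth 0 (nth [::] (incidence_list G) (R y)) (R z))
  | Vertex x y z =>
      assign x (nth 0 (map val (nth [::] (edge_list G) (R y))) (R z))
  | Seq p1 p2 => Some (p1 :: p2 :: todo, st)
  | If x p1 p2 => Some ((if R x != 0 then p1 else p2) :: todo, st)
  | While x p1 => Some (if R x != 0 then p1 :: p :: todo else todo, st)
  end.

(* The final state, if all the commands are completed within t steps. *)
Fixpoint run (t w s : nat) G (r : tape w) (todo : seq cmd) st : option state :=
  match todo, t with
  | [::], _ => Some st
  | _ :: _, 0 => None
  | p :: todo', t'.+1 =>
      obind (fun c => run t' s G r c.1 c.2) (step s G r p todo' st)
  end.

(* A query v starts with v in register 0 and 0 in all the other registers, so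
   that only the local memory is preserved between queries.  The answer is the
   color encoded in register 0 at the end. *)
Definition answer_query (A : program) (t s : nat) G (r : tape (word_bits A n))
    (mem : store) (v : 'I_n) : option (bool * store) :=
  omap (fun st => (regs st 0 != 0, memory st))
       (run t s G r [:: code A]
            (set_reg (word_bits A n) (State (fun=> 0) mem) 0 v)).

Fixpoint answers_from (A : program) (t s : nat) G (r : tape (word_bits A n))
    (mem : store) (qs : seq 'I_n) : option (seq bool) :=
  if qs is v :: qs' then
    obind (fun am => omap (cons am.1) (answers_from t s G r am.2 qs'))
          (answer_query t s G r mem v)
  else Some [::].

(* [None] when some query is not answered within t steps and s words. *)
Definition answers (A : program) (t s : nat) G (r : tape (word_bits A n))
    (qs : seq 'I_n) : option (seq bool) :=
  answers_from t s G r (fun=> 0) qs.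

(* All the queries are answered, according to one proper coloring of E. *)
Definition consistent (A : program) (t s : nat) G (qs : seq 'I_n)
    (r : tape (word_bits A n)) : bool :=
  [exists c : {ffun 'I_n -> bool},
     proper_coloring E c && (answers t s G r qs == Some [seq c v | v <- qs])].

End Execution.

Local Open Scope ring_scope.

Definition tape_prob (R : realType) (w : nat) (P : pred (tape w)) : R :=
  #|[set r : (2 ^ w)%N.-tuple bool | P r]|%:R / #|{: (2 ^ w)%N.-tuple bool}|%:R.

(* [A] is a (t, s, delta)-local computation algorithm for proper two coloring of
   the hypergraphs in [C].  The bounds on time and memory hold for every
   content of the tape. *)
Definition two_coloring_LCA (R : realType) (C : forall n, hypergraph n -> Prop)
    (A : program) (t s : nat -> nat) (delta : nat -> R) : Prop :=
  forall n (E : hypergraph n) (G : representation E) (qs : seq 'I_n), C n E ->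
    (forall r : tape (word_bits A n), answers (t n) (s n) G r qs != None) /\
    tape_prob R (consistent (A := A) (t n) (s n) G qs) >= 1 - delta n.

Definition log2 (R : realType) (x : R) : R := ln x / ln 2.

Definition binary_entropy (R : realType) (x : R) : R :=
  - x * log2 x - (1 - x) * log2 (1 - x).

Definition in_problem_class (R : realType) (alpha : R) (k n : nat)
    (E : hypergraph n) : Prop :=
  [/\ uniform k E, no_isolated_vertex E
    & 2 * expR 1 * (max_edge_degree E + 1)%:R < 2 `^ (alpha * k%:R) :> R].

Local Open Scope classical_set_scope.

(* f(n) = O(g(n)) as n tends to infinity. *)
Definition big_O (R : realType) (f g : nat -> R) : Prop :=
  (f : nat -> R^o) =O_\oo (g : nat -> R^o).

Definition polylog (R : realType) (t : nat -> nat) : Prop :=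
  exists d : nat, big_O (fun n => (t n)%:R : R) (fun n => ln n%:R ^+ d).

(* Main.v *)
(* Beck's method with threshold T = 3k/4 and neighborhoods of radius three needs
   only 4 alpha < 1, and alpha_star < 5/22.

   The queried vertices take the color given by their tape bit, except that an
   edge with T colored vertices, all of one color (a critical edge), freezes its
   other vertices.  A query that hits a frozen vertex explores its frozen
   component.  A large component contains many disjoint critical edges, each at
   distance at most three from an earlier one in the line graph.  Disjoint edges
   are all critical with probability at most 2 ^ (1 - T) per edge, while there
   are about (k Delta) ^ 3 << 2 ^ T ways to choose the next one.  The sum of the
   conditional probabilities of all such families is a supermartingale over the
   whole sequence of queries, so that the adaptive order of the colorings does
   not matter.

   An edge that meets an explored component of logarithmic size has two colors
   or at least k - T frozen vertices.  The component is recolored by Moser's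
   resampling with a stack of edges to check.  As k Delta << 2 ^ (k - T), an
   induction on the number of resamplings left bounds the probability that
   O(log n) of them do not suffice by n ^ -2.

   The algorithm is a decision tree that reads no tape address twice along any
   path; hence probabilities over the tape are expectations over the tree.  The
   machine program computes the leaf that a given tape selects. *)

Require Import Defs.
From mathcomp Require Import all_boot all_order all_algebra.
From mathcomp Require Import all_classical all_reals all_analysis.
From mathcomp Require Import zify ring lra.

Set Implicit Arguments.
Unset Strict Implicit.
Unset Printing Implicit Defensive.

Import Order.TTheory GRing.Theory Num.Theory.
Import numFieldNormedType.Exports.

Local Open Scope nat_scope.

(** * Decision trees *)

(** With D a bound on the edge degree plus one, the search needs 64 (k D)^3 <= 2^T and the repair
    needs 16 k D <= 2^(k - T). The ratio 3/4 balances the two: both follow from 16 k D <= 2^(k/4),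
    the first one by taking cubes.

    The bounds on time and memory hold for every tape, so both phases carry explicit cutoffs, L
    frozen vertices and N resamplings, and exceeding one of them is the only way to fail. Since a
    query of a colored vertex does nothing and every other successful query reduces the number of
    untouched vertices, at most n repairs are paid for, however long the sequence of queries.

    The queries may leave vertices uncolored, although consistency asks for a coloring of all of
    them. The analysis therefore appends all the vertices to the sequence: if this longer run
    succeeds it ends in a total proper coloring, and as final colors never change, that coloring
    agrees with all the answers given on the way. *)

Inductive tree (A : Type) := Ret (a : A) | Flip (x : nat) (k : bool -> tree A).

Fixpoint bind A B (m : tree A) (f : A -> tree B) : tree B :=
  match m with
  | Ret a => f a
  | Flip x k => Flip x (fun b => bind (k b) f)
  end.

Fixpoint foldT S X (f : S -> X -> tree S) (s : S) (l : seq X) : tree S :=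
  if l is x :: l' then bind (f s x) (fun s' => foldT f s' l') else Ret s.

Fixpoint interp A (r : nat -> bool) (m : tree A) : A :=
  match m with Ret a => a | Flip x k => interp r (k (r x)) end.

Fixpoint leaves A (P : A -> Prop) (m : tree A) : Prop :=
  match m with Ret a => P a | Flip _ k => forall b, leaves P (k b) end.

(* The addresses read along every path are pairwise distinct and lie in S; those
   in [Q a] are still unread when the leaf [a] is reached. *)
Fixpoint fresh A (S : nat -> Prop) (m : tree A) (Q : A -> nat -> Prop) : Prop :=
  match m with
  | Ret a => forall x, Q a x -> S x
  | Flip x k => S x /\ forall b, fresh (fun y => S y /\ y <> x) (k b) Q
  end.

Fixpoint Ex (R : realFieldType) A (F : A -> R) (m : tree A) : R :=
  match m with
  | Ret a => F a
  | Flip _ k => ((Ex F (k true) + Ex F (k false)) / 2)%R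
  end.

Lemma interp_bind A B r (m : tree A) (f : A -> tree B) :
  interp r (bind m f) = interp r (f (interp r m)).
Proof. by elim: m => //= x k IH; rewrite IH. Qed.

Lemma interp_foldT S X r (f : S -> X -> tree S) l s :
  interp r (foldT f s l) = foldl (fun s x => interp r (f s x)) s l.
Proof. by elim: l s => //= x l IH s; rewrite interp_bind IH. Qed.

Lemma leaves_interp A (P : A -> Prop) r m : leaves P m -> P (interp r m).
Proof. by elim: m => //= x k IH H; apply: IH. Qed.

Lemma leavesW A (P Q : A -> Prop) m :
  (forall a, P a -> Q a) -> leaves P m -> leaves Q m.
Proof. by move=> PQ; elim: m => /= [a|x k IH H b]; [apply: PQ|apply: IH]. Qed.

Lemma leaves_and A (P Q : A -> Prop) m :
  leaves P m -> leaves Q m -> leaves (fun a => P a /\ Q a) m.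
Proof. by elim: m => //= x k IH HP HQ b; apply: IH. Qed.

Lemma leaves_bind A B (P : B -> Prop) (m : tree A) (f : A -> tree B) :
  leaves (fun a => leaves P (f a)) m -> leaves P (bind m f).
Proof. by elim: m => //= x k IH H b; apply: IH. Qed.

Lemma leaves_foldT S (X : eqType) (P : S -> Prop) (f : S -> X -> tree S) l s :
  (forall s x, x \in l -> P s -> leaves P (f s x)) -> P s ->
  leaves P (foldT f s l).
Proof.
elim: l s => //= x l IH s Hf Ps; apply: leaves_bind.
apply: leavesW (Hf _ _ (mem_head _ _) Ps) => s' Ps'.
by apply: IH => // t y yl; apply: Hf; rewrite in_cons yl orbT.
Qed.

Lemma freshW A (S S' : nat -> Prop) (m : tree A) (Q Q' : A -> nat -> Prop) :
  (forall x, S x -> S' x) -> (forall a x, Q' a x -> Q a x) ->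
  fresh S m Q -> fresh S' m Q'.
Proof.
elim: m S S' => /= [a|x k IH] S S' HS HQ.
  by move=> H x /HQ /H /HS.
move=> [Sx H]; split; first exact: HS.
by move=> b; apply: IH (H b) => // y [Sy yx]; split=> //; apply: HS.
Qed.

Lemma fresh_bind A B S (m : tree A) (f : A -> tree B) Q Q' :
  fresh S m Q -> (forall a, fresh (Q a) (f a) Q') -> fresh S (bind m f) Q'.
Proof.
move=> Hm Hf; elim: m S Hm => /= [a|x k IH] S H.
  exact: freshW (Hf a).
by case: H => Sx H; split=> // b; apply: IH.
Qed.

Lemma fresh_bind_leaves A B S (m : tree A) (f : A -> tree B) P Q Q' :
  fresh S m Q -> leaves P m -> (forall a, P a -> fresh (Q a) (f a) Q') ->
  fresh S (bind m f) Q'.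
Proof.
move=> Hm HP Hf; elim: m S Hm HP => /= [a|x k IH] S H HP.
  exact: freshW (Hf a HP).
by case: H => Sx H; split=> // b; apply: IH.
Qed.

Lemma fresh_strengthen Z S (t : tree Z) P (Q1 Q2 : Z -> nat -> Prop) :
  fresh S t Q1 -> leaves P t -> (forall a, P a -> forall x, Q2 a x -> Q1 a x) ->
  fresh S t Q2.
Proof.
elim: t S => /= [a|y f IH] S H HP HQ; first by move=> x /(HQ _ HP); apply: H.
by case: H => Sy H; split=> // b; apply: IH.
Qed.

Lemma fresh_foldT S X (f : S -> X -> tree S) (Q : S -> nat -> Prop) l s :
  (forall s x, fresh (Q s) (f s x) Q) -> fresh (Q s) (foldT f s l) Q.
Proof.
move=> Hf; elim: l s => //= x l IH s.
by apply: fresh_bind (Hf _ _) _ => s'; apply: IH.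
Qed.

Lemma fresh_interp A S (m : tree A) Q (r r' : nat -> bool) :
  fresh S m Q -> (forall x, S x -> r x = r' x) -> interp r m = interp r' m.
Proof.
elim: m S => //= x k IH S [Sx H] rr'; rewrite rr' //.
by apply: IH (H _) _ => y [Sy _]; apply: rr'.
Qed.

(** * Expectation over a tree and over the tape *)

Section Expectation.
Variable R : realFieldType.
Local Open Scope ring_scope.

Lemma Ex_bind A B (F : B -> R) (m : tree A) (f : A -> tree B) :
  Ex F (bind m f) = Ex (fun a => Ex F (f a)) m.
Proof. by elim: m => //= x k IH; rewrite !IH. Qed.

Lemma Ex_le_leaves A (F G : A -> R) m :
  leaves (fun a => F a <= G a) m -> Ex F m <= Ex G m.
Proof.
elim: m => //= x k IH H.
by have := IH _ (H true); have := IH _ (H false); lra.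
Qed.

Lemma Ex_le A (F G : A -> R) m : (forall a, F a <= G a) -> Ex F m <= Ex G m.
Proof. by move=> FG; apply: Ex_le_leaves; elim: m => /=. Qed.

Lemma Ex_cst A (c : R) (m : tree A) : Ex (fun=> c) m = c.
Proof. by elim: m => //= x k IH; rewrite !IH; lra. Qed.

Lemma ExD A (F G : A -> R) m : Ex (fun a => F a + G a) m = Ex F m + Ex G m.
Proof. by elim: m => //= x k IH; rewrite !IH; lra. Qed.

Lemma Ex_ge0 A (F : A -> R) m : (forall a, 0 <= F a) -> 0 <= Ex F m.
Proof. by move=> F0; rewrite -[0](Ex_cst _ m); apply: Ex_le. Qed.

Lemma Ex_foldT_le S (X : eqType) (P : S -> Prop) (F : S -> R)
    (f : S -> X -> tree S) l s :
  (forall s x, x \in l -> P s -> leaves P (f s x)) ->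
  (forall s x, x \in l -> P s -> Ex F (f s x) <= F s) ->
  P s -> Ex F (foldT f s l) <= F s.
Proof.
elim: l s => //= x l IH s HP HF Ps; rewrite Ex_bind.
apply: le_trans (HF _ _ (mem_head _ _) Ps); apply: Ex_le_leaves.
apply: leavesW (HP _ _ (mem_head _ _) Ps) => s' Ps'.
by apply: IH => // t y yl; [apply: HP|apply: HF]; rewrite in_cons yl orbT.
Qed.

(* phi negates the bit [v] and preserves the rest of what [H] depends on. *)
Lemma sum_flip (X : finType) (phi : X -> X) (v : X -> bool) (H : bool -> X -> R) :
  involutive phi -> (forall x, v (phi x) = ~~ v x) ->
  (forall b x, H b (phi x) = H b x) ->
  \sum_x H (v x) x = (\sum_x H true x + \sum_x H false x) / 2.
Proof.
move=> phiK vphi Hphi.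
have E : \sum_x H (v x) x = \sum_x H (~~ v x) x.
  rewrite (reindex_inj (inv_inj phiK)) /=.
  by apply: eq_bigr => x _; rewrite Hphi vphi.
have E2 : \sum_x H (v x) x + \sum_x H (~~ v x) x =
          \sum_x H true x + \sum_x H false x.
  by rewrite -!big_split /=; apply: eq_bigr => x _; case: (v x) => //=; rewrite addrC.
by move: E2; rewrite -E => <-; lra.
Qed.

Definition flip_at N (x : nat) (r : N.-tuple bool) : N.-tuple bool :=
  [tuple (nth false r i) (+) (i == x :> nat) | i < N].

Lemma nth_flip_at N x (r : N.-tuple bool) y :
  nth false (flip_at x r) y = nth false r y (+) ((y == x) && (y < N)%N).
Proof.
case: (ltnP y N) => yN; last first.
  by rewrite !nth_default ?size_tuple // andbF.
by rewrite -(tnth_nth false (flip_at x r) (Ordinal yN)) tnth_mktuple /= andbT.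
Qed.

(** Negating bit [x] of the tape is an involution that exchanges the two branches at [Flip x], and
    freshness makes both branches blind to it. So the average over the tapes splits evenly between
    the branches, exactly as [Ex] does. *)
Lemma sum_tape A (F : A -> R) (N : nat) (m : tree A) S Q :
  fresh S m Q -> (forall x, S x -> (x < N)%N) ->
  \sum_(r : N.-tuple bool) F (interp (nth false r) m) =
  #|{: N.-tuple bool}|%:R * Ex F m.
Proof.
elim: m S => /= [a|x k IH] S; first by rewrite sumr_const mulr_natl.
move=> [Sx Hk] SN.
rewrite (sum_flip (phi := flip_at x) (v := fun r => nth false r x)
  (H := fun b (r : N.-tuple bool) => F (interp (nth false r) (k b)))).
- by rewrite !(IH _ _ (Hk _)) => [|y [/SN]|y [/SN]] //; rewrite -mulrDr mulrA.
- move=> r; apply: eq_from_tnth => i; rewrite !(tnth_nth false) !nth_flip_at.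
  by rewrite -addbA addbb addbF.
- by move=> r; rewrite nth_flip_at eqxx SN //= addbT.
- move=> b r; congr F; apply: fresh_interp (Hk b) _ => y [Sy /eqP yx].
  by rewrite nth_flip_at (negPf yx) addbF.
Qed.
End Expectation.

(** * The algorithm as a decision tree *)

Section Model.
Variables (n : nat) (ed : nat -> seq 'I_n) (inc : 'I_n -> seq nat).
Variables (k T L N B : nat).

(* Colors: 0 untouched, 1 and 2 final, 3 frozen; while the frozen vertices are
   being recolored, 3 and 4 are the tentative versions of 1 and 2. *)
Local Notation config := ('I_n -> nat).
Local Notation phase1 := (('I_n -> nat) * seq 'I_n)%type.
Implicit Types (c : config) (W : seq 'I_n) (v u : 'I_n) (g : nat).

Definition upd c u a : config := fun x => if x == u then a else c x.

Definition num c a (f : seq 'I_n) := count (fun u => c u == a) f.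

Definition critical c g :=
  (num c 1 (ed g) * num c 2 (ed g) == 0) &&
  (T <= num c 1 (ed g) + num c 2 (ed g)).

(** The guard on [size s.2] lets a query freeze at most [L + 1] vertices, one more than allowed, so
    that [settle] can see the overflow. The test for critical edges precedes the coin, so an edge
    that is already critical gets no further colored vertex. *)
Definition touch (s : phase1) u : tree (phase1) :=
  if (s.1 u == 0) && (size s.2 <= L) then
    if has (critical s.1) (inc u) then Ret (upd s.1 u 3, rcons s.2 u)
    else Flip u (fun b => Ret (upd s.1 u b.+1, s.2))
  else Ret s.

Definition sweep (s : phase1) w : tree (phase1) :=
  foldT (fun s g => foldT touch s (ed g)) s (inc w).

(** Breadth-first search whose queue is the list of frozen vertices itself; [i] separates the swept
    prefix from the rest. *)
Fixpoint explore v fuel i (s : phase1) : tree (phase1) :=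
  if fuel is fuel'.+1 then
    if (i < size s.2) && (size s.2 <= L) then
      bind (sweep s (nth v s.2 i)) (explore v fuel' i.+1)
    else Ret s
  else Ret s.

(** The state consists of the configuration, the number of bits used in the current block, and the
    stack of edges to check. *)
Definition redraw base (s : config * nat * seq nat) u : tree (config * nat * seq nat) :=
  if 2 < s.1.1 u then
    Flip (base + s.1.2)
      (fun b : bool => Ret (upd s.1.1 u (3 + b), s.1.2.+1, catrev (inc u) s.2))
  else Ret s.

(** Parity identifies a tentative color with its final version: 1 and 3 are odd, 2 and 4 even. *)
Definition mono c g :=
  let x := count (fun u => odd (c u)) (ed g) in (x == 0) || (x == k).

(** The inner [fix] discards edges with two colors for free; only resamplings consume the budget
    [M]. *)
Fixpoint repair base M c j (st : seq nat) {struct M} : tree (bool * config) :=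
  (fix check st := match st with
   | [::] => Ret (true, c)
   | g :: st' =>
     if mono c g then
       if M is M'.+1 then
         bind (foldT (redraw base) (c, j, st') (ed g))
              (fun s => repair base M' s.1.1 s.1.2 s.2)
       else Ret (false, c)
     else check st'
   end) st.

Definition finish c W : config := foldl (fun c w => upd c w (c w - 2)) c W.

Definition base v := n + v * B.

Definition settle v (s : phase1) : tree (bool * config) :=
  if size s.2 <= L then
    bind (foldT (redraw (base v)) (s.1, 0, [::]) s.2)
      (fun s' => bind (repair (base v) N s'.1.1 s'.1.2 s'.2)
         (fun r => Ret (r.1, finish r.2 s.2)))
  else Ret (false, s.1).

Definition query v c : tree (bool * config) :=
  bind (touch (c, [::]) v) (fun s => bind (explore v L 0 s) (settle v)).

Fixpoint queries (qs : seq 'I_n) c : tree (bool * config) :=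
  if qs is v :: qs' then
    bind (query v c) (fun r => if r.1 then queries qs' r.2 else Ret r)
  else Ret (true, c).

(** * Invariants of the first phase *)

Definition two_colored c g := (0 < num c 1 (ed g)) && (0 < num c 2 (ed g)).
Definition colored c g := num c 1 (ed g) + num c 2 (ed g).

(** This is what the freezing rule buys: an edge of size [k] without two colors keeps at least
    [k - T] vertices that have no final color. *)
Definition slack c := forall g, two_colored c g \/ colored c g <= T.

Definition linked v W u := u = v \/ exists w g, [/\ w \in W, w \in ed g & u \in ed g].

(** The last clause records why each vertex was frozen and how it was reached, through [v] or
    through an earlier entry of the list. The certificate for a long list is traced along these
    links. *)
Definition frozen_inv v (s : phase1) :=
  [/\ forall u, s.1 u <= 3, forall u, (s.1 u == 3) = (u \in s.2), uniq s.2, slack s.1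
    & forall i, i < size s.2 ->
        has (critical s.1) (inc (nth v s.2 i)) /\
        linked v (take i s.2) (nth v s.2 i)].

Definition extends (s s' : phase1) :=
  (forall x, s.1 x != 0 -> s'.1 x = s.1 x) /\ (exists W2, s'.2 = s.2 ++ W2).

Hypothesis incE : forall u g, (g \in inc u) = (u \in ed g).
Hypothesis ed_uniq : forall g, uniq (ed g).
Hypothesis T_gt0 : 0 < T.

Lemma criticalE c g : critical c g = ~~ two_colored c g && (T <= colored c g).
Proof. by rewrite /critical muln_eq0 !eqn0Ngt -negb_and. Qed.

Lemma num_upd c u a b f : c u = 0 -> b != 0 -> uniq f ->
  num (upd c u a) b f = num c b f + (a == b) * (u \in f).
Proof.
move=> cu0 b0; rewrite /num; elim: f => [|x f IH] /=; first by rewrite muln0.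
move=> /andP[xf uf].
rewrite {}IH // /upd in_cons [x == u]eq_sym; case: (eqVneq u x) => [ux|_] /=; last by rewrite addnA.
by rewrite -ux in xf *; rewrite cu0 (negPf xf) [0 == b]eq_sym (negPf b0); lia.
Qed.

Lemma num_upd3 c u b f : c u = 0 -> 0 < b < 3 ->
  num (upd c u 3) b f = num c b f.
Proof.
move=> cu0 b0; apply: eq_count => x; rewrite /upd; case: (eqVneq x u) => // ->.
by rewrite cu0; lia.
Qed.

Lemma critical_upd3 c u g : c u = 0 -> critical (upd c u 3) g = critical c g.
Proof. by move=> cu0; rewrite /critical !num_upd3. Qed.

Lemma extends_refl s : extends s s.
Proof. by split=> //; exists [::]; rewrite cats0. Qed.

Lemma extends_trans s1 s2 s3 : extends s1 s2 -> extends s2 s3 -> extends s1 s3.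
Proof.
move=> [H1 [W1 E1]] [H2 [W2 E2]]; split; last first.
  by exists (W1 ++ W2); rewrite E2 E1 catA.
by move=> x x0; rewrite H2 ?H1.
Qed.

Lemma touch_extends s u : leaves (extends s) (touch s u).
Proof.
rewrite /touch; case: ifP => [/andP[/eqP cu0 _]|_]; last exact: extends_refl.
have H a W2 : extends s (upd s.1 u a, s.2 ++ W2).
  split; last by exists W2.
  by move=> x /= x0; rewrite /upd; case: (eqVneq x u) => // E; rewrite E cu0 in x0.
case: ifP => _ /=; first by rewrite -cats1.
by move=> b; have := H b.+1 [::]; rewrite cats0.
Qed.

Lemma foldT_extends (X : eqType) (f : phase1 -> X -> tree _) s l :
  (forall s x, leaves (extends s) (f s x)) -> leaves (extends s) (foldT f s l).
Proof.
move=> H; apply: leaves_foldT (extends_refl s) => t x _ st.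
by apply: leavesW (H t x) => t'; apply: extends_trans.
Qed.

Lemma sweep_extends s w : leaves (extends s) (sweep s w).
Proof. by apply: foldT_extends => t g; apply: foldT_extends => *; apply: touch_extends. Qed.

Lemma explore_extends v fuel i s : leaves (extends s) (explore v fuel i s).
Proof.
elim: fuel i s => [|fuel IH] i s /=; first exact: extends_refl.
case: ifP => _ /=; last exact: extends_refl.
apply: leaves_bind; apply: leavesW (sweep_extends s _) => t st.
by apply: leavesW (IH i.+1 t) => t'; apply: extends_trans.
Qed.

Lemma touch_touched s u :
  leaves (fun s' : phase1 => s'.1 u != 0 \/ L < size s'.2) (touch s u).
Proof.
rewrite /touch; case: ifP => [_|H /=]; last first.
  by move: H; case: eqP => //= _ H; [right; rewrite ltnNge H | left].
case: ifP => _ /=; first by left; rewrite /upd eqxx.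
by move=> b; left; rewrite /upd eqxx.
Qed.

Lemma extends_size s s' : extends s s' -> size s.2 <= size s'.2.
Proof. by case=> _ [W ->]; rewrite size_cat leq_addr. Qed.

Lemma extends_touched s s' x :
  extends s s' -> s.1 x != 0 \/ L < size s.2 -> s'.1 x != 0 \/ L < size s'.2.
Proof.
move=> E; have := extends_size E; case: E => E _.
by move=> H [x0|]; [left; rewrite E|right; lia].
Qed.

Lemma foldT_established (X : eqType) (f : phase1 -> X -> tree _)
    (P : X -> phase1 -> Prop) s l :
  (forall s x, leaves (extends s) (f s x)) ->
  (forall s x, x \in l -> leaves (P x) (f s x)) ->
  (forall x s s', extends s s' -> P x s -> P x s') ->
  leaves (fun s' : phase1 => forall x, x \in l -> P x s') (foldT f s l).
Proof.
move=> Hf HP Hext; elim: l s HP => [|y l IH] s HP //=.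
apply: leaves_bind; apply: leavesW (HP s _ (mem_head _ _)) => t Pt.
have Hl : forall s x, x \in l -> leaves (P x) (f s x).
  by move=> ? x xl; apply: HP; rewrite in_cons xl orbT.
apply: leavesW (leaves_and (IH t Hl) (foldT_extends t l Hf)) => t' [H tt' x].
by rewrite in_cons => /predU1P[->|/H //]; apply: Hext tt' Pt.
Qed.

Lemma sweep_touched s w :
  leaves (fun s' : phase1 => forall g, g \in inc w -> forall u, u \in ed g ->
             s'.1 u != 0 \/ L < size s'.2) (sweep s w).
Proof.
apply: (foldT_established (P := fun g (s' : phase1) => forall u, u \in ed g ->
             s'.1 u != 0 \/ L < size s'.2)).
- by move=> *; apply: foldT_extends => *; apply: touch_extends.
- move=> t g _; apply: (foldT_established (P := fun u (s' : phase1) => s'.1 u != 0 \/ L < size s'.2)).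
  + exact: touch_extends.
  + by move=> *; apply: touch_touched.
  + by move=> *; apply: extends_touched; eauto.
- by move=> g t t' tt' H u ug; apply: extends_touched tt' (H u ug).
Qed.

Definition swept v i (s : phase1) :=
  forall i', i' < minn i (size s.2) -> forall g, g \in inc (nth v s.2 i') ->
    forall u, u \in ed g -> s.1 u != 0 \/ L < size s.2.

(** When the fuel is used up, [i = L], so a list of size at most [L] has been swept entirely. *)
Lemma explore_swept v fuel i s : fuel + i = L -> swept v i s ->
  leaves (fun s' : phase1 => size s'.2 <= L -> forall w, w \in s'.2 ->
    forall g, g \in inc w -> forall u, u \in ed g -> s'.1 u != 0)
  (explore v fuel i s).
Proof.
have done_ s' i' : size s'.2 <= i' -> swept v i' s' -> size s'.2 <= L ->
    forall w, w \in s'.2 -> forall g, g \in inc w -> forall u, u \in ed g -> s'.1 u != 0.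
  move=> i's H sL w /(nthP v) [i0 i0s <-] g gw u ug.
  have i0m : i0 < minn i' (size s'.2) by rewrite leq_min i0s (leq_trans i0s i's).
  by case: (H i0 i0m g gw u ug) => //; rewrite ltnNge sL.
elim: fuel i s => [|fuel IH] i s Ei Hs /=.
  by move=> sL; apply: (done_ _ _ _ Hs sL); lia.
case: ifP => [/andP[i_s sL]|H /=]; last by move=> sL; apply: (done_ _ _ _ Hs sL); lia.
apply: leaves_bind.
apply: leavesW (leaves_and (sweep_extends s _) (sweep_touched s _)) => t [st Ht].
apply: IH; first lia.
move=> i' i't g; have [_ [W2 tE]] := st; have /orP[ii|/eqP ii] : (i' < i) || (i' == i) by lia.
  rewrite tE nth_cat ifT; last lia.
  by move=> gi u ug; rewrite -tE; apply: (extends_touched st (Hs i' _ g gi u ug)); lia.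
by rewrite ii tE nth_cat i_s -tE; apply: Ht.
Qed.

Lemma linkedW v W W' u : {subset W <= W'} -> linked v W u -> linked v W' u.
Proof.
move=> sW [->|[w [g [ww wg ug]]]]; [by left|right].
by exists w, g; split=> //; apply: sW.
Qed.

(** A vertex gets a color only if no edge at it is critical. Hence the critical edges that justify
    the earlier frozen vertices do not change, and an edge through [u] that has no two colors had
    fewer than [T] colored vertices, so that one more is allowed by [slack]. *)
Lemma touch_inv v s u : linked v s.2 u -> frozen_inv v s ->
  leaves (frozen_inv v) (touch s u).
Proof.
move: s => [c W] /= Hu [/= c3 cW uW sl HW]; rewrite /touch /=.
case: ifP => [/andP[/eqP cu0 _]|_ //].
have uNW : u \notin W by rewrite -cW /= cu0.
case: ifP => [Hcr|Hcr] /=; last first => [b|]; split=> /=.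
- by move=> x; rewrite /upd; case: (eqVneq x u) => _ //; case: b.
- by move=> x; rewrite /upd; case: (eqVneq x u) => [->|_] //; rewrite (negPf uNW); case: b.
- by [].
- move=> g; rewrite /two_colored /colored !num_upd //.
  case ug: (u \in ed g); last by rewrite !muln0 !addn0; apply: sl.
  have [/andP[H1 H2]|gsl] := sl g; first by left; lia.
  have : ~~ critical c g.
    by apply/negP => cg; case/negP: Hcr; apply/hasP; exists g; rewrite ?incE.
  rewrite criticalE negb_and negbK -ltnNge => /orP[/andP[H1 H2]|H]; first by left; lia.
  by right; move: H; rewrite /colored; case: b => /=; lia.
- move=> i iW; have [/hasP[g gi Hg] ln] := HW i iW; split=> //.
  apply/hasP; exists g => //.
  have ug : (u \in ed g) = false.
    by apply/negbTE/negP => ug; case/negP: Hcr; apply/hasP; exists g; rewrite ?incE.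
  by rewrite /critical !num_upd // ug !muln0 !addn0.
- by move=> x; rewrite /upd; case: (eqVneq x u).
- by move=> x; rewrite /upd mem_rcons in_cons; case: (eqVneq x u) => //= _.
- by rewrite rcons_uniq uNW.
- by move=> g; rewrite /two_colored /colored !num_upd3 //; apply: sl.
- have Hhas x : has (critical c) (inc x) -> has (critical (upd c u 3)) (inc x).
    by apply: sub_has => g; rewrite critical_upd3.
  move=> i; rewrite size_rcons ltnS leq_eqVlt => /predU1P[->|iW].
    rewrite nth_rcons ltnn eqxx; split; first exact: Hhas.
    by apply: linkedW Hu => x; rewrite -cats1 take_size_cat.
  rewrite nth_rcons iW; have [H1 H2] := HW i iW; split; first exact: Hhas.
  by rewrite -cats1 takel_cat // ltnW.
Qed.

Lemma sweep_inv v s w : w \in s.2 -> frozen_inv v s -> leaves (frozen_inv v) (sweep s w).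
Proof.
move=> ws Hs; apply: (@leavesW _ (fun s : phase1 => w \in s.2 /\ frozen_inv v s)); first by move=> ? [].
apply: leaves_foldT => // {s ws Hs} s g gw Hs.
apply: leaves_foldT => // {s Hs} s u ug [ws Hs].
apply: leaves_and; last first.
  by apply: touch_inv Hs; right; exists w, g; split; rewrite // -incE.
by apply: leavesW (touch_extends s u) => t [_ [W2 ->]]; rewrite mem_cat ws.
Qed.

Lemma explore_inv v fuel i s : frozen_inv v s -> leaves (frozen_inv v) (explore v fuel i s).
Proof.
elim: fuel i s => //= fuel IH i s Hs; case: ifP => // /andP[i_s _].
apply: leaves_bind; apply: leavesW (sweep_inv (mem_nth _ i_s) Hs) => t Ht.
exact: IH.
Qed.


(** * Neighborhoods, and certificates for large components *)

Variable D : nat.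
Hypothesis edge_size : forall u g, u \in ed g -> size (ed g) = k.
Hypothesis inc_size : forall u, size (inc u) <= D.

Local Notation Q := (k * D).

Lemma ed_size g : size (ed g) <= k.
Proof.
case E : (ed g) => [|u f] //; have ug : u \in ed g by rewrite E mem_head.
by rewrite -E (edge_size ug).
Qed.

Definition meets g h := has (fun x => x \in ed h) (ed g).

Definition nb g := flatten [seq inc u | u <- ed g].

Definition nb3 g := flatten [seq nb h | h <- flatten [seq nb h | h <- nb g]].

Lemma meetsC g h : meets g h = meets h g.
Proof. by apply/hasP/hasP => -[x xg xh]; exists x. Qed.

Lemma mem_nb g h : (h \in nb g) = meets g h.
Proof.
apply/flattenP/hasP => [[_ /mapP[u ug ->]]|[x xg xh]].
  by rewrite incE => uh; exists u.
by exists (inc x); rewrite ?incE //; apply: map_f.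
Qed.

Lemma mem_nb3 f g h e : meets f g -> meets g h -> meets h e -> e \in nb3 f.
Proof.
move=> fg gh he; apply/flattenP; exists (nb h); rewrite ?mem_nb //.
apply: map_f; apply/flattenP; exists (nb g); rewrite ?mem_nb //.
by apply: map_f; rewrite mem_nb.
Qed.

Lemma size_flatten_le (X Y : eqType) (f : X -> seq Y) a (l : seq X) :
  (forall x, size (f x) <= a) -> size (flatten [seq f x | x <- l]) <= size l * a.
Proof.
by move=> H; elim: l => //= x l IH; rewrite size_cat mulSn leq_add.
Qed.

Lemma size_nb g : size (nb g) <= Q.
Proof.
by apply: leq_trans (size_flatten_le _ inc_size) _; rewrite leq_mul ?ed_size.
Qed.

Lemma size_nb3 g : size (nb3 g) <= Q ^ 3.
Proof.
apply: leq_trans (size_flatten_le _ size_nb) _; rewrite expnSr leq_mul //.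
by apply: leq_trans (size_flatten_le _ size_nb) _; rewrite leq_mul // size_nb.
Qed.

(* The m-tuples of disjoint edges that a search through neighborhoods of radius
   three may select: [st] is the stack of the search, [ch] the edges selected so
   far. *)
Fixpoint certs m st (ch : seq nat) {struct m} : seq (seq nat) :=
  if m is m'.+1 then
    (fix scan st := if st is g :: st' then
       (if has (meets g) ch then [::]
        else [seq g :: ct | ct <- certs m' (nb3 g ++ st') (g :: ch)]) ++ scan st'
     else [::]) st
  else [:: [::]].

Definition disjoint_family := pairwise (fun g h => ~~ meets g h).

Lemma certsP m st ch ct : ct \in certs m st ch ->
  [/\ size ct = m, disjoint_family ct & forall g h, g \in ct -> h \in ch -> ~~ meets g h].
Proof.
elim: m st ch ct => [|m IH] st ch ct /=; first by rewrite inE => /eqP ->.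
elim: st => //= g st IHst; rewrite mem_cat => /orP[|//].
case: ifP => // Hch /mapP[ct' /IH[<- dct Hct] ->]; split=> //=.
  rewrite /disjoint_family /= -/disjoint_family dct andbT.
  by apply/allP => h hct; rewrite meetsC Hct ?mem_head.
move=> g' h; rewrite in_cons => /predU1P[->|g'ct] hch; last first.
  by apply: Hct; rewrite // in_cons hch orbT.
by apply/negP => gh; case/negP: Hch; apply/hasP; exists h.
Qed.

(** Greedy selection: a search that cannot collect [m] critical edges ends with a selection that is
    maximal, so every critical edge offered to it, by the stack or near a newly selected edge, meets
    or belongs to the selection. *)
Lemma certs_grow c m st ch :
  (exists2 ct, ct \in certs m st ch & all (critical c) ct) \/
  exists ch', [/\ size ch' < m + size ch, {subset ch <= ch'},
    forall g, g \in st -> critical c g -> has (meets g) ch' || (g \in ch')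
    & forall h g, h \in ch' -> h \notin ch -> g \in nb3 h -> critical c g ->
        has (meets g) ch' || (g \in ch')].
Proof.
elim: m st ch => [|m IH] st ch /=; first by left; exists [::]; rewrite ?mem_head.
elim: st => [|g st IHst].
  right; exists ch; split=> //; first by rewrite addSn ltnS leq_addl.
  by move=> h g -> /negP.
(* The rest of the stack is tried first. Its maximal selection also handles [g] when [g] is not
   critical or meets [ch]; in the remaining case [g] is selected and [m] decreases. *)
case: IHst => [[ct ctin ctc]|[ch' [szch chs Hst Hnb]]].
  by left; exists ct; rewrite // mem_cat ctin orbT.
case cg: (critical c g); last first.
  right; exists ch'; split=> // h; rewrite in_cons => /predU1P[->|/Hst //].
  by rewrite cg.
case: ifP => gch.
  right; exists ch'; split=> // h; rewrite in_cons => /predU1P[-> _|/Hst //].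
  apply/orP; left; apply/hasP; have /hasP[x xch gx] := gch.
  by exists x => //; apply: chs.
case: (IH (nb3 g ++ st) (g :: ch)) => [[ct ctin ctc]|[ch2 [sz2 sub2 Hst2 Hnb2]]].
  by left; exists (g :: ct); rewrite /= ?cg // mem_cat map_f.
right; exists ch2; split.
- by rewrite addSnnS.
- by move=> h hch; apply: sub2; rewrite in_cons hch orbT.
- move=> h; rewrite in_cons => /predU1P[-> _|hst].
    by rewrite sub2 ?mem_head ?orbT.
  by apply: Hst2; rewrite mem_cat hst orbT.
- move=> h g' hch2 hch; case: (eqVneq h g) => [->|hg] g'h.
    by apply: Hst2; rewrite mem_cat g'h.
  by apply: Hnb2 g'h; rewrite // in_cons negb_or hg.
Qed.

Lemma critical_nonempty c g : critical c g -> has predT (ed g).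
Proof.
rewrite criticalE => /andP[_]; rewrite /colored.
by case: (ed g) => //=; rewrite /num /=; lia.
Qed.

Lemma meets_refl c g : critical c g -> meets g g.
Proof. by move=> /critical_nonempty /hasP[x xg _]; apply/hasP; exists x. Qed.

Lemma size_cover (ch : seq nat) (W : seq 'I_n) : uniq W ->
  (forall u, u \in W -> exists g h, [/\ u \in ed g, h \in ch & meets h g]) ->
  size W <= size ch * Q * k.
Proof.
move=> uW HW; have sub : {subset W <= flatten [seq ed g | g <- flatten [seq nb h | h <- ch]]}.
  move=> u /HW[g [h [ug hch hg]]]; apply/flattenP; exists (ed g) => //.
  by apply: map_f; apply/flattenP; exists (nb h); rewrite ?mem_nb //; apply: map_f.
apply: leq_trans (uniq_leq_size uW sub) _.
apply: leq_trans (size_flatten_le _ ed_size) _; rewrite leq_mul2r.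
by rewrite (size_flatten_le _ size_nb) orbT.
Qed.

(** Otherwise fewer than [m] edges form a maximal selection, and by induction on the order of
    discovery every frozen vertex lies in an edge that meets a selected one; this contradicts the
    length of the list. In the inductive step a selected [h] meets an edge [f] at the parent [w],
    [f] meets the linking edge [e] at [w], and [e] meets the critical edge [g] at [u]. These three
    steps are the origin of [nb3]. *)
Lemma frozen_cert v m s : frozen_inv v s -> m * Q * k < size s.2 ->
  exists2 ct, ct \in certs m (inc v) [::] & all (critical s.1) ct.
Proof.
move=> [_ _ uW _ HW] big; have [//|[ch [sz _ Hv Hnb]]] := certs_grow s.1 m (inc v) [::].
exfalso; suff : size s.2 <= size ch * Q * k.
  rewrite addn0 in sz; have : size ch * Q * k <= m * Q * k.
    by rewrite !leq_mul // ltnW.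
  by lia.
apply: size_cover uW _ => u /(nthP v)[i].
have fin g : critical s.1 g -> has (meets g) ch || (g \in ch) ->
    exists2 h, h \in ch & meets h g.
  move=> cg /orP[/hasP[h hch gh]|gch]; first by exists h; rewrite // meetsC.
  by exists g => //; apply: meets_refl cg.
have [j] := ubnP i; elim: j i u => // j IH i u ij iW Eu.
have [/hasP[g gi cg]] := HW i iW; rewrite Eu in gi * => -[uv|[w [e [wt we ue]]]].
  have [|h hch hg] := fin g cg; first by apply: Hv; rewrite // -uv.
  by exists g, h; rewrite -incE.
have {}wt := wt; have /(nthP v)[i' i't Ew] := wt.
have i'i : i' < i by rewrite (size_takel (ltnW iW)) in i't.
have i'W : i' < size s.2 by apply: ltn_trans iW.
have [||f [h [wf hch hf]]] := IH i' w _ i'W; [lia|by rewrite -Ew nth_take|].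
have [|h' h'ch h'g] := fin g cg.
  apply: (Hnb h) => //; apply: (mem_nb3 hf (h := e)).
    by apply/hasP; exists w.
  by apply/hasP; exists u; rewrite // -incE.
by exists g, h'; rewrite -incE.
Qed.

(** * Correctness of the repair and of a query *)

Lemma num_partition c f : (forall u, u \in f -> (0 < c u <= 3)) ->
  (num c 1 f + num c 2 f + num c 3 f) = size f.
Proof.
elim: f => //= u f IH H; rewrite /num /= -!/(num _ _ _) -IH => [|x xf]; last first.
  by apply: H; rewrite in_cons xf orbT.
by have := H u (mem_head _ _); case: (c u) => [|[|[|[|]]]] //= _;
  rewrite ?add0n ?add1n ?addSn ?addnS.
Qed.

Lemma num_gt0P c a f : reflect (exists2 u, u \in f & c u = a) (0 < num c a f).
Proof.
by rewrite -has_count; apply: (iffP hasP) => -[u uf /eqP cu]; exists u.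
Qed.

Lemma two_colored_mono c g : size (ed g) = k ->
  (exists2 u, u \in ed g & odd (c u)) -> (exists2 u, u \in ed g & ~~ odd (c u)) ->
  ~~ mono c g.
Proof.
move=> sz [u ug ou] [w wg ow]; rewrite /mono negb_or -lt0n -has_count -sz.
apply/andP; split; first by apply/hasP; exists u.
by rewrite -all_count; apply/allPn; exists w.
Qed.

Definition tentative c0 c := forall u, if (2 < c0 u) then (2 < c u < 5) else c u == c0 u.

Lemma tentative_frozen c0 c u : tentative c0 c -> (2 < c u) = (2 < c0 u).
Proof. by move/(_ u); case: ifP => [_ /andP[->]|H /eqP->]. Qed.

Lemma redraw_leaves b0 c0 s f : tentative c0 s.1.1 ->
  leaves (fun s' => [/\ tentative c0 s'.1.1, {subset s.2 <= s'.2},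
      forall u, u \in f -> (2 < c0 u) -> {subset inc u <= s'.2}
    & forall g, g \in s'.2 \/ forall u, u \in ed g -> s'.1.1 u = s.1.1 u])
  (foldT (redraw b0) s f).
Proof.
elim: f s => [|x f IH] s Hs; first by split=> // g; right.
apply: leaves_bind; rewrite /redraw (tentative_frozen x Hs).
case: ifP => cx /=; last first.
  apply: leavesW (IH s Hs) => s' [H1 H2 H3 H4]; split=> // u.
  by rewrite in_cons => /predU1P[->|/H3 //]; rewrite cx.
move=> b; apply: leavesW (IH _ _) => /= [s' [H1 H2 H3 H4]|]; last first.
  move=> u; rewrite /upd; case: (eqVneq u x) => [->|_]; last exact: Hs.
  by rewrite cx; case: b.
split=> //.
- by move=> h hs; apply: H2; rewrite catrevE mem_cat hs orbT.
- move=> u; rewrite in_cons => /predU1P[-> _ h hx|/H3 //].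
  by apply: H2; rewrite catrevE mem_cat mem_rev hx.
- move=> g; have [gs|Hg] := H4 g; first by left.
  have [xg|xg] := boolP (x \in ed g).
    by left; apply: H2; rewrite catrevE mem_cat mem_rev incE xg.
  right=> u ug; rewrite Hg // /upd; case: (eqVneq u x) => // ux.
  by rewrite -ux ug in xg.
Qed.

Definition touches_frozen c g := has (fun u => 2 < c u) (ed g).

Lemma eq_mono c c' g : {in ed g, c =1 c'} -> mono c g = mono c' g.
Proof.
move=> E; rewrite /mono; have -> // : count (fun u => odd (c u)) (ed g) =
  count (fun u => odd (c' u)) (ed g).
by apply: eq_in_count => u ug; rewrite E.
Qed.

(** The invariant is that every monochromatic edge with a frozen vertex is on the stack. A
    resampling pushes all the edges at the vertices it redraws, so an edge that is not pushed keeps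
    its colors. *)
Lemma repair_leaves b0 c0 M c j st : tentative c0 c ->
  (forall g, touches_frozen c0 g -> mono c g -> g \in st) ->
  leaves (fun r : bool * config => tentative c0 r.2 /\
            (r.1 -> forall g, touches_frozen c0 g -> ~~ mono r.2 g))
  (repair b0 M c j st).
Proof.
elim: M c j st => [|M IHM] c j st Hc; elim: st => [|g st IHst] Hst /=.
- by split=> // _ g /Hst H; apply/negP => /H.
- case: ifP => mg //=; apply: IHst => h th mh; have := Hst h th mh.
  by rewrite in_cons => /predU1P[hg|//]; rewrite -hg mh in mg.
- by split=> // _ g /Hst H; apply/negP => /H.
case: ifP => mg; last first.
  apply: IHst => h th mh; have := Hst h th mh.
  by rewrite in_cons => /predU1P[hg|//]; rewrite -hg mh in mg.
apply: leaves_bind; apply: leavesW (redraw_leaves b0 (s := (c, j, st)) (ed g) Hc) => s' /=.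
move=> [H1 H2 H3 H4]; apply: IHM => // h th mh; have [//|E] := H4 h.
rewrite (eq_mono (c' := c)) // in mh; have := Hst h th mh.
(* The popped edge itself returns to the stack through one of its frozen vertices. *)
rewrite in_cons => /predU1P[hg|/H2 //]; have /hasP[u uh cu] := th.
by apply: (H3 u) => //; [rewrite -hg|rewrite incE].
Qed.

Lemma finishE c W : uniq W -> finish c W = fun u => if u \in W then (c u - 2) else c u.
Proof.
rewrite /finish => uW; apply: funext => u; elim: W c uW => //= w W IH c /andP[wW uW].
rewrite IH // in_cons /upd; case: (eqVneq u w) => [->|] //=.
by rewrite (negPf wW).
Qed.

(** The third clause serves both [slack] and the potential: an edge whose colors change ends with
    two final colors and can no longer become critical. *)
Definition settled c c' :=
  [/\ forall u, (c u <= 2) -> c' u = c u, forall u, c u = 3 -> (0 < c' u <= 2)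
    & forall g, (forall u, u \in ed g -> c' u = c u) \/ two_colored c' g].

Definition closed_frontier (s : phase1) := (size s.2 <= L) -> forall w, w \in s.2 ->
  forall g, g \in inc w -> forall u, u \in ed g -> s.1 u != 0.

Lemma closed_frozen v s g : frozen_inv v s -> closed_frontier s -> (size s.2 <= L) ->
  touches_frozen s.1 g -> size (ed g) = k /\ forall u, u \in ed g -> (0 < s.1 u <= 3).
Proof.
move=> [s3 sW _ _ _] Hs sL /hasP[u ug su]; split; first exact: edge_size ug.
move=> x xg; rewrite s3 andbT lt0n; apply: (Hs sL u) xg; last by rewrite incE.
by rewrite -sW; have := s3 u; lia.
Qed.

Lemma settle_leaves v s : frozen_inv v s -> closed_frontier s ->
  leaves (fun r : bool * config => r.1 -> settled s.1 r.2) (settle v s).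
Proof.
move=> Hs Hcl; rewrite /settle; case: ifP => // sL; have [s3 sW uW _ _] := Hs.
have T0 : tentative s.1 s.1 by move=> u; case: ifP => // su; have := s3 u; lia.
apply: leaves_bind.
apply: leavesW (redraw_leaves (base v) (s := (s.1, 0, [::])) s.2 T0) => s' /= [H1 _ H3 _].
apply: leaves_bind.
apply: leavesW (@repair_leaves (base v) s.1 N s'.1.1 s'.1.2 s'.2 H1 _) => /=; last first.
  move=> g /hasP[u ug su] _; apply: (H3 u) => //; last by rewrite incE.
  by rewrite -sW; have := s3 u; lia.
move=> [ok c'] /= [Hc' Hok] ok1; rewrite finishE //.
have WE u : (u \in s.2) = (2 < s.1 u) by rewrite -sW; have := s3 u; lia.
split=> [u su|u su|g].
- by rewrite WE ltnNge su; have := Hc' u; rewrite ltnNge su => /eqP.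
- by rewrite WE su; have := Hc' u; rewrite su /=; lia.
have [tg|ntg] := boolP (touches_frozen s.1 g); [right|left].
  have [sz pos] := closed_frozen Hs Hcl sL tg.
  have := Hok ok1 g tg; rewrite /mono negb_or -lt0n -has_count -sz -all_count.
  move=> /andP[/hasP[u ug ou] /allPn[w wg ow]].
  apply/andP; split; apply/num_gt0P; [exists u => //|exists w => //].
    by have := Hc' u; rewrite WE; have := pos u ug; case: ifP => su; lia.
  by have := Hc' w; rewrite WE; have := pos w wg; case: ifP => sw; lia.
move=> u ug; have su : (2 < s.1 u) = false by apply/negbTE; apply: (hasPn ntg).
by rewrite WE su; have := Hc' u; rewrite su => /eqP.
Qed.

Definition query_inv c := (forall u, c u <= 2) /\ slack c.

Lemma settled_query_inv v s c' : frozen_inv v s -> settled s.1 c' -> query_inv c'.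
Proof.
move=> [s3 _ _ sl _] [H1 H2 H3]; split=> [u|g].
  have := s3 u; rewrite leq_eqVlt ltnS => /predU1P[/H2/andP[]//|su].
  by rewrite H1.
have [E|] := H3 g; [|by left].
have En a : num c' a (ed g) = num s.1 a (ed g) by apply: eq_in_count => u /E ->.
by rewrite /two_colored /colored !En; apply: sl.
Qed.

Lemma explore_leaves v (s : phase1) : frozen_inv v s ->
  leaves (fun s' => [/\ frozen_inv v s', closed_frontier s' & extends s s'])
  (explore v L 0 s).
Proof.
move=> Hs; have sw : swept v 0 s by move=> i'; rewrite min0n.
have H1 := explore_inv L 0 Hs; have H2 := explore_extends v L 0 s.
have H3 := explore_swept (addn0 L) sw.
by apply: leavesW (leaves_and H1 (leaves_and H2 H3)) => s' [? [? ?]].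
Qed.

Lemma touch_start v c : query_inv c ->
  leaves (fun s' => frozen_inv v s' /\ extends (c, [::]) s')
  (touch (c, [::]) v).
Proof.
move=> [c2 sl]; have F0 : frozen_inv v (c, [::]).
  split=> //= u; first exact: leq_trans (c2 u) _.
  by rewrite in_nil; apply/negbTE; have := c2 u; lia.
have H1 := touch_inv (or_introl (erefl v)) F0.
have H2 := touch_extends (c, [::]) v.
exact: leaves_and H1 H2.
Qed.

Definition refines c c' := forall u, c u != 0 -> c' u = c u.

Lemma settled_refines c s c' : query_inv c -> extends (c, [::]) s -> settled s.1 c' ->
  refines c c'.
Proof.
move=> [c2 _] [/= E _] [H _ _] u cu; rewrite -(E u cu); apply: H.
by rewrite (E u cu).
Qed.

Lemma settled_nonzero v s c' u : frozen_inv v s -> settled s.1 c' -> s.1 u != 0 ->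
  c' u != 0.
Proof.
move=> [s3 _ _ _ _] [H1 H2 _] su; have := s3 u; rewrite leq_eqVlt ltnS.
case/predU1P => [/H2/andP[]|su2]; first by lia.
by rewrite H1.
Qed.

(** Only queries of untouched vertices use random bits or can fail. *)
Lemma query_done v c : c v != 0 -> query v c = Ret (true, c).
Proof.
move=> /negPf cv; rewrite /query /touch /= cv /=.
have -> : explore v L 0 (c, [::]) = Ret (c, [::]) by case: L.
by rewrite /settle /=; case: N.
Qed.

Lemma touch_nonzero v c : leaves (fun s' : phase1 => s'.1 v != 0) (touch (c, [::]) v).
Proof.
rewrite /touch /= andbT; case: ifP => [_|/negbT //]; case: ifP => _ /=.
  by rewrite /upd eqxx.
by move=> b; rewrite /upd eqxx.
Qed.

Lemma query_leaves v c : query_inv c ->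
  leaves (fun r : bool * config => r.1 -> [/\ query_inv r.2, r.2 v != 0 & refines c r.2])
  (query v c).
Proof.
move=> Hc; have [cv|cv] := boolP (c v != 0); first by rewrite query_done.
apply: leaves_bind.
apply: leavesW (leaves_and (touch_start v Hc) (touch_nonzero v c)) => s [[Hs cs] sv].
apply: leaves_bind; apply: leavesW (explore_leaves Hs) => t [Ht ct st].
apply: leavesW (settle_leaves Ht ct) => r Hr /Hr stl; split.
- exact: settled_query_inv Ht stl.
- apply: settled_nonzero Ht stl _; have [E _] := st.
  by rewrite E.
- exact: settled_refines Hc (extends_trans cs st) stl.
Qed.

Lemma queries_leaves qs c : query_inv c ->
  leaves (fun r : bool * config => r.1 ->
    [/\ query_inv r.2, refines c r.2 & forall v, v \in qs -> r.2 v != 0]) (queries qs c).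
Proof.
elim: qs c => [|v qs IH] c Hc //=.
apply: leaves_bind; apply: leavesW (query_leaves v Hc) => -[[] c'] //= /(_ isT)[Hc' c'v cc'].
apply: leavesW (IH c' Hc') => -[ok c2] /= H ok1; have [Hc2 c2c' Hq] := H ok1; split=> //.
  by move=> u cu; rewrite c2c' cc'.
move=> u; rewrite in_cons => /predU1P[->|/Hq //].
by rewrite c2c'.
Qed.

Definition untouched c := #|[pred u | c u == 0]|.

Lemma untouched_decr v c c' : c v = 0 -> c' v != 0 -> refines c c' ->
  (untouched c' < untouched c).
Proof.
move=> cv c'v E; apply: proper_card; apply/fintype.properP; split.
  apply/fintype.subsetP => u; rewrite !inE; apply: contraTT => cu; by rewrite (E u cu).
by exists v; rewrite inE ?cv.
Qed.

(** * No tape address is read twice *)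

Section Freshness.

(** An address below [n] is the coin of a vertex and counts as spent once the vertex has left color
    0. The predicate [E] describes what is left of the blocks. *)
Definition unread c (E : nat -> Prop) (x : nat) : Prop :=
  (exists2 u, c u = 0 & x = u) \/ ((n <= x) /\ E x).

Lemma touch_fresh E s u :
  fresh (unread s.1 E) (touch s u) (fun s' => unread s'.1 E).
Proof.
rewrite /touch; case: ifP => [/andP[/eqP cu0 _]|_] //=.
have H a x : a != 0 -> unread (upd s.1 u a) E x -> unread s.1 E x /\ x <> u.
  move=> a0 [[w]|[nx Ex]]; last first.
    by split; [right|move=> xu; move: nx; rewrite xu leqNgt ltn_ord].
  rewrite /upd; case: (eqVneq w u) => [_ /eqP|wu cw ->]; first by rewrite (negPf a0).
  by split; [left; exists w|move=> /val_inj/eqP; rewrite (negPf wu)].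
case: ifP => _ /=; first by move=> x /H[].
split; first by left; exists u.
by move=> b x /H[].
Qed.

Lemma sweep_fresh E s w :
  fresh (unread s.1 E) (sweep s w) (fun s' => unread s'.1 E).
Proof.
apply: (fresh_foldT (Q := fun s' : phase1 => unread s'.1 E)) => t g.
apply: (fresh_foldT (Q := fun s' : phase1 => unread s'.1 E)) => t' u.
exact: touch_fresh.
Qed.

Lemma explore_fresh E v fuel i s :
  fresh (unread s.1 E) (explore v fuel i s) (fun s' => unread s'.1 E).
Proof.
elim: fuel i s => //= fuel IH i s; case: ifP => _; last by [].
by apply: fresh_bind (sweep_fresh E s _) _ => t; apply: IH.
Qed.

(* The tape after position n is divided into one block of size B per vertex. *)
Definition block v j x := (base v + j <= x < base v + B).

Definition blocks c x := exists2 u, c u = 0 & block u 0 x.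

Lemma block_inj v w x : block v 0 x -> block w 0 x -> v = w.
Proof.
rewrite /block /base !addn0 => /andP[v1 v2] /andP[w1 w2]; apply/val_inj.
case: (ltngtP v w) => // vw; have := leq_mul vw (leqnn B); rewrite mulSn; lia.
Qed.

(** A repair consumes its block from left to right, so what remains of it starts at the offset
    [s.1.2]; [E] collects the other blocks. *)
Definition unread2 v E (s : config * nat * seq nat) :=
  unread s.1.1 (fun x => block v s.1.2 x \/ E x).

Lemma redraw_fresh v E s f :
  (forall x, block v 0 x -> ~ E x) -> (s.1.2 + size f <= B) ->
  fresh (unread2 v E s) (foldT (redraw (base v)) s f) (unread2 v E) /\
  leaves (fun s' => s'.1.2 <= s.1.2 + size f) (foldT (redraw (base v)) s f).
Proof.
move=> HE; elim: f s => [|u f IH] s sB; first by split=> //=; rewrite addn0.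
split; last first.
  apply: leaves_bind; rewrite /redraw; case: ifP => _ /= => [b|].
    have sB' : (s.1.2.+1 + size f <= B) by rewrite addSnnS.
    have [_] := IH (upd s.1.1 u (3 + b), s.1.2.+1, catrev (inc u) s.2) sB'.
    by apply: leavesW => s'; rewrite /= addSnnS.
  have [|_] := IH s; first by apply: leq_trans sB; rewrite leq_add2l.
  by apply: leavesW => s'; rewrite /= addnS => /leqW.
rewrite [foldT _ _ _]/=; rewrite {1}/redraw; case: ifP => su; last first.
  by rewrite [bind _ _]/=; apply: (IH s _).1; rewrite /= in sB; lia.
split.
  right; rewrite /block /base; split; first by lia.
  by left; rewrite /= in sB; lia.
move=> b; rewrite [bind _ _]/=.
set t := (_, _, _); have [|+ _] := IH t; first by rewrite /t /= in sB *; lia.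
apply: freshW => // x [[w]|[nx Ex]] /=.
  rewrite /upd; case: (eqVneq w u) => [_ /eqP|wu cw ->]; first by rewrite addSn.
  split; first by left; exists w.
  by rewrite /base => wE; have := ltn_ord w; lia.
split; first by right; split=> //; case: Ex => [Bx|]; [left|right] => //;
  move: Bx; rewrite /block /=; lia.
case: Ex => [|Ex xE]; first by rewrite /block /=; lia.
by case: (HE x) => //; rewrite xE /block /=; rewrite /= in sB; lia.
Qed.

Lemma repair_fresh v E M c j st :
  (forall x, block v 0 x -> ~ E x) -> (j + M * k <= B) ->
  fresh (unread2 v E (c, j, st)) (repair (base v) M c j st)
        (fun r => unread r.2 E).
Proof.
have Hret c0 j0 st0 (ok : bool) : fresh (unread2 v E (c0, j0, st0)) (Ret (ok, c0))
    (fun r => unread r.2 E).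
  by move=> x [?|[nx Ex]]; [left|right; split=> //; right].
move=> HE; elim: M c j st => [|M IHM] c j st jB.
  elim: st => [|g st IHst]; first exact: Hret.
  rewrite [repair _ _ _ _ _]/=; case: ifP => _; last exact: IHst.
  exact: (Hret c j (g :: st) false).
elim: st => [|g st IHst]; first exact: Hret.
rewrite [repair _ _ _ _ _]/=; case: ifP => _; last exact: IHst.
have szg := ed_size g.
have [|F1 F2] := @redraw_fresh v E (c, j, st) (ed g) HE; first by rewrite /=; lia.
apply: fresh_bind_leaves F1 F2 _ => -[[c' j'] st'] /= j'B.
by apply: IHM; lia.
Qed.

Hypothesis B_ge : L + N * k <= B.

Lemma settle_fresh v E s : frozen_inv v s -> (forall x, block v 0 x -> ~ E x) ->
  fresh (unread2 v E (s.1, 0, [::])) (settle v s) (fun r => unread r.2 E).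
Proof.
move=> Hs HE; rewrite /settle; case: ifP => sL; last first.
  by move=> x [?|[nx Ex]]; [left|right; split=> //; right].
have [s3 sW uW _ _] := Hs.
have T0 : tentative s.1 s.1 by move=> u; case: ifP => // su; have := s3 u; lia.
have [|F1 F2] := @redraw_fresh v E (s.1, 0, [::]) s.2 HE; first by rewrite /=; lia.
have F3 := redraw_leaves (base v) (s := (s.1, 0, [::])) s.2 T0.
apply: fresh_bind_leaves F1 (leaves_and F2 F3) _ => -[[c' j'] st'] /= [j'L [T1 _ H3 _]].
have F4 := @repair_fresh v E N c' j' st' HE.
apply: fresh_bind_leaves (F4 _) (@repair_leaves (base v) s.1 N c' j' st' T1 _) _.
- by lia.
- move=> g /hasP[u ug su] _; apply: (H3 u) => //; last by rewrite incE.
  by rewrite -sW; have := s3 u; lia.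
move=> [ok c2] [/= T2 _] x [[u]|]; last by right.
rewrite finishE //; case: ifP => us; last by left; exists u.
(* A frozen vertex has a tentative color above 2, so subtracting 2 cannot make it untouched
   again. *)
have := T2 u; rewrite ifT; first by lia.
by move: us; rewrite -sW => /eqP ->.
Qed.

(** The query of an untouched [v] reads no block but that of [v], and a success leaves [v] colored,
    which removes the block from [blocks]. After a failure nothing is claimed to be unread, as
    [queries] stops there. *)
Lemma query_fresh v c : query_inv c ->
  fresh (unread c (blocks c)) (query v c)
        (fun r x => r.1 /\ unread r.2 (blocks r.2) x).
Proof.
move=> Hc; have [cv|cv] := boolP (c v != 0); first by rewrite query_done // => x [].
have {}cv : c v = 0 by apply/eqP/negPn.
pose E x := exists u, [/\ u != v, c u = 0 & block u 0 x].
have HE x : block v 0 x -> ~ E x.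
  by move=> vx [u [uv _ ux]]; rewrite (block_inj ux vx) eqxx in uv.
apply: (fresh_strengthen (Q1 := fun r => unread r.2 E) (P := fun r : bool * config =>
  r.1 -> [/\ query_inv r.2, r.2 v != 0 & refines c r.2])); last first.
- move=> [ok c'] /= H x [ok1 Hx]; have [_ c'v cc'] := H ok1.
  case: Hx => [|[nx [u c'u ux]]]; first by left.
  right; split=> //; exists u; split=> //.
    by apply/eqP => uv; rewrite -uv c'u in c'v.
  by apply/eqP; apply/contraT => cu; rewrite (cc' u cu) in c'u; rewrite c'u in cu.
- exact: query_leaves.
apply: fresh_bind_leaves (touch_fresh _ (c, [::]) v) (touch_start v Hc) _ => s [Hs cs].
apply: fresh_bind_leaves (explore_fresh _ v L 0 s) (explore_leaves Hs) _ => t [Ht ct st].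
apply: freshW (settle_fresh Ht HE) => // x [?|[nx Ex]]; [by left|right; split=> //].
by case: Ex => [Ex|[u [uv cu ux]]]; [exists v|exists u].
Qed.

Lemma queries_fresh qs c : query_inv c ->
  fresh (unread c (blocks c)) (queries qs c) (fun _ _ => False).
Proof.
elim: qs c => [|v qs IH] c Hc //=.
apply: fresh_bind_leaves (query_fresh v Hc) (query_leaves v Hc) _ => -[[] c'] /=.
  by move=> /(_ isT)[Hc' _ _]; apply: freshW (IH _ Hc') => // x [].
by [].
Qed.

End Freshness.

(** * Failure probability *)

Section Potential.
Variable R : realFieldType.
Local Open Scope ring_scope.

(* An upper bound on the conditional probability that g becomes critical. *)
Definition cap c g : R :=
  if two_colored c g then 0
  else (if colored c g == 0%N then 2 else 1) * 2 ^+ minn (colored c g) T / 2 ^+ T.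

Definition capP c (ct : seq nat) : R := \prod_(g <- ct) cap c g.

(** All the starting vertices are summed, since one potential has to serve every query of the
    sequence. *)
Definition potential m c : R :=
  \sum_(v : 'I_n) \sum_(ct <- certs m (inc v) [::]) capP c ct.

Lemma exp2_gt0 e : 0 < 2 ^+ e :> R.
Proof. by rewrite exprn_gt0. Qed.

Lemma cap_ge0 c g : 0 <= cap c g.
Proof.
rewrite /cap; case: ifP => // _; rewrite divr_ge0 ?mulr_ge0 ?ltW ?exp2_gt0 //.
by case: ifP.
Qed.

Lemma capP_ge0 c ct : 0 <= capP c ct.
Proof. by rewrite /capP; elim/big_ind: _ => // *; [apply: mulr_ge0|apply: cap_ge0]. Qed.

Lemma potential_ge0 m c : 0 <= potential m c.
Proof. by apply: sumr_ge0 => v _; apply: sumr_ge0 => ct _; apply: capP_ge0. Qed.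

Lemma cap_critical c g : critical c g -> cap c g = 1.
Proof.
rewrite criticalE /cap => /andP[/negPf -> Tc].
rewrite (minn_idPr Tc) ifF; last by apply/negbTE; lia.
by rewrite mul1r divff // gt_eqF ?exp2_gt0.
Qed.

Lemma cap_upd_notin c u a g : c u = 0%N -> u \notin ed g -> cap (upd c u a) g = cap c g.
Proof.
move=> cu0 /negPf ug; rewrite /cap /two_colored /colored !num_upd //.
by rewrite ug !muln0 !addn0.
Qed.

(** In an uncolored edge either color leads to cap 2 / 2^T, the value before. In an edge with
    vertices of one color only, the same color at most doubles the cap and the other color makes it
    0. *)
Lemma cap_upd_in c u g : c u = 0%N -> u \in ed g ->
  cap (upd c u 1) g + cap (upd c u 2) g <= 2 * cap c g.
Proof.
have T0 : 0 <= (2 ^+ T)^-1 :> R by rewrite invr_ge0 ltW ?exp2_gt0.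
move=> cu0 ug; rewrite /cap /two_colored /colored !num_upd // ug /=.
rewrite ?muln1 ?muln0 ?addn0 ?addn1 ?addnS ?addSn /=.
set a := num c 1 (ed g); set b := num c 2 (ed g).
have [/eqP Ea|a0] := posnP a; have [/eqP Eb|b0] := posnP b.
- rewrite (eqP Ea) (eqP Eb) /= (minn_idPl T_gt0) min0n expr0 expr1.
  by have := exp2_gt0 T; rewrite -invr_gt0 => H; lra.
- rewrite (eqP Ea) /= add0n ifF; last by apply/negbTE; lia.
  rewrite add0r !mul1r mulrA ler_wpM2r //.
  by rewrite -exprS ler_weXn2l ?ler1n //; lia.
- rewrite (eqP Eb) /= addn0 addr0 ifF; last by apply/negbTE; lia.
  rewrite !mul1r mulrA ler_wpM2r //.
  by rewrite -exprS ler_weXn2l ?ler1n //; lia.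
- by rewrite /= addr0 mulr0.
Qed.

(** Disjointness puts [u] in at most one edge of the family, so a single factor changes and the
    product inherits the inequality of [cap_upd_in]. *)
Lemma capP_upd c u ct : c u = 0%N -> disjoint_family ct ->
  capP (upd c u 1) ct + capP (upd c u 2) ct <= 2 * capP c ct.
Proof.
move=> cu0; rewrite /capP /disjoint_family; elim: ct => [|g ct IH] /=.
  by rewrite !big_nil; lra.
move=> /andP[/allP gct dct]; rewrite !big_cons; have [ug|ug] := boolP (u \in ed g).
  have E a : \prod_(h <- ct) cap (upd c u a) h = \prod_(h <- ct) cap c h.
    rewrite big_seq [RHS]big_seq; apply: eq_bigr => h hct.
    apply: cap_upd_notin => //; apply/negP => uh; case/negP: (gct h hct).
    by apply/hasP; exists u.
  rewrite !E -mulrDl mulrA ler_wpM2r ?cap_upd_in //.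
  exact: (capP_ge0 c ct).
rewrite !cap_upd_notin // -mulrDr mulrCA ler_wpM2l ?cap_ge0 //.
exact: IH.
Qed.

Lemma potential_upd m c u : c u = 0%N ->
  potential m (upd c u 1) + potential m (upd c u 2) <= 2 * potential m c.
Proof.
move=> cu0; rewrite /potential -big_split mulr_sumr; apply: ler_sum => v _ /=.
rewrite -big_split mulr_sumr /= big_seq [leRHS]big_seq; apply: ler_sum => ct ctP.
by apply: capP_upd => //; have [] := certsP ctP.
Qed.

Lemma Ex_touch m (s : phase1) u :
  Ex (fun s' : phase1 => potential m s'.1) (touch s u) <= potential m s.1.
Proof.
rewrite /touch; case: ifP => // /andP[/eqP cu0 _]; case: ifP => _ /=.
  rewrite le_eqVlt; apply/orP; left; apply/eqP.
  apply: eq_bigr => v _; apply: eq_bigr => ct _; apply: eq_bigr => g _.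
  by rewrite /cap /two_colored /colored !num_upd3.
by have := potential_upd m cu0; lra.
Qed.

Lemma Ex_sweep m (s : phase1) w :
  Ex (fun s' : phase1 => potential m s'.1) (sweep s w) <= potential m s.1.
Proof.
apply: (@Ex_foldT_le _ _ _ (fun=> True)) => //; first by move=> *; elim: foldT => /=.
move=> t g _ _; apply: (@Ex_foldT_le _ _ _ (fun=> True)) => //.
  by move=> *; elim: touch => /=.
by move=> *; apply: Ex_touch.
Qed.

Lemma Ex_explore m v fuel i (s : phase1) :
  Ex (fun s' : phase1 => potential m s'.1) (explore v fuel i s) <= potential m s.1.
Proof.
elim: fuel i s => //= fuel IH i s; case: ifP => // _.
rewrite Ex_bind; apply: le_trans (Ex_sweep m s (nth v s.2 i)).
by apply: Ex_le => t; apply: IH.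
Qed.

(** A single certificate whose edges are all critical already contributes 1. *)
Lemma frozen_potential v m (s : phase1) :
  frozen_inv v s -> (m * Q * k < size s.2)%N -> 1 <= potential m s.1.
Proof.
move=> Hs /(frozen_cert Hs)[ct ctin /allP ctc].
rewrite /potential (bigD1 v) //= (big_rem ct) //=.
have -> : capP s.1 ct = 1.
  rewrite /capP big_seq big1 // => g gct; exact: cap_critical (ctc g gct).
rewrite -addrA lerDl addr_ge0 //; first by apply: sumr_ge0 => *; apply: capP_ge0.
by apply: sumr_ge0 => *; apply: sumr_ge0 => *; apply: capP_ge0.
Qed.

(* A step of a search whose stack grows by X is paid for by the factor
   A ^+ X <= 4; popping one element saves a fraction of order 1 / X. *)
Definition growth_base X (A : R) := [/\ 1 <= A, 1 <= X%:R * (A - 1) & A ^+ X <= 4].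

(** For t = 1 - 1 / (2 X) take A = t^-2. Bernoulli's inequality gives t^X >= 1/2, hence A^X <= 4;
    and X (1 - t^2) = (1 + t) / 2 >= t^2 gives X (A - 1) >= 1. *)
Lemma growth_base_exists X : (0 < X)%N -> exists A, growth_base X A.
Proof.
move=> X0; have x0 : 0 < X%:R :> R by rewrite ltr0n.
have x1 : 1 <= X%:R :> R by rewrite ler1n.
pose t : R := 1 - (2 * X%:R)^-1.
have tE : 2 * X%:R * t = 2 * X%:R - 1 by rewrite /t; field; lra.
have t_half : 1 / 2 <= t.
  have : (2 * X%:R)^-1 <= 2^-1 :> R by rewrite lef_pV2 ?posrE; lra.
  by rewrite /t; lra.
have t1 : t <= 1 by rewrite /t lerBlDr lerDl invr_ge0; lra.
have bernoulli j : (j <= X)%N -> 1 - j%:R / (2 * X%:R) <= t ^+ j.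
  elim: j => [|j IH] jX; first by rewrite mul0r subr0 expr0.
  rewrite exprS; have := IH (ltnW jX) => H.
  have E : t * (1 - j%:R / (2 * X%:R)) =
      1 - j.+1%:R / (2 * X%:R) + j%:R / (2 * X%:R) * (2 * X%:R)^-1.
    by rewrite /t -natr1; ring.
  have : t * (1 - j%:R / (2 * X%:R)) <= t * t ^+ j by apply: ler_wpM2l => //; lra.
  rewrite E; apply: le_trans; rewrite lerDl.
  by rewrite !mulr_ge0 ?invr_ge0 ?mulr_ge0 ?ler0n.
have tX : 1 / 2 <= t ^+ X.
  apply: le_trans (bernoulli X (leqnn X)); rewrite invfM mulrCA divff ?gt_eqF //; lra.
have t0 : 0 < t by lra.
exists (t ^- 2); split.
- by rewrite -exprVn exprn_ege1 // invf_ge1.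
- have : t ^+ 2 * (X%:R * (t ^- 2 - 1)) = X%:R * (1 - t ^+ 2) by field; lra.
  have : 0 < t ^+ 2 by rewrite exprn_gt0.
  have : t ^+ 2 <= X%:R * (1 - t ^+ 2) by rewrite expr2; nra.
  move=> H1 H2 H3; rewrite -(ler_pM2l H2) H3 mulr1; exact: H1.
rewrite -exprVn -exprM mulnC exprM exprVn.
have : (t ^+ X)^-1 <= 2 by rewrite -[leRHS]invrK lef_pV2 ?posrE ?exprn_gt0 //; lra.
have : 0 <= (t ^+ X)^-1 by rewrite invr_ge0 exprn_ge0 // ltW.
by rewrite expr2; nra.
Qed.

(** A stack of size s has weight A^s. Popping an edge saves A^(s1 + 1) - A^s1 >= A^s1 / X, and e = 4
    x X turns the saving into 4 x A^s1, enough for a stack grown by X. The case x = 1 counts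
    certificates; for the repair, x bounds the probability that an edge is monochromatic. *)
Lemma step_bound X A (x : R) e s1 s2 M : growth_base X A -> 0 <= x -> (s2 <= X + s1)%N ->
  e = 4 * x * X%:R ->
  x * (A ^+ s2 * e ^+ M) + A ^+ s1 * e ^+ M.+1 <= A ^+ s1.+1 * e ^+ M.+1.
Proof.
move=> [A_ge1 A_step A_exp] x0 s2s Ee; have e0 : 0 <= e ^+ M by rewrite exprn_ge0 // Ee !mulr_ge0.
have As : A ^+ s2 <= 4 * A ^+ s1.
  apply: le_trans (_ : A ^+ (X + s1) <= _); first by rewrite ler_weXn2l.
  by rewrite exprD ler_wpM2r // exprn_ge0 // (le_trans _ A_ge1).
have As0 : 0 <= A ^+ s1 by rewrite exprn_ge0 // (le_trans _ A_ge1).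
have H : x * (A ^+ s2 * e ^+ M) <= x * (4 * A ^+ s1 * e ^+ M).
  by rewrite ler_wpM2l // ler_wpM2r.
have H2 : x * (4 * A ^+ s1 * e ^+ M) * 1 <=
    x * (4 * A ^+ s1 * e ^+ M) * (X%:R * (A - 1)).
  by rewrite ler_wpM2l // !mulr_ge0.
rewrite -lerBrDr; apply: le_trans H _; rewrite mulr1 in H2; apply: le_trans H2 _.
have -> : e ^+ M.+1 = 4 * x * X%:R * e ^+ M by rewrite exprS {1}Ee.
by rewrite exprS le_eqVlt; apply/orP; left; apply/eqP; ring.
Qed.

Lemma size_certs X A m st ch : growth_base X A -> (Q ^ 3 <= X)%N ->
  (size (certs m st ch))%:R <= A ^+ size st * (4 * X%:R) ^+ m.
Proof.
move=> gA QX; have [A_ge1 _ _] := gA; have A_ge0 := le_trans ler01 A_ge1.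
elim: m st ch => [|m IH] st ch.
  by rewrite /= expr0 mulr1 exprn_ege1.
rewrite /=; elim: st => [|g st IHst] /=; first by rewrite mulr_ge0 ?exprn_ge0 ?mulr_ge0 ?A_ge0.
rewrite size_cat natrD.
have sz : (size (nb3 g ++ st) <= X + size st)%N.
  by rewrite size_cat leq_add2r (leq_trans (size_nb3 g)).
have := step_bound m gA ler01 sz (erefl _); rewrite mul1r mulr1; apply: le_trans.
apply: lerD => //; case: ifP => _; last by rewrite size_map; apply: IH.
by rewrite mulr_ge0 ?exprn_ge0 ?mulr_ge0 ?A_ge0.
Qed.

(** Each edge starts with cap 2 / 2^T. The initial stack [inc v] has at most D <= Q^3 edges, so its
    weight is at most 4. *)
Lemma potential_init m : (0 < Q)%N ->
  potential m (fun=> 0%N) <= n%:R * (4 * (4 * (Q ^ 3)%:R * (2 / 2 ^+ T)) ^+ m).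
Proof.
move=> Q0; have X0 : (0 < Q ^ 3)%N by rewrite expn_gt0 Q0.
have [A gA] := growth_base_exists X0; have [A_ge1 _ A_exp] := gA.
have DX : (D <= Q ^ 3)%N.
  apply: (@leq_trans Q); last by rewrite -{1}(expn1 Q) leq_pexp2l.
  by move: Q0; rewrite muln_gt0 => /andP[k0 _]; rewrite leq_pmull.
rewrite /potential; apply: le_trans (_ : \sum_(v : 'I_n)
    (4 * (4 * (Q ^ 3)%:R * (2 / 2 ^+ T)) ^+ m) <= _); last first.
  by rewrite sumr_const card_ord -[leLHS]mulr_natl.
apply: ler_sum => v _; rewrite big_seq.
rewrite (eq_bigr (fun=> (2 / 2 ^+ T) ^+ m)); last first.
  move=> ct /certsP[<- _ _]; rewrite /capP.
  have cap0 g : cap (fun=> 0%N) g = 2 / 2 ^+ T.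
    have num0 a : (0 < a)%N -> num (fun=> 0%N) a (ed g) = 0%N.
      by move=> a0; apply/eqP; rewrite -leqn0 leqNgt -has_count; apply/hasPn => x _ /=; lia.
    by rewrite /cap /two_colored /colored !num0 //= min0n expr0 mulr1.
  by rewrite (eq_bigr _ (fun g _ => cap0 g)) big_const_seq count_predT iter_mulr_1.
rewrite -big_seq big_const_seq count_predT iter_addr_0 -[_ *+ size _]mulr_natl.
rewrite [X in _ <= _ * X]exprMn mulrA.
rewrite ler_wpM2r ?exprn_ge0 ?divr_ge0 ?exprn_ge0 //.
apply: le_trans (size_certs _ _ _ gA (leqnn _)) _; rewrite ler_wpM2r ?exprn_ge0 ?mulr_ge0 //.
by apply: le_trans A_exp; rewrite ler_weXn2l // (leq_trans (inc_size v)).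
Qed.

(** * Resampling of uniform colorings *)

Section Resampling.
Implicit Types (sg rho : {ffun 'I_n -> bool}) (f : seq 'I_n).

Definition tent c sg : config := fun u => if (2 < c u)%N then (3 + sg u)%N else c u.

Definition over sg f rho : {ffun 'I_n -> bool} :=
  [ffun u => if u \in f then rho u else sg u].

Definition avg (h : {ffun 'I_n -> bool} -> R) : R :=
  (\sum_rho h rho) / #|{: {ffun 'I_n -> bool}}|%:R.

Lemma card_neq0 : #|{: {ffun 'I_n -> bool}}|%:R != 0 :> R.
Proof. by rewrite card_ffun card_bool pnatr_eq0 expn_eq0. Qed.

Lemma avg_le h1 h2 : (forall sg, h1 sg <= h2 sg) -> avg h1 <= avg h2.
Proof. by move=> H; rewrite ler_wpM2r ?invr_ge0 ?ler0n // ler_sum. Qed.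

Lemma avgD h1 h2 : avg (fun sg => h1 sg + h2 sg) = avg h1 + avg h2.
Proof. by rewrite /avg big_split mulrDl. Qed.

Lemma avg_cst x : avg (fun=> x) = x.
Proof. by rewrite /avg sumr_const -[_ *+ #|_|]mulr_natr -mulrA divff ?mulr1 ?card_neq0. Qed.

Lemma avgZ x h : avg (fun sg => x * h sg) = x * avg h.
Proof. by rewrite /avg -mulr_sumr mulrA. Qed.

Lemma avgZr x h : avg (fun sg => h sg * x) = avg h * x.
Proof. by rewrite /avg -mulr_suml mulrAC. Qed.

(* Swapping the restrictions of sg and rho to f makes chi and h independent. *)
Lemma avg_resample f (chi h : {ffun 'I_n -> bool} -> R) :
  (forall sg rho, chi (over sg f rho) = chi rho) ->
  avg (fun sg => chi sg * avg (fun rho => h (over sg f rho))) = avg chi * avg h.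
Proof.
move=> Hchi; pose swap (p : {ffun 'I_n -> bool} * {ffun 'I_n -> bool}) :=
  (over p.1 f p.2, over p.2 f p.1).
have swapK : involutive swap.
  move=> [sg rho]; congr pair; apply/ffunP => u; rewrite !ffunE /=;
    by case: ifP => // uf; rewrite ?uf.
transitivity (avg (fun sg => avg (fun rho => chi sg * h (over sg f rho)))).
  by rewrite /avg; congr (_ / _); apply: eq_bigr => sg _; rewrite -mulr_sumr mulrA.
transitivity (avg (fun sg => avg (fun rho => chi rho * h sg))); last first.
  by rewrite -avgZ; congr avg; apply: funext => sg; rewrite avgZr.
rewrite /avg -!mulr_suml; congr (_ / _ / _).
rewrite !pair_bigA (reindex_inj (inv_inj swapK)) /=; apply: eq_bigr => -[sg rho] _ /=.
rewrite Hchi; congr (_ * h _); apply/ffunP => u; rewrite !ffunE.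
by case: ifP => // uf; rewrite ?uf.
Qed.

Lemma avg_flip u (H : bool -> {ffun 'I_n -> bool} -> R) :
  (forall b sg x, H b (over sg [:: u] x) = H b sg) ->
  avg (fun sg => H (sg u) sg) = (avg (H true) + avg (H false)) / 2.
Proof.
move=> HH; rewrite /avg -mulrDl mulrAC; congr (_ / _).
apply: (sum_flip (phi := fun sg => over sg [:: u] [ffun x => ~~ sg x])
  (v := fun sg : {ffun 'I_n -> bool} => sg u)).
- move=> sg; apply/ffunP => x; rewrite !ffunE inE.
  by case: (x == u); rewrite ?negbK.
- by move=> sg; rewrite !ffunE inE eqxx.
- by move=> b sg; rewrite HH.
Qed.

Definition push c (st : seq nat) f :=
  foldl (fun st u => if (2 < c u)%N then catrev (inc u) st else st) st f.

(** Distinct vertices get independent bits, so drawing them one by one amounts to overwriting [sg]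
    on [f] with a uniform [rho]. The stack and the tape position depend on [c] only. *)
Lemma Ex_redraw F b0 c sg j st f : uniq f ->
  Ex F (foldT (redraw b0) (tent c sg, j, st) f) =
  avg (fun rho => F (tent c (over sg f rho), (j + count (fun u => (2 < c u)%N) f)%N, push c st f)).
Proof.
elim: f sg j st => [|u f IH] sg j st.
  move=> _; rewrite /= -[LHS]avg_cst; congr (_ / _); apply: eq_bigr => rho _.
  by rewrite addn0; congr (F (_, _, _)); congr tent; apply/ffunP => x; rewrite ffunE.
move=> /= /andP[uf uniqf]; rewrite Ex_bind.
have -> : redraw b0 (tent c sg, j, st) u = if (2 < c u)%N then
    Flip (b0 + j) (fun b : bool => Ret (upd (tent c sg) u (3 + b)%N, j.+1, catrev (inc u) st))
    else Ret (tent c sg, j, st).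
  by rewrite /redraw /= {1}/tent; case: (ltnP 2 (c u)) => cu //; rewrite ltnNge cu.
case: ifP => cu; last first.
  rewrite /= IH // add0n; congr (_ / _); apply: eq_bigr => rho _; congr (F (_, _, _)).
  apply: funext => x; rewrite /tent; case: ifP => // cx; rewrite !ffunE in_cons.
  by case: eqVneq => // xu; rewrite xu cu in cx.
have tentb (b : bool) : upd (tent c sg) u (3 + b)%N = tent c (over sg [:: u] [ffun=> b]).
  apply: funext => x; rewrite /upd /tent; case: (eqVneq x u) => [->|xu].
    by rewrite cu ffunE inE eqxx ffunE.
  by rewrite ffunE inE (negPf xu).
have := tentb false; have := tentb true; rewrite /= => -> ->; rewrite !IH //.
pose H b rho := F (tent c (over (over sg [:: u] [ffun=> b]) f rho),
  (j.+1 + count (fun u => (2 < c u)%N) f)%N, push c (catrev (inc u) st) f).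
rewrite -(@avg_flip u H) => [|b rho x]; last first.
  congr (F (_, _, _)); congr tent; apply/ffunP => y; rewrite !ffunE.
  case: ifP => // yf; rewrite inE; case: eqVneq => // yu.
  by rewrite -yu yf in uf.
congr (_ / _); apply: eq_bigr => rho _; rewrite /H addnA addn1; congr (F (_, _, _)).
apply: funext => x; rewrite /tent; case: ifP => // _; rewrite !ffunE !in_cons in_nil orbF.
by case: (eqVneq x u) => [->|_] //=; rewrite (negPf uf).
Qed.

Lemma size_push c st f : (size (push c st f) <= size st + size f * D)%N.
Proof.
elim: f st => [|u f IH] st /=; first by rewrite addn0.
apply: leq_trans (IH _) _; rewrite mulSn addnA leq_add2r.
case: ifP => _; last exact: leq_addr.
by rewrite catrevE size_cat size_rev addnC leq_add2l.
Qed.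

Lemma mem_push c st f g : (g \in push c st f) =
  (g \in st) || has (fun u => (2 < c u)%N && (g \in inc u)) f.
Proof.
elim: f st => [|u f IH] st /=; first by rewrite orbF.
by rewrite IH; case: ifP => _ /=; rewrite // catrevE mem_cat mem_rev orbCA orbA.
Qed.

Definition failure (r : bool * config) : R := (~~ r.1)%:R.

Variables (c : config) (p : R).
Definition unlikely g := avg (fun sg => (mono (tent c sg) g)%:R) <= p.
Hypothesis p_ge0 : 0 <= p.
Hypothesis frozen_unlikely : forall u g, (2 < c u)%N -> g \in inc u -> unlikely g.

Lemma Ex_failure_le1 T' (m : tree T') (F : T' -> bool) : Ex (fun r => (F r)%:R) m <= 1 :> R.
Proof. by rewrite -[leRHS](Ex_cst (1 : R) m); apply: Ex_le => r; rewrite lern1 leq_b1. Qed.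

(* By [avg_resample] the coloring after a resampling is again uniform, whatever
   edge was found monochromatic; so the induction hypothesis applies to it. *)
Lemma repair_failure X A b0 M j st : growth_base X A -> (Q <= X)%N ->
  {in st, forall g, unlikely g} ->
  avg (fun sg => Ex failure (repair b0 M (tent c sg) j st)) <=
  A ^+ size st * (4 * p * X%:R) ^+ M.
Proof.
move=> gA QX; have [A_ge1 _ _] := gA; have A_ge0 := le_trans ler01 A_ge1.
have e0 M' : 0 <= (4 * p * X%:R) ^+ M' by rewrite exprn_ge0 ?mulr_ge0.
elim: M j st => [|M IHM] j st.
  move=> _; case: st => [|g st] /=.
    by rewrite /failure /= avg_cst mul1r expr0.
  rewrite expr0 mulr1; apply: le_trans (_ : 1 <= _); last first.
    by rewrite exprn_ege1.
  rewrite -[leRHS]avg_cst; apply: avg_le => sg; exact: Ex_failure_le1.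
elim: st => [|g st IHst] good.
  by rewrite /= /failure /= avg_cst mulr_ge0 ?e0 ?exprn_ge0 ?A_ge0.
pose st' := push c st (ed g); pose j' := (j + count (fun u => (2 < c u)%N) (ed g))%N.
pose G sg := Ex failure (repair b0 M (tent c sg) j' st').
(* The branch that continues with [st] is counted in both cases. This avoids conditioning on [g]
   having two colors, so the coloring in that term is still uniform. *)
apply: le_trans (_ : avg (fun sg => (mono (tent c sg) g)%:R *
    avg (fun rho => G (over sg (ed g) rho)) +
    Ex failure (repair b0 M.+1 (tent c sg) j st)) <= _).
  apply: avg_le => sg; rewrite [repair b0 M.+1 _ _ _]/=.
  case: ifP => _; last by rewrite mul0r add0r.
  rewrite mul1r Ex_bind Ex_redraw // lerDl.
  by apply: Ex_ge0 => r; rewrite ler0n.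
rewrite avgD avg_resample; last first.
  move=> sg rho; congr (_ : bool)%:R; rewrite /mono.
  have -> // : count (fun u => odd (tent c (over sg (ed g) rho) u)) (ed g) =
               count (fun u => odd (tent c rho u)) (ed g).
  by apply: eq_in_count => u ug; rewrite /tent ffunE ug.
have gg : unlikely g by apply: good; rewrite mem_head.
have goodst : {in st, forall g, unlikely g}.
  by move=> h hst; apply: good; rewrite in_cons hst orbT.
have sz : (size st' <= X + size st)%N.
  apply: leq_trans (size_push _ _ _) _; rewrite addnC leq_add2r.
  by apply: leq_trans QX; rewrite leq_mul ?ed_size.
apply: le_trans (step_bound M gA p_ge0 sz (erefl _)); apply: lerD (IHst goodst).
apply: ler_pM => //.
- by rewrite -[0](avg_cst 0); apply: avg_le => sg; rewrite ler0n.
- by rewrite -[0](avg_cst 0); apply: avg_le => sg; apply: Ex_ge0 => r; rewrite ler0n.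
apply: IHM => h; rewrite mem_push => /orP[/goodst //|/hasP[u _ /andP[cu hu]]].
exact: frozen_unlikely cu hu.
Qed.

End Resampling.

(** * Failure probability of a sequence of queries *)

Lemma card_agree (F : {set 'I_n}) b :
  #|[set sg : {ffun 'I_n -> bool} | [forall u in F, sg u == b]]| = (2 ^ #|~: F|)%N.
Proof.
rewrite -card_bool -(card_pffun_on b (~: F) predT) cardsE.
apply: eq_card => sg; rewrite inE; apply/forall_inP/pffun_onP => [H|[H _] u uF].
  split=> //; apply/fintype.subsetP => u; rewrite !inE; apply: contra => uF.
  exact: H.
apply/negPn/negP => ub; have := fintype.subsetP H u; rewrite !inE uF.
by move/(_ ub).
Qed.

Lemma avg_agree (F : {set 'I_n}) b :
  avg (fun sg => ([forall u in F, sg u == b] : bool)%:R) = (2 ^+ #|F|)^-1.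
Proof.
rewrite /avg -natr_sum (_ : (\sum_i _)%N = (2 ^ #|~: F|)%N); last first.
  rewrite -(card_agree F b) -sum1dep_card [RHS]big_mkcond /=.
  by apply: eq_bigr => sg _; case: ifP.
rewrite card_ffun card_bool -(cardsC F) expnD.
by rewrite natrM !natrX invfM mulrCA divff ?mulr1 // expf_neq0 // pnatr_eq0.
Qed.

(** Without two final colors the edge has at least [k - T] frozen vertices, whose bits all have to
    agree: probability at most 2^-(k - T) for each of the two values. *)
Lemma mono_unlikely c g : size (ed g) = k ->
  (forall u, u \in ed g -> (0 < c u <= 3)%N) ->
  two_colored c g \/ (colored c g <= T)%N -> unlikely c (2 / 2 ^+ (k - T)) g.
Proof.
move=> sz c3 Hg; rewrite /unlikely; have p0 : 0 <= 2 / 2 ^+ (k - T) :> R.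
  by rewrite divr_ge0 ?exprn_ge0.
case tw: (two_colored c g).
  rewrite -[leRHS](avg_cst (2 / 2 ^+ (k - T))); apply: avg_le => sg.
  have /andP[/num_gt0P[u ug cu] /num_gt0P[w wg cw]] := tw.
  rewrite (negPf (two_colored_mono sz _ _)) //; first by exists u => //; rewrite /tent cu.
  by exists w => //; rewrite /tent cw.
case: Hg => [|Hg]; first by rewrite tw.
pose F := [set u in ed g | c u == 3%N].
have cF : (k - T <= #|F|)%N.
  have -> : #|F| = num c 3%N (ed g).
    rewrite /num -size_filter -(card_uniqP _) ?filter_uniq //.
    by apply: eq_card => u; rewrite inE mem_filter andbC.
  by have := num_partition c3; move: Hg; rewrite /colored sz; lia.
apply: le_trans (_ : avg (fun sg => ([forall u in F, sg u == true] : bool)%:R +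
    ([forall u in F, sg u == false] : bool)%:R) <= _).
  apply: avg_le => sg; rewrite -natrD ler_nat.
  case mg: (mono _ _) => //; rewrite /mono -sz in mg; have [|] := orP mg.
    rewrite -leqn0 leqNgt -has_count => /hasPn H; rewrite addn_gt0 lt0b.
    apply/orP; left; apply/forall_inP => u; rewrite inE => /andP[ug /eqP cu].
    by have := H u ug; rewrite /tent cu /=; case: (sg u).
  rewrite -all_count => /allP H; rewrite addn_gt0 !lt0b.
  apply/orP; right; apply/forall_inP => u; rewrite inE => /andP[ug /eqP cu].
  by have := H u ug; rewrite /tent cu /=; case: (sg u).
have : (2 ^+ #|F|)^-1 <= (2 ^+ (k - T))^-1 :> R.
  by rewrite lef_pV2 ?posrE ?exp2_gt0 // ler_weXn2l // ler1n.
by rewrite avgD !avg_agree; lra.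
Qed.

(** A repair gives cap 0 to the edges that it changes and leaves the caps of the others. *)
Lemma settled_potential m c c' : settled c c' -> potential m c' <= potential m c.
Proof.
move=> [_ _ H]; apply: ler_sum => v _; apply: ler_sum => ct _.
rewrite /capP; elim: ct => [|g ct IH]; first by rewrite !big_nil.
rewrite !big_cons; apply: ler_pM => //; first exact: cap_ge0.
  exact: capP_ge0.
have [E|tw] := H g; last by rewrite {1}/cap tw cap_ge0.
have En a : num c' a (ed g) = num c a (ed g) by apply: eq_in_count => u /E ->.
by rewrite /cap /two_colored /colored !En.
Qed.

Variable m : nat.
Hypothesis L_ge : (m * Q * k <= L)%N.
Hypothesis Q_gt0 : (0 < Q)%N.
Hypothesis p_le : 4 * (2 / 2 ^+ (k - T)) * Q%:R <= 1 / 2 :> R.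

(** The numerator bounds the weight A^(Q L) of the initial stack of a repair, and each resampling
    contributes a factor 1/2. *)
Definition err : R := 4 ^+ L / 2 ^+ N.

Lemma err_ge0 : 0 <= err.
Proof. by rewrite divr_ge0 ?exprn_ge0. Qed.

Lemma settle_failure v s : frozen_inv v s -> closed_frontier s -> (size s.2 <= L)%N ->
  Ex failure (settle v s) <= err.
Proof.
move=> Hs Hcl sL; rewrite /settle sL Ex_bind; have [s3 sW uW sl _] := Hs.
(* Color 3 is the tentative color of the bit [false]; the first round of draws replaces this
   assignment by a uniform one. *)
have -> : s.1 = tent s.1 [ffun=> false].
  apply: funext => u; rewrite /tent ffunE; case: ifP => // su.
  by have := s3 u; lia.
rewrite Ex_redraw //; set f := push _ _ _.
have WE u : (2 < s.1 u)%N = (u \in s.2) by rewrite -sW; have := s3 u; lia.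
pose p : R := 2 / 2 ^+ (k - T).
have p0 : 0 <= p by rewrite divr_ge0 ?exprn_ge0.
have [A gA] := growth_base_exists Q_gt0; have [A_ge1 _ A_exp] := gA.
have A_ge0 := le_trans ler01 A_ge1.
have Hu u g : (2 < s.1 u)%N -> g \in inc u -> unlikely s.1 p g.
  move=> su gu; have tg : touches_frozen s.1 g by apply/hasP; exists u; rewrite -?incE.
  by have [sz pos] := closed_frozen Hs Hcl sL tg; apply: mono_unlikely.
apply: (@le_trans _ _ (avg (fun rho => Ex failure (repair (base v) N (tent s.1 rho)
    (0 + count (fun u => (2 < s.1 u)%N) s.2)%N f)))).
  apply: avg_le => rho; rewrite Ex_bind le_eqVlt; apply/orP; left; apply/eqP.
  have -> // : tent s.1 (over [ffun=> false] s.2 rho) = tent s.1 rho.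
  by apply: funext => u; rewrite /tent; case: ifP => // su; rewrite ffunE -WE su.
have Hst : {in f, forall g, unlikely s.1 p g}.
  move=> g; rewrite mem_push in_nil /= => /hasP[u uW' /andP[su gu]].
  exact: Hu su gu.
apply: le_trans (repair_failure p0 Hu (base v) N _ gA (leqnn Q) Hst) _.
have szf : (size f <= Q * L)%N.
  apply: leq_trans (size_push _ _ _) _; rewrite add0n mulnC leq_mul //.
  by move: Q_gt0; rewrite muln_gt0 => /andP[k0 _]; rewrite leq_pmull.
have e0 : 0 <= 4 * p * Q%:R by apply: mulr_ge0 => //; apply: mulr_ge0.
apply: ler_pM; rewrite ?(exprn_ge0 _ e0) ?exprn_ge0 ?A_ge0 //.
  apply: (@le_trans _ _ (A ^+ (Q * L))); first by rewrite ler_weXn2l.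
  by rewrite exprM lerXn2r ?nnegrE ?exprn_ge0 ?A_ge0.
rewrite -exprVn lerXn2r ?nnegrE ?invr_ge0 //.
by apply: le_trans p_le _; rewrite mul1r.
Qed.

(* A search that fails makes the potential at least 1; a repair is charged to a
   vertex that the query leaves no longer untouched. *)
Definition bound c : R := potential m c + (untouched c)%:R * err.

Lemma query_bound v c : query_inv c ->
  Ex (fun r : bool * config => if r.1 then bound r.2 else 1) (query v c) <= bound c.
Proof.
move=> Hc; have [cv|cv] := boolP (c v != 0%N); first by rewrite query_done.
have {}cv : c v = 0%N by apply/eqP/negPn.
rewrite /query Ex_bind.
pose e := (untouched c)%:R * err.
apply: (@le_trans _ _ (Ex (fun s : phase1 => potential m s.1 + e) (touch (c, [::]) v))); last first.
  by rewrite ExD Ex_cst /bound lerD2r (Ex_touch m (c, [::])).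
apply: Ex_le_leaves.
apply: leavesW (leaves_and (touch_start v Hc) (touch_nonzero v c)) => s [[Hs cs] sv].
rewrite Ex_bind.
apply: (@le_trans _ _ (Ex (fun s : phase1 => potential m s.1 + e) (explore v L 0 s))); last first.
  by rewrite ExD Ex_cst lerD2r Ex_explore.
apply: Ex_le_leaves; apply: leavesW (explore_leaves Hs) => t [Ht ct st].
have e0 : 0 <= e by rewrite mulr_ge0 ?err_ge0.
have [tL|tL] := leqP (size t.2) L; last first.
  rewrite /settle leqNgt tL /=; apply: le_trans (frozen_potential (m := m) Ht _) _.
    exact: leq_ltn_trans L_ge tL.
  by rewrite lerDl.
(* A success leaves at least one vertex fewer untouched; the [err] that this frees pays for the
   failure of the repair. *)
apply: (@le_trans _ _ (Ex (fun r => failure r + (potential m t.1 + (e - err))) (settle v t))).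
  apply: Ex_le_leaves; apply: leavesW (settle_leaves Ht ct) => -[ok c'] /= Hok.
  rewrite /failure /=; case: ok Hok => /= [/(_ isT) stl|_]; last first.
    rewrite -[X in X <= _]addr0 lerD2l addr_ge0 ?potential_ge0 // subr_ge0 /e.
    rewrite -[leLHS]mul1r ler_wpM2r ?err_ge0 // ler1n.
    by apply/card_gt0P; exists v; rewrite inE cv.
  have tv : t.1 v != 0%N by have [E _] := st; rewrite E.
  have := untouched_decr cv (settled_nonzero Ht stl tv)
    (settled_refines Hc (extends_trans cs st) stl).
  rewrite -(ler_nat R) => lt.
  have := ler_wpM2r err_ge0 lt; rewrite -natr1 mulrDl mul1r -/e => lt'.
  have := settled_potential m stl; rewrite /bound; lra.
by rewrite ExD Ex_cst; have := settle_failure Ht ct tL; lra.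
Qed.

Theorem queries_failure qs c : query_inv c -> Ex failure (queries qs c) <= bound c.
Proof.
elim: qs c => [|v qs IH] c Hc /=.
  by rewrite /failure /= addr_ge0 ?potential_ge0 // mulr_ge0 ?err_ge0.
rewrite Ex_bind; apply: le_trans (query_bound v Hc); apply: Ex_le_leaves.
apply: leavesW (query_leaves v Hc) => -[[] c'] //= /(_ isT)[Hc' _ _].
exact: IH.
Qed.

End Potential.
End Model.

(** * The program *)

Notation "p ;; q" := (Seq p q) (at level 70, right associativity).

Definition For (i f b : nat) (body : cmd) : cmd :=
  Const i 0 ;; Op OpLt f i b ;;
  While f (body ;; Op OpAdd i i 1 ;; Op OpLt f i b).

(* Registers that the query only initializes: 1 holds 1, 2 the number of vertices,
   3 the edge size k, 4 the bound L, 7 the address of the stack, 9, 11, 12 and 13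
   the constants 0, T - 1, 2 and 3.  Register 0 holds the queried vertex, 10 the
   number of frozen vertices, 5 the next tape address, 6 the number of resamplings
   left and 8 the end of the stack. *)
Definition p_critical : cmd :=
  Const 29 0 ;; Const 30 0 ;;
  For 31 32 3 (Vertex 33 28 31 ;; ReadMem 33 33 ;;
    Op OpEq 34 33 1 ;; Op OpAdd 29 29 34 ;;
    Op OpEq 34 33 12 ;; Op OpAdd 30 30 34) ;;
  Op OpMul 24 29 30 ;; Op OpEq 24 24 9 ;;
  Op OpAdd 34 29 30 ;; Op OpLt 34 11 34 ;; Op OpMul 24 24 34.

Definition p_touch : cmd :=
  ReadMem 21 20 ;; Op OpEq 21 21 9 ;; Op OpAdd 22 4 1 ;; Op OpLt 22 10 22 ;;
  Op OpMul 21 21 22 ;;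
  If 21
    (Const 23 0 ;; Degree 25 20 ;;
     For 26 27 25 (Edge 28 20 26 ;; p_critical ;; Op OpAdd 23 23 24) ;;
     If 23
       (WriteMem 20 13 ;; Op OpAdd 24 2 10 ;; WriteMem 24 20 ;; Op OpAdd 10 10 1)
       (RandomBit 24 20 ;; Op OpAdd 24 24 1 ;; WriteMem 20 24))
    Skip.

Definition p_guard : cmd :=
  Op OpLt 16 15 10 ;; Op OpAdd 17 4 1 ;; Op OpLt 17 10 17 ;; Op OpMul 16 16 17.

Definition p_explore : cmd :=
  Const 15 0 ;; p_guard ;;
  While 16
    (Op OpAdd 17 2 15 ;; ReadMem 17 17 ;; Degree 18 17 ;;
     For 35 36 18 (Edge 37 17 35 ;; For 38 39 3 (Vertex 20 37 38 ;; p_touch)) ;;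
     Op OpAdd 15 15 1 ;; p_guard).

Definition p_redraw : cmd :=
  ReadMem 21 20 ;; Op OpLt 21 12 21 ;;
  If 21
    (RandomBit 22 5 ;; Op OpAdd 22 22 13 ;; WriteMem 20 22 ;; Op OpAdd 5 5 1 ;;
     Degree 25 20 ;;
     For 26 27 25 (Edge 28 20 26 ;; WriteMem 8 28 ;; Op OpAdd 8 8 1))
    Skip.

Definition p_mono : cmd :=
  Const 29 0 ;;
  For 31 32 3 (Vertex 33 37 31 ;; ReadMem 33 33 ;; Op OpMod 33 33 12 ;;
    Op OpAdd 29 29 33) ;;
  Op OpEq 24 29 9 ;; Op OpEq 34 29 3 ;; Op OpAdd 24 24 34.

(** When the budget in register 6 is exhausted, the stack is emptied and the loop ends. The machine
    keeps no record of a failure; the flag exists in the tree only. *)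
Definition p_repair : cmd :=
  Op OpLt 16 7 8 ;;
  While 16
    (Op OpSub 8 8 1 ;; ReadMem 37 8 ;; p_mono ;;
     If 24
       (If 6
          (Op OpSub 6 6 1 ;; For 38 39 3 (Vertex 20 37 38 ;; p_redraw))
          (Op OpAdd 8 7 9))
       Skip ;;
     Op OpLt 16 7 8).

Definition p_settle : cmd :=
  Op OpAdd 8 7 9 ;;
  For 35 36 10 (Op OpAdd 20 2 35 ;; ReadMem 20 20 ;; p_redraw) ;;
  p_repair ;;
  For 35 36 10 (Op OpAdd 20 2 35 ;; ReadMem 20 20 ;; ReadMem 21 20 ;;
    Op OpSub 21 21 12 ;; WriteMem 20 21).

(** The loop counts the halvings that bring n to 0, that is [(trunc_log 2 n).+1], the factor that
    scales [cL], [cN] and [cB]. *)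
Definition p_init (k T cL cN cB : nat) : cmd :=
  Const 1 1 ;; Const 12 2 ;; Const 13 3 ;; Const 3 k ;; Const 11 T.-1 ;;
  NumVertices 2 ;; Op OpAdd 40 2 9 ;;
  While 40 (Op OpDiv 40 40 12 ;; Op OpAdd 41 41 1) ;;
  Const 42 cL ;; Op OpMul 4 42 41 ;; Const 42 cN ;; Op OpMul 6 42 41 ;;
  Const 42 cB ;; Op OpMul 42 42 41 ;; Op OpMul 42 0 42 ;; Op OpAdd 5 2 42 ;;
  Op OpAdd 7 2 4 ;; Op OpAdd 7 7 1 ;; Op OpAdd 20 0 9.

Definition p_query (k T cL cN cB : nat) : cmd :=
  p_init k T cL cN cB ;; p_touch ;; p_explore ;;
  Op OpAdd 17 4 1 ;; Op OpLt 16 10 17 ;; If 16 p_settle Skip ;;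
  ReadMem 0 0 ;; Op OpSub 0 0 1.

(** * Timed Hoare rules for the machine *)

Section Hoare.
Context {n : nat} {E : hypergraph n} (G : representation E).
Variables (w s : nat) (r : tape w).

Definition ex (t : nat) (p : cmd) (st : state) (P : state -> Prop) : Prop :=
  exists2 st', P st' &
    exists2 t0, t0 <= t & forall t' todo, run (t0 + t') s G r (p :: todo) st = run t' s G r todo st'.

Lemma ex_le t t' p st P : ex t p st P -> t <= t' -> ex t' p st P.
Proof. by move=> [st' H [t0 le H']] tt'; exists st' => //; exists t0 => //; apply: leq_trans tt'. Qed.

Lemma exW t p st (P P' : state -> Prop) :
  (forall st', P st' -> P' st') -> ex t p st P -> ex t p st P'.
Proof. by move=> PP' [st' /PP' H H']; exists st'. Qed.

Lemma ex_step p st st' (P : state -> Prop) :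
  (forall todo, step s G r p todo st = Some (todo, st')) -> P st' -> ex 1 p st P.
Proof. by move=> H HP; exists st' => //; exists 1 => // t' todo; rewrite /= H. Qed.

Lemma ex_assign p x a R m (P : state -> Prop) :
  (forall todo, step s G r p todo (State R m) = Some (todo, set_reg w (State R m) x a)) ->
  a < 2 ^ w -> P (State (update R x a) m) -> ex 1 p (State R m) P.
Proof.
move=> H aw HP; apply: ex_step H _.
by rewrite /set_reg modn_small.
Qed.

Lemma ex_skip st (P : state -> Prop) : P st -> ex 1 Skip st P.
Proof. exact: ex_step. Qed.

Lemma ex_const x a R m (P : state -> Prop) :
  a < 2 ^ w -> P (State (update R x a) m) -> ex 1 (Const x a) (State R m) P.
Proof. exact: ex_assign. Qed.

Lemma ex_op o x y z R m (P : state -> Prop) :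
  eval_binop o (R y) (R z) < 2 ^ w ->
  P (State (update R x (eval_binop o (R y) (R z))) m) -> ex 1 (Op o x y z) (State R m) P.
Proof. exact: ex_assign. Qed.

Lemma ex_read x y R m (P : state -> Prop) :
  R y < s -> m (R y) < 2 ^ w -> P (State (update R x (m (R y))) m) ->
  ex 1 (ReadMem x y) (State R m) P.
Proof. by move=> Hs; apply: ex_assign => todo; rewrite /= Hs. Qed.

Lemma ex_write x y R m (P : state -> Prop) :
  R x < s -> P (State R (update m (R x) (R y))) -> ex 1 (WriteMem x y) (State R m) P.
Proof. by move=> Hs; apply: ex_step => todo; rewrite /= Hs. Qed.

Lemma ex_bit x y R m (P : state -> Prop) : 0 < w ->
  P (State (update R x (nth false r (R y))) m) -> ex 1 (RandomBit x y) (State R m) P.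
Proof.
move=> w0; apply: ex_assign => //; apply: leq_ltn_trans (leq_b1 _) _.
by rewrite -{1}(expn0 2) ltn_exp2l.
Qed.

Lemma ex_seq t1 t2 p q st P :
  ex t1 p st (fun st' => ex t2 q st' P) -> ex (t1 + t2).+1 (Seq p q) st P.
Proof.
move=> [st1 [st2 HP [t02 le2 H2]] [t01 le1 H1]]; exists st2 => //.
exists (t01 + t02).+1; first by lia.
by move=> t' todo; rewrite /= -addnA H1 H2.
Qed.

Lemma ex_if t1 t2 x p q st P :
  (regs st x != 0 -> ex t1 p st P) -> (regs st x = 0 -> ex t2 q st P) ->
  ex (t1 + t2).+1 (If x p q) st P.
Proof.
move=> Hp Hq; case: (eqVneq (regs st x) 0) => [x0|x0].
  have [st' HP [t0 le H]] := Hq x0; exists st' => //; exists t0.+1; first by lia.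
  by move=> t' todo; rewrite /= x0 /= H.
have [st' HP [t0 le H]] := Hp x0; exists st' => //; exists t0.+1; first by lia.
by move=> t' todo; rewrite /= x0 /= H.
Qed.

Lemma ex_while (I : nat -> state -> Prop) t x p J st (P : state -> Prop) :
  (forall j st, I j st -> regs st x != 0 ->
     ex t p st (fun st' => exists2 j', j' < j & I j' st')) ->
  (forall j st, I j st -> regs st x = 0 -> P st) ->
  I J st -> ex (J * t.+1).+1 (While x p) st P.
Proof.
move=> Hbody Hend; have [b Jb] := ubnP J; elim: b J st Jb => // b IH J st Jb HI.
case: (eqVneq (regs st x) 0) => [x0|x0].
  exists st; first exact: Hend HI x0.
  by exists 1 => // t' todo; rewrite /= x0.
have [st1 [J' J'J HI'] [t01 le1 H1]] := Hbody _ _ HI x0.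
have [st2 HP [t02 le2 H2]] := IH J' st1 ltac:(lia) HI'.
exists st2 => //; exists (t01 + t02).+1.
  have := leq_mul J'J (leqnn t.+1); rewrite mulSn; lia.
by move=> t' todo; rewrite /= x0 -addnA H1 H2.
Qed.

Definition frame (md : pred nat) (R R' : store) := forall x, ~~ md x -> R' x = R x.

Lemma frame_trans md R1 R2 R3 : frame md R1 R2 -> frame md R2 R3 -> frame md R1 R3.
Proof. by move=> H1 H2 x xm; rewrite H2 // H1. Qed.

Lemma frameW (md md' : pred nat) R R' : (forall x, md x -> md' x) ->
  frame md R R' -> frame md' R R'.
Proof. by move=> H F x xm; apply: F; apply: contra (H x) xm. Qed.

Lemma frame_update (md : pred nat) R R' x a : md x -> frame md R R' -> frame md R (update R' x a).
Proof.
move=> xm H y ym; rewrite /update; case: (eqVneq y x) => [yx|_]; last exact: H.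
by rewrite yx xm in ym.
Qed.

(** A counted loop refines [foldl g] over [l]. [Rel] has to ignore the counter and the flag, which
    change between iterations, and the body has to preserve the counter and all registers outside
    [md]. *)
Lemma ex_for (S X : Type) (md : pred nat) i f b body t (g : S -> X -> S)
    (l : seq X) (x0 : X) (Rel : S -> state -> Prop) s0 R0 m0 (P : state -> Prop) :
  md i -> md f -> ~~ md b -> ~~ md 1 -> i != f -> R0 1 = 1 -> R0 b = size l ->
  0 < w -> size l < 2 ^ w ->
  (forall x R m v1 v2, Rel x (State R m) -> Rel x (State (update (update R i v1) f v2) m)) ->
  (forall j R m, j < size l -> R i = j -> frame md R0 R ->
     Rel (foldl g s0 (take j l)) (State R m) ->
     ex t body (State R m) (fun st' => [/\ regs st' i = j, frame md R0 (regs st') &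
       Rel (g (foldl g s0 (take j l)) (nth x0 l j)) st'])) ->
  Rel s0 (State R0 m0) ->
  (forall R m, frame md R0 R -> Rel (foldl g s0 l) (State R m) -> P (State R m)) ->
  ex (size l * (t + 5) + 6) (For i f b body) (State R0 m0) P.
Proof.
move=> mi mf mb m1 fi R1 Rb w0 lw Hins Hbody Hs0 HP.
have w1 : 1 < 2 ^ w by rewrite -{1}(expn0 2) ltn_exp2l.
have bw (q : bool) : q < 2 ^ w by apply: leq_ltn_trans (leq_b1 q) w1.
have updK (h : store) y a : update h y a y = a by rewrite /update eqxx.
have updN (h : store) y z a : y != z -> update h y a z = h z.
  by move=> /negPf yz; rewrite /update eq_sym yz.
have bi : i != b by apply: contraNneq mb => <-.
have bf : f != b by apply: contraNneq mb => <-.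
have i1 : i != 1 by apply: contraNneq m1 => <-.
pose I j st := exists2 j0, j0 + j = size l & [/\ regs st i = j0, regs st f = (j0 < size l),
  frame md R0 (regs st) & Rel (foldl g s0 (take j0 l)) st].
apply: (@ex_le (1 + (1 + (size l * (t + (1 + 1).+1).+1.+1).+1).+1).+1); last by lia.
apply: ex_seq; apply: ex_const; first by lia.
apply: ex_seq; apply: ex_op; rewrite /= updK (updN _ _ _ _ bi) Rb; first exact: bw.
apply: (ex_while (I := I)).
- move=> j [R m] [j0 jl [/= Ri Rf FR HR]]; rewrite Rf eqb0 negbK => j0l.
  apply: ex_seq; apply: exW (Hbody _ R m j0l Ri FR HR) => -[R' m'] [/= R'i FR' HR'].
  apply: ex_seq; apply: ex_op; rewrite /= R'i FR' // R1; first by lia.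
  apply: ex_op; rewrite /= updK (updN _ _ _ _ bi) (FR' b mb) Rb; first exact: bw.
  exists j.-1; first by lia.
  exists j0.+1; first by lia.
  rewrite /= updK (updN _ _ _ _ _) 1?eq_sym // updK addn1; split=> //.
    by apply: frame_update => //; apply: frame_update.
  rewrite (take_nth x0) // -cats1 foldl_cat /=; exact: Hins.
- move=> j [R m] [j0 jl [/= Ri Rf FR HR]]; rewrite Rf => /eqP.
  rewrite eqb0 -leqNgt => lj; apply: HP => //.
  by rewrite take_oversize // in HR.
exists 0 => //=; rewrite updK (updN _ _ _ _ _) 1?eq_sym // updK take0; split=> //.
  by apply: frame_update => //; apply: frame_update.
exact: Hins.
Qed.

End Hoare.

Arguments update f x a y /.

Definition edge_verts n (E : hypergraph n) (G : representation E) g :=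
  nth [::] (edge_list G) g.

Definition incident n (E : hypergraph n) (G : representation E) u :=
  tnth (incidence_list G) u.

(** * Refinement of the decision tree by the program *)

Section Refinement.
Context {n : nat} {E : hypergraph n} (G : representation E).
Variables (w s : nat) (r : tape w) (k T L N B D : nat) (v0 : 'I_n).

Local Notation ed := (edge_verts G).
Local Notation inc := (incident G).
Local Notation tp := (nth false r).
Local Notation config := ('I_n -> nat).
Local Notation ex := (ex G s r).

Implicit Types (R : store) (m : store) (c : config) (g j : nat).

Hypothesis w_gt0 : 0 < w.
Hypothesis w_big :
  n + n * B + B + L + N + s + D + k * k + k + T + size (edge_list G) + 9 < 2 ^ w.
Hypothesis s_ge : n + L + 1 + D * L + k * D * N <= s.
Hypothesis T_gt0 : 0 < T.
Hypothesis inc_lt : forall u g, g \in inc u -> g < size (edge_list G).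
Hypothesis inc_edge : forall u g, g \in inc u -> size (ed g) = k.
Hypothesis inc_size : forall u, size (inc u) <= D.

Definition consts (R : store) :=
  [/\ [/\ R 1 = 1, R 2 = n, R 3 = k & R 4 = L], R 7 = n + L + 1
    & [/\ R 9 = 0, R 11 = T.-1, R 12 = 2 & R 13 = 3]].

Lemma consts_frame (md : pred nat) R R' : all (predC md) [:: 1; 2; 3; 4; 7; 9; 11; 12; 13] ->
  frame md R R' -> consts R -> consts R'.
Proof.
move=> /= /and5P[h1 h2 h3 h4 /and5P[h7 h9 h11 h12 /andP[h13 _]]] F.
by move=> [[? ? ? ?] ? [? ? ? ?]]; rewrite /consts !F.
Qed.

(** The bound 4 instead of 2 is deliberate: the machine must respect its limits even after a failed
    query, which may leave frozen or tentative colors behind. *)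
Definition mem_config (m : store) (c : config) := forall u : 'I_n, m u = c u /\ c u <= 4.

Lemma size_inc (y : nat) (u : 'I_n) : y = u -> nth [::] (incidence_list G) y = inc u.
Proof. by move=> ->; rewrite /incident (tnth_nth [::]). Qed.

Lemma ex_degree x y (u : 'I_n) R m (P : state -> Prop) : R y = u ->
  P (State (update R x (size (inc u))) m) -> ex 1 (Degree x y) (State R m) P.
Proof.
move=> yu; apply: ex_assign => /= [todo|]; first by rewrite (size_inc yu).
by have := inc_size u; lia.
Qed.

Lemma ex_edge x y z (u : 'I_n) j R m (P : state -> Prop) : R y = u -> R z = j ->
  j < size (inc u) ->
  P (State (update R x (nth 0 (inc u) j)) m) -> ex 1 (Edge x y z) (State R m) P.
Proof.
move=> yu zj js; apply: ex_assign => /= [todo|]; first by rewrite (size_inc yu) zj.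
by apply: ltn_trans (inc_lt (mem_nth 0 js)) _; lia.
Qed.

Lemma ex_vertex x y z g j R m (P : state -> Prop) : R y = g -> R z = j -> j < size (ed g) ->
  P (State (update R x (nth v0 (ed g) j)) m) -> ex 1 (Vertex x y z) (State R m) P.
Proof.
move=> yg zj js; apply: ex_assign => /= [todo|]; first by rewrite yg zj (nth_map v0).
by have := ltn_ord (nth v0 (ed g) j); lia.
Qed.

Lemma foldl_num (c : config) a b (l : seq 'I_n) x y :
  foldl (fun p u => (p.1 + (c u == a), p.2 + (c u == b))) (x, y) l =
  (x + num c a l, y + num c b l).
Proof.
elim: l x y => [|u l IH] x y /=; first by rewrite /num /= !addn0.
by rewrite IH /num /= !addnA.
Qed.

Lemma num_le (c : config) a l : num c a l <= size l.
Proof. exact: count_size. Qed.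

Lemma critical_ok c g R m : consts R -> mem_config m c -> R 28 = g -> size (ed g) = k ->
  ex (16 * k + 30) p_critical (State R m) (fun st => [/\ memory st = m,
    frame [pred x | (x == 24) || (28 < x < 35)] R (regs st)
    & regs st 24 = critical ed T c g]).
Proof.
move=> CR Hm Rg sg; have ns : n <= s by lia.
have [[R1 R2 R3 R4] R7 [R9 R11 R12 R13]] := CR.
have kk : k <= k * k by case: (k) => // k'; rewrite leq_pmulr.
eapply ex_le.
  apply: ex_seq; apply: ex_const; first lia.
  apply: ex_seq; apply: ex_const; first lia.
  apply: ex_seq.
  apply: (ex_for (md := [pred x | 28 < x < 35]) (l := ed g) (x0 := v0) (s0 := (0, 0))
    (g := fun p u => (p.1 + (c u == 1), p.2 + (c u == 2)))
    (Rel := fun p st => [/\ regs st 29 = p.1, regs st 30 = p.2 & memory st = m])) => //.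
  - by rewrite /= R3.
  - by rewrite sg; lia.
  - move=> j R' m' jl R'j F; rewrite foldl_num /= => -[H29 H30 Hm'].
    have := num_le c 1 (take j (ed g)); have := num_le c 2 (take j (ed g)).
    rewrite !size_takel ?(ltnW jl) // => b2 b1.
    have [mu c4] := Hm (nth v0 (ed g) j); have ul := ltn_ord (nth v0 (ed g) j).
    apply: ex_seq; apply: (ex_vertex (g := g) (j := j)) => //; first by rewrite F.
    apply: ex_seq; apply: ex_read => /=; [lia | rewrite Hm' mu; lia |].
    rewrite Hm' mu.
    apply: ex_seq; apply: ex_op => /=; rewrite F //= R1; first lia.
    apply: ex_seq; apply: ex_op => /=; rewrite H29; first lia.
    apply: ex_seq; apply: ex_op => /=; rewrite F //= R12; first lia.
    apply: ex_op => /=; rewrite H30; first lia.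
    split=> //; do 6! [apply: frame_update => //].
  - move=> R' m' F; rewrite foldl_num /= !add0n => -[H29 H30 Hm'].
    have := num_le c 1 (ed g); have := num_le c 2 (ed g); rewrite sg => b2 b1.
    have b3 := leq_mul b1 b2.
    apply: ex_seq; apply: ex_op => /=; rewrite H29 H30; first lia.
    apply: ex_seq; apply: ex_op => /=; rewrite F //= R9; first lia.
    apply: ex_seq; apply: ex_op => /=; rewrite H29 H30; first lia.
    apply: ex_seq; apply: ex_op => /=; rewrite F //= R11; first lia.
    apply: ex_op => /=; first lia.
    split=> //=; last by rewrite /critical mulnb prednK.
    do 5! [apply: frame_update => //].
    apply: frame_trans (frameW _ F); last by move=> x /= ->; rewrite orbT.
    by do 2! [apply: frame_update => //].
by rewrite sg; lia.
Qed.


Definition rel1 (S : config * seq 'I_n) (st : state) :=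
  [/\ mem_config (memory st) S.1, size S.2 <= L.+1, regs st 10 = size S.2
    & forall i, i < size S.2 -> memory st (n + i) = nth v0 S.2 i].

Definition touch_regs := [pred x | (x == 10) || (19 < x < 35)].

Lemma touch_ok (S : config * seq 'I_n) (u : 'I_n) R m : consts R -> rel1 S (State R m) -> R 20 = u ->
  ex (D * (16 * k + 40) + 50) p_touch (State R m) (fun st =>
    rel1 (interp tp (touch ed inc T L S u)) st /\ frame touch_regs R (regs st)).
Proof.
case: S => c W CR [/= Hm sW R10 HW] Ru.
have [[R1 R2 R3 R4] R7 [R9 R11 R12 R13]] := CR; have [mu c4] := Hm u; have un := ltn_ord u.
eapply ex_le.
  apply: ex_seq; apply: ex_read; rewrite Ru ?mu; [lia|lia|].
  apply: ex_seq; apply: ex_op => /=; rewrite ?R9; first lia.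
  apply: ex_seq; apply: ex_op => /=; rewrite ?R4 ?R1; first lia.
  apply: ex_seq; apply: ex_op => /=; rewrite ?R10; first lia.
  apply: ex_seq; apply: ex_op => /=; first lia.
  set b := (c u == 0) * _; set R' := update _ 21 _.
  have Eb : (b != 0) = (c u == 0) && (size W <= L).
    by rewrite /b addn1 ltnS mulnb eqb0 negbK.
  have F' : frame touch_regs R R' by do ! [apply: frame_update => //].
  apply: ex_if; rewrite [regs _ _](_ : _ = b) //; last first.
    move=> b0; apply: ex_skip; rewrite /touch -Eb b0 /=; split=> //.
  rewrite /touch Eb => E1; rewrite /= E1; have /andP[/eqP cu0 sWL] := E1.
  have CR' : consts R' by exact: CR.
  apply: ex_seq; apply: ex_const; first lia.
  apply: ex_seq; apply: (ex_degree (u := u)); first exact: Ru.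
  apply: ex_seq.
  apply: (ex_for (md := [pred x | (22 < x < 35) && (x != 25)]) (l := inc u) (x0 := 0) (s0 := 0)
    (g := fun a g => a + critical ed T c g)
    (Rel := fun a st => regs st 23 = a /\ memory st = m)) => //.
  - by have := inc_size u; lia.
  - move=> j R2' m2 jl R2j F2 [/= H23 Hm2].
    have CR2 : consts R2' by apply: consts_frame F2 _.
    have gi := mem_nth 0 jl.
    apply: ex_seq; apply: (ex_edge (u := u) (j := j)) => //; first by rewrite F2.
    rewrite Hm2; set R3' := update _ 28 _.
    apply: ex_seq; apply: exW (critical_ok (c := c) (g := nth 0 (inc u) j) (R := R3') (m := m) _ _ _ _) => //.
    + move=> [R4' m4] [/= -> F4 H24].
      have E23 : R4' 23 = R2' 23 by rewrite F4.
      have cnt : foldl (fun a g => a + critical ed T c g) 0 (take j (inc u)) <= j.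
        rewrite -[X in _ <= X](size_takel (ltnW jl)) -[X in _ <= X]add0n.
        elim: (take j (inc u)) 0 => [|x l IH] a /=; first by rewrite addn0.
        by apply: leq_trans (IH _) _; case: critical; lia.
      apply: ex_op => /=; rewrite E23 H23 H24.
        by have := inc_size u; case: critical; lia.
      split=> //; first by rewrite F4.
      apply: frame_update => //; apply: frame_trans F2 _.
      apply: frame_trans (frameW _ F4); first by apply: frame_update.
      by move=> x /=; lia.
    + by rewrite (inc_edge gi).
  - move=> R2' m2 F2 [/= H23 Hm2].
    have CR2 : consts R2' by apply: consts_frame F2 _.
    have [[R1' R2'' R3' R4'] R7' [R9' R11' R12' R13']] := CR2.
    have H20 : R2' 20 = u by rewrite F2.
    have H10 : R2' 10 = size W by rewrite F2.
    have FF : frame touch_regs R R2'.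
      apply: frame_trans F' _; apply: frame_trans (frameW _ F2).
        by do ! [apply: frame_update => //].
      by move=> x /=; lia.
    have Ehas : (R2' 23 != 0) = has (critical ed T c) (inc u).
      have E0 a l : foldl (fun a g => a + critical ed T c g) a l = a + count (critical ed T c) l.
        by elim: l a => [|x l IH] a /=; rewrite ?addn0 // IH addnA.
      by rewrite H23 E0 add0n has_count lt0n.
    apply: ex_if => /= [h|h].
      rewrite -Ehas h /=.
      apply: ex_seq; apply: ex_write => /=; rewrite ?H20; first lia.
      apply: ex_seq; apply: ex_op => /=; rewrite ?R2'' ?H10; first lia.
      apply: ex_seq; apply: ex_write => /=; rewrite ?H20; first lia.
      apply: ex_op => /=; rewrite ?R1' ?H10; first lia.
      split; last by do ! [apply: frame_update => //].
      rewrite Hm2; split=> /=; rewrite ?size_rcons ?addn1 //.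
        move=> x; have xn := ltn_ord x; rewrite /= (_ : (x == n + size W :> nat) = false); last by apply/negbTE; lia.
        rewrite /upd R13' (inj_eq val_inj); case: (eqVneq x u) => _; last exact: Hm.
        by [].
      move=> i; rewrite ltnS leq_eqVlt eqn_add2l => /predU1P[->|iW].
        by rewrite eqxx nth_rcons ltnn eqxx.
      rewrite ifF; last by apply/negbTE; lia.
      by rewrite nth_rcons iW ifF ?HW //; apply/negbTE; lia.
    rewrite -Ehas h /=.
    apply: ex_seq; apply: ex_bit => //=.
    apply: ex_seq; apply: ex_op => /=; rewrite ?R1' ?H20; first by case: nth; lia.
    apply: ex_write => /=; rewrite ?H20; first lia.
    split; last by do ! [apply: frame_update => //].
    rewrite Hm2; split=> //=.
      move=> x; rewrite /= /upd (inj_eq val_inj); case: (eqVneq x u) => _; last exact: Hm.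
      by rewrite addn1; case: nth.
    by move=> i iW; rewrite ifF ?HW //; apply/negbTE; lia.
by have := inc_size u => H; have := leq_mul H (leqnn (16 * k + 40)); lia.
Qed.

Definition t_touch := D * (16 * k + 40) + 50.
Definition t_sweep := D * (k * (t_touch + 7) + 20) + 10.

Definition sweep_regs := [pred x | (x == 10) || (19 < x < 40)].

Lemma sweep_ok (S : config * seq 'I_n) (u : 'I_n) R m : consts R -> rel1 S (State R m) ->
  R 17 = u -> R 18 = size (inc u) ->
  ex t_sweep (For 35 36 18 (Edge 37 17 35 ;; For 38 39 3 (Vertex 20 37 38 ;; p_touch)))
    (State R m) (fun st =>
    rel1 (interp tp (sweep ed inc T L S u)) st /\ frame sweep_regs R (regs st)).
Proof.
move=> CR HS R17 R18; rewrite /sweep interp_foldT; eapply ex_le.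
  apply: (ex_for (md := sweep_regs) (l := inc u) (x0 := 0) (s0 := S)
    (g := fun S g => interp tp (foldT (touch ed inc T L) S (ed g)))
    (Rel := rel1)) => //.
  - by have [[]] := CR.
  - by have := inc_size u; lia.
  - move=> j R1 m1 jl R1j F1 H1.
    have CR1 : consts R1 by apply: consts_frame F1 _.
    have gi := mem_nth 0 jl; set g := nth 0 (inc u) j in gi *.
    apply: ex_seq; apply: (ex_edge (u := u) (j := j)) => //; first by rewrite F1.
    rewrite -/g; set R2 := update _ 37 _; rewrite interp_foldT.
    have CR2 : consts R2 by exact: CR1.
    have F2 : frame sweep_regs R R2 by apply: frame_update.
    eapply (ex_le (t' := k * (t_touch + 7) + 6)).
    apply: (ex_for (md := [pred x | touch_regs x || (x == 38) || (x == 39)]) (l := ed g)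
      (x0 := v0) (s0 := foldl (fun S g => interp tp (foldT (touch ed inc T L) S (ed g))) S
         (take j (inc u)))
      (g := fun S u => interp tp (touch ed inc T L S u)) (Rel := rel1)) => //.
    + by have [[]] := CR2.
    + by have [[_ _ -> _]] := CR2; rewrite (inc_edge gi).
    + by rewrite (inc_edge gi); lia.
    + move=> i R3 m3 il R3i F3 H3.
      apply: ex_seq; apply: (ex_vertex (g := g) (j := i)) => //; first by rewrite F3.
      set R4 := update _ 20 _.
      have F4 : frame [pred x | touch_regs x || (x == 38) || (x == 39)] R2 R4.
        exact: frame_update.
      have CR4 : consts R4 by apply: consts_frame F4 _.
      apply: exW (touch_ok (u := nth v0 (ed g) i) CR4 H3 _) => // -[R5 m5] [/= H5 F5].
      split=> //; first by rewrite F5.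
      apply: frame_trans F4 _; apply: frameW F5 => x /=.
      by move=> ->.
    + move=> R3 m3 F3 H3; split=> //=.
        by rewrite F3.
      by apply: frame_trans F2 _; apply: frameW F3 => x /=; lia.
    by rewrite (inc_edge gi) leq_add2r leq_mul // /t_touch; lia.
rewrite /t_sweep; apply: leq_add => //; apply: leq_mul; [exact: inc_size | lia].
Qed.

Definition t_explore := L * (t_sweep + 20) + 20.

Definition explore_regs := [pred x | (x == 10) || (14 < x < 40)].

Lemma guard_ok i z R m (P : state -> Prop) : consts R -> R 15 = i -> R 10 = z ->
  i <= L -> z <= L.+1 ->
  (forall R', frame [pred x | (x == 16) || (x == 17)] R R' ->
    R' 16 = (i < z) && (z <= L) -> P (State R' m)) ->
  ex 7 p_guard (State R m) P.
Proof.
move=> [[R1 R2 R3 R4] R7 [R9 R11 R12 R13]] R15 R10 iL zL HP.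
apply: (@ex_le _ _ _ _ _ _ (1 + (1 + (1 + 1).+1).+1).+1) => //.
apply: ex_seq; apply: ex_op => /=; rewrite ?R15 ?R10; first lia.
apply: ex_seq; apply: ex_op => /=; rewrite ?R1 ?R4; first lia.
apply: ex_seq; apply: ex_op => /=; rewrite ?R10; first lia.
apply: ex_op => /=; first lia.
apply: HP; last by rewrite /= mulnb addn1 ltnS.
by do ! [apply: frame_update => //].
Qed.

Lemma explore_ok (S : config * seq 'I_n) R m : consts R -> rel1 S (State R m) ->
  ex t_explore p_explore (State R m) (fun st =>
    rel1 (interp tp (explore ed inc T L v0 L 0 S)) st /\ frame explore_regs R (regs st)).
Proof.
move=> CR HS; eapply ex_le.
  apply: ex_seq; apply: ex_const; first lia.
  have [_ sW R10 _] := HS.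
  apply: ex_seq; apply: (guard_ok (i := 0) (z := size S.2)) => // R1 F1 R1_16.
  apply: (ex_while (J := L) (I := fun j st => exists i S', [/\ frame explore_regs R (regs st),
    j + i = L, regs st 15 = i, rel1 S' st &
    regs st 16 = (i < size S'.2) && (size S'.2 <= L) /\
    interp tp (explore ed inc T L v0 j i S') = interp tp (explore ed inc T L v0 L 0 S)])).
  - move=> j [R2 m2] [i [S' [/= F2 ji R15 H2 [R16 Efin]]]]; rewrite R16 eqb0 negbK => g.
    have /andP[iS SL] := g; have CR2 : consts R2 by apply: consts_frame F2 _.
    have [/= _ _ _ HW] := H2; have [[R2_1 R2_2 R2_3 R2_4] _ _] := CR2.
    have un := ltn_ord (nth v0 S'.2 i).
    apply: ex_seq; apply: ex_op => /=; rewrite ?R15 ?R2_2; first lia.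
    apply: ex_seq; apply: ex_read => /=; rewrite ?HW //; [lia|lia|].
    apply: ex_seq; apply: (ex_degree (u := nth v0 S'.2 i)) => //.
    set R3 := update _ 18 _; have F3 : frame explore_regs R R3 by do ! [apply: frame_update => //].
    apply: ex_seq; apply: exW (@sweep_ok S' (nth v0 S'.2 i) R3 m2 _ _ _ _) => //.
    move=> [R4 m4] [/= H4 F4].
    have F4' : frame explore_regs R R4.
      by apply: frame_trans F3 _; apply: frameW F4 => x /=; lia.
    have CR4 : consts R4 by apply: consts_frame F4' _.
    have [[R4_1 R4_2 R4_3 R4_4] _ _] := CR4.
    have [_ sW4 R4_10 _] := H4; have R4_15 : R4 15 = i by rewrite F4.
    apply: ex_seq; apply: ex_op => /=; rewrite ?R4_15 ?R4_1; first lia.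
    set S4 := interp _ _ in H4 sW4 R4_10.
    apply: (guard_ok (i := i.+1) (z := size S4.2)) => //=; [by rewrite addn1|lia|].
    move=> R5 F5 R5_16; exists j.-1; first lia.
    exists i.+1, S4; split=> /=.
    + apply: frame_trans F4' _; apply: frame_trans (frameW _ F5).
        by apply: frame_update.
      by move=> x /=; lia.
    + by lia.
    + by rewrite F5 //= addn1.
    + by split=> //=; [case: H4 | rewrite F5 | case: H4].
    (* Without fuel [i = L], which contradicts the guard [g]. *)
    + split=> //; rewrite -Efin; case: (j) ji => [|j'] ji; first lia.
      by rewrite /= g interp_bind.
  - move=> j [R2 m2] [i [S' [/= F2 ji R15 H2 [R16 Efin]]]]; rewrite R16 => /eqP.
    rewrite eqb0 => /negPf g; split=> //.
    by move: Efin; case: (j) => [|j'] /=; rewrite ?g => <-.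
  - exists 0, S; split=> //=.
    + apply: frame_trans (frameW _ F1); first by apply: frame_update.
      by move=> x /=; lia.
    + by rewrite addn0.
    + by rewrite F1.
    + by split=> //=; [case: HS | rewrite F1 | case: HS].
rewrite /t_explore; have : L * ((1 + (1 + (1 + (t_sweep + (1 + 7).+1).+1).+1).+1).+1).+1 <=
  L * (t_sweep + 20) by apply: leq_mul => //; lia.
by lia.
Qed.

Variable b0 : nat.
Hypothesis b0_le : b0 + B <= n + n * B.

Local Notation SB := (n + L + 1).

(** The head of the list is the top of the stack, while memory holds the bottom first; hence [rev].
    The edge sizes are recorded because the program scans exactly [k] vertices of a popped edge. *)
Definition rel2 W (S : config * nat * seq nat) (st : state) :=
  [/\ mem_config (memory st) S.1.1, regs st 5 = b0 + S.1.2, regs st 8 = SB + size S.2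
    & [/\ forall i, i < size S.2 -> memory st (SB + i) = nth 0 (rev S.2) i,
          forall i, i < size W -> memory st (n + i) = nth v0 W i
        & {in S.2, forall g, size (ed g) = k}]].

Definition redraw_regs := [pred x | (x == 5) || (x == 8) || (19 < x < 35)].

Definition t_redraw := D * 13 + 30.

Lemma foldl_cons (l st : seq nat) : foldl (fun st g => g :: st) st l = catrev l st.
Proof. by elim: l st => //= x l IH st; rewrite IH. Qed.

Lemma size_catrev (Z : Type) (l st : seq Z) : size (catrev l st) = size l + size st.
Proof. by rewrite catrevE size_cat size_rev. Qed.

Lemma redraw_ok W (S : config * nat * seq nat) (u : 'I_n) R m :
  consts R -> rel2 W S (State R m) -> R 20 = u -> size W <= L -> S.1.2 < B ->
  size S.2 + D <= D * L + k * D * N ->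
  ex t_redraw p_redraw (State R m) (fun st =>
    rel2 W (interp tp (redraw inc b0 S u)) st /\ frame redraw_regs R (regs st)).
Proof.
case: S => [[c j] stk] CR /= HS Ru WL jB szB; have [/= Hm R5 R8 [Hstk HW Hk]] := HS.
have [[R1 R2 R3 R4] R7 [R9 R11 R12 R13]] := CR; have [mu c4] := Hm u; have un := ltn_ord u.

eapply ex_le.
  apply: ex_seq; apply: ex_read; rewrite Ru ?mu; [lia|lia|].
  apply: ex_seq; apply: ex_op => /=; rewrite ?R12; first lia.
  set b : nat := (2 < c u); set R' := update _ 21 _.
  apply: ex_if; rewrite [regs _ _](_ : _ = b) // /redraw /b; last first.
    move=> /eqP; rewrite eqb0 => /negPf Ecu; apply: ex_skip; rewrite /= Ecu; split=> //.
    by do ! [apply: frame_update => //].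
  rewrite eqb0 negbK => cu; rewrite /= cu.
  have [R'20 R'13 R'1 R'5] : [/\ R' 20 = u, R' 13 = 3, R' 1 = 1 & R' 5 = b0 + j] by split.
  apply: ex_seq; apply: ex_bit => //=; rewrite ?R'5.
  apply: ex_seq; apply: ex_op => /=; rewrite ?R'13; first by case: nth; lia.
  apply: ex_seq; apply: ex_write => /=; rewrite ?R'20; first lia.
  apply: ex_seq; apply: ex_op => /=; rewrite ?R'5 ?R'1; first lia.
  apply: ex_seq; apply: (ex_degree (u := u)); first exact: Ru.
  set R1' := update _ 25 _; set m1 := update m _ _; set a := nth false r (b0 + j) in m1 R1' *.
  have CR1 : consts R1' by exact: CR.
  have F1 : frame redraw_regs R R1' by do ! [apply: frame_update => //].
  apply: (ex_for (md := [pred x | (x == 8) || (25 < x < 29)]) (l := inc u) (x0 := 0) (s0 := stk)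
    (g := fun st g => g :: st)
    (Rel := fun st => rel2 W (upd c u (3 + a), j.+1, st))) => //.
  - by have := inc_size u; lia.
  - move=> i R2' m2 il R2i F2; rewrite foldl_cons; set st' := catrev _ _ => -[/= Hm2 R2_5 R2_8 [Hstk2 HW2 Hk2]].
    have szst' : size st' = i + size stk by rewrite size_catrev size_takel // ltnW.
    have cap : size st' < D * L + k * D * N by have := inc_size u; lia.
    have CR2 : consts R2' by apply: consts_frame F2 _.
    have [[R2_1 R2_2 _ _] _ _] := CR2.
    apply: ex_seq; apply: (ex_edge (u := u) (j := i)) => //; first by rewrite F2.
    apply: ex_seq; apply: ex_write => /=; first by rewrite R2_8; lia.
    apply: ex_op => /=; rewrite R2_8 ?R2_1; first lia.
    split=> //=; first by do ! [apply: frame_update => //].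
    split=> /=; [|by []|lia|split].
    + move=> x; have xn := ltn_ord x; rewrite /= ifF; first exact: Hm2.
      by apply/negbTE; lia.
    + move=> i'; rewrite ltnS rev_cons nth_rcons size_rev leq_eqVlt eqn_add2l.
      case: (eqVneq i' (size st')) => [-> _|_ /= i's]; first by rewrite ltnn.
      by rewrite i's; apply: Hstk2.
    + move=> i' i'W; rewrite ifF; first exact: HW2.
      by apply/negbTE; lia.
    + by move=> g; rewrite in_cons => /predU1P[->|/Hk2 //]; apply: inc_edge (mem_nth 0 il).
  - split; rewrite /R1' /m1 /=; [|lia|exact: R8|split=> //].
    + move=> x; rewrite /= /upd (inj_eq val_inj); case: (eqVneq x u) => _; last exact: Hm.
      by split; have := leq_b1 a; lia.
    + by move=> i istk; rewrite ifF ?Hstk //; apply/negbTE; lia.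
    + by move=> i iW; rewrite ifF ?HW //; apply/negbTE; lia.
  - move=> R2' m2 F2; rewrite foldl_cons => H2; split=> //=.
    by apply: frame_trans F1 _; apply: frameW F2 => x /=; lia.
rewrite /t_redraw; have := leq_mul (inc_size u) (leqnn ((1 + (1 + 1).+1).+1 + 5)).
lia.
Qed.

Lemma mono_ok c g R m (P : state -> Prop) :
  consts R -> mem_config m c -> R 37 = g -> size (ed g) = k ->
  (forall R', frame [pred x | (x == 24) || (28 < x < 35)] R R' ->
    (R' 24 != 0) = mono ed k c g -> P (State R' m)) ->
  ex (13 * k + 30) p_mono (State R m) P.
Proof.
move=> CR Hm Rg sg HP; have [[R1 R2 R3 R4] R7 [R9 R11 R12 R13]] := CR.
have ns : n <= s by lia.
have Ef a l : foldl (fun a (u : 'I_n) => a + odd (c u)) a l = a + count (fun u => odd (c u)) l.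
  by elim: l a => [|x l IH] a /=; rewrite ?addn0 // IH addnA.
eapply ex_le.
  apply: ex_seq; apply: ex_const; first lia.
  apply: ex_seq.
  apply: (ex_for (md := [pred x | 28 < x < 35]) (l := ed g) (x0 := v0) (s0 := 0)
    (g := fun a u => a + odd (c u))
    (Rel := fun a st => regs st 29 = a /\ memory st = m)) => //.
  - by rewrite /= R3.
  - by rewrite sg; lia.
  - move=> j R' m' jl R'j F; rewrite Ef add0n => -[/= H29 Hm'].
    have := count_size (fun u => odd (c u)) (take j (ed g)); rewrite size_takel ?(ltnW jl) // => cs.
    have [mu c4] := Hm (nth v0 (ed g) j); have ul := ltn_ord (nth v0 (ed g) j).
    apply: ex_seq; apply: (ex_vertex (g := g) (j := j)) => //; first by rewrite F.
    apply: ex_seq; apply: ex_read => /=; [lia | rewrite Hm' mu; lia |].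
    rewrite Hm' mu.
    apply: ex_seq; apply: ex_op => /=; rewrite F //= R12 modn2; first by case: odd; lia.
    apply: ex_op => /=; rewrite H29; first by case: odd; lia.
    by split=> //; do ! [apply: frame_update => //].
  - move=> R' m' F; rewrite Ef add0n => -[/= H29 ->].
    apply: ex_seq; apply: ex_op => /=; rewrite H29 F //= R9; first by lia.
    apply: ex_seq; apply: ex_op => /=; rewrite H29 F //= R3; first by lia.
    apply: ex_op => /=; first lia.
    apply: HP; last by rewrite /= /mono addn_eq0 !eqb0 negb_and !negbK.
    do 3! [apply: frame_update => //].
    apply: frame_trans (frameW _ F); last by move=> x /= ->; rewrite orbT.
    by apply: frame_update.
by rewrite sg; lia.
Qed.

Lemma redraw_grow (S : config * nat * seq nat) u :
  let S' := interp tp (redraw inc b0 S u) in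
  size S'.2 <= size S.2 + D /\ S'.1.2 <= S.1.2.+1.
Proof.
rewrite /redraw; case: ifP => _ /=; last by split; lia.
by rewrite size_catrev; have := inc_size u; lia.
Qed.

Lemma redraws_grow l (S : config * nat * seq nat) :
  let S' := foldl (fun S u => interp tp (redraw inc b0 S u)) S l in
  size S'.2 <= size S.2 + size l * D /\ S'.1.2 <= S.1.2 + size l.
Proof.
elim: l S => [|u l IH] S /=; first by lia.
by have [H1 H2] := redraw_grow S u; have [H3 H4] := IH (interp tp (redraw inc b0 S u)); lia.
Qed.

Definition repair_regs := [pred x | (x \in [:: 5; 6; 8; 16]) || (19 < x < 40)].

Lemma redraw_edge_ok W (S : config * nat * seq nat) g R m :
  consts R -> rel2 W S (State R m) -> R 37 = g -> size (ed g) = k -> size W <= L ->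
  S.1.2 + k <= B -> size S.2 + k * D <= D * L + k * D * N ->
  ex (k * (t_redraw + 7) + 6) (For 38 39 3 (Vertex 20 37 38 ;; p_redraw)) (State R m)
    (fun st => rel2 W (interp tp (foldT (redraw inc b0) S (ed g))) st /\
       frame [pred x | redraw_regs x || (x == 38) || (x == 39)] R (regs st)).
Proof.
move=> CR HS Rg sg WL jB szB; rewrite interp_foldT; eapply ex_le.
  apply: (ex_for (md := [pred x | redraw_regs x || (x == 38) || (x == 39)]) (l := ed g)
      (x0 := v0) (s0 := S) (g := fun S u => interp tp (redraw inc b0 S u)) (Rel := rel2 W)) => //.
  - by have [[]] := CR.
  - by have [[_ _ -> _]] := CR.
  - by rewrite sg; lia.
  - move=> i R1 m1 il R1i F1 H1.
    have [] := redraws_grow (take i (ed g)) S; rewrite size_takel ?(ltnW il) // => g1 g2.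
    rewrite sg in il; have := leq_mul il (leqnn D); rewrite mulSn => iD.
    apply: ex_seq; apply: (ex_vertex (g := g) (j := i)); rewrite ?sg //; first by rewrite F1.
    set R2 := update _ 20 _.
    have F2 : frame [pred x | redraw_regs x || (x == 38) || (x == 39)] R R2.
      exact: frame_update.
    have CR2 : consts R2 by apply: consts_frame F2 _.
    apply: exW (redraw_ok (u := nth v0 (ed g) i) CR2 H1 _ WL _ _) => //; [|lia|lia].
    move=> -[R5 m5] [/= H5 F5]; split=> //; first by rewrite F5.
    by apply: frame_trans F2 _; apply: frameW F5 => x /= ->.
by rewrite sg; lia.
Qed.

Hypothesis k_gt0 : 0 < k.

Lemma repair_nil M c j : repair ed inc k b0 M c j [::] = Ret (true, c).
Proof. by case: M. Qed.

Lemma repair_cons M c j g stk : repair ed inc k b0 M c j (g :: stk) =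
  if mono ed k c g then
    if M is M'.+1 then
      bind (foldT (redraw inc b0) (c, j, stk) (ed g))
           (fun s => repair ed inc k b0 M' s.1.1 s.1.2 s.2)
    else Ret (false, c)
  else repair ed inc k b0 M c j stk.
Proof. by case: M. Qed.

Definition mem_list W m := forall i, i < size W -> m (n + i) = nth v0 W i.

Definition t_repair := (D * L + k * D * N) * (k * (t_redraw + 20) + 60) + 10.

(** The loop measure is [size stk + k * D * M]: a check pops one edge, and a resampling trades one
    unit of [M] for at most [k * D] pushes. The same quantity keeps the stack within memory. The
    second disjunct of the loop invariant describes a loop about to end for lack of budget. *)
Lemma repair_ok W M c j stk R m : consts R -> rel2 W (c, j, stk) (State R m) ->
  R 6 = M -> size W <= L -> M <= N ->
  j + M * k <= B -> size stk + k * D * M <= D * L + k * D * N ->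
  ex t_repair p_repair (State R m) (fun st =>
    [/\ mem_config (memory st) (interp tp (repair ed inc k b0 M c j stk)).2,
        mem_list W (memory st) & frame repair_regs R (regs st)]).
Proof.
move=> CR HS R6 WL MN jB cap; have [/= Hm R5 R8 [Hstk HW Hk]] := HS.
have [[R1 R2 R3 R4] R7 [R9 R11 R12 R13]] := CR.
set fin := interp _ _; eapply ex_le.
  apply: ex_seq; apply: ex_op; rewrite /= ?R7 ?R8; first lia.
  apply: (ex_while (J := size stk + k * D * M) (t := k * (t_redraw + 20) + 59)
    (I := fun J st => [/\ frame repair_regs R (regs st), mem_list W (memory st) &
      (exists M c j stk, [/\ rel2 W (c, j, stk) st, regs st 6 = M /\ M <= N,
         j + M * k <= B, J = size stk + k * D * M /\ J <= D * L + k * D * N &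
         regs st 16 = (0 < size stk) /\
         interp tp (repair ed inc k b0 M c j stk) = fin]) \/
      (regs st 16 = 0 /\ mem_config (memory st) fin.2)])).
  - move=> J [R1' m1] [/= F1 HW1 [|[-> //]]].
    case=> M1 [c1 [j1 [stk1 [H1 [R1_6 M1N] jB1 [-> cap1] [R1_16 Efin]]]]].
    rewrite R1_16 eqb0 negbK; case: stk1 H1 cap1 R1_16 Efin => // g stk1.
    move=> [/= Hm1 R1_5 R1_8 [Hstk1 _ Hk1]] cap1 R1_16 Efin _.
    have CR1 : consts R1' by apply: consts_frame F1 _.
    have [[R1_1 R1_2 R1_3 R1_4] R1_7 [R1_9 R1_11 R1_12 R1_13]] := CR1.
    have sg : size (ed g) = k by apply: Hk1; rewrite mem_head.
    have glt : g < size (edge_list G).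
      rewrite ltnNge; apply/negP => /(nth_default [::]) Hg.
      by move: k_gt0; rewrite -sg /edge_verts Hg.
    have m1g : m1 (SB + size stk1) = g.
      by rewrite Hstk1 // rev_cons nth_rcons size_rev ltnn eqxx.
    have Hpop R' : R' 5 = R1' 5 -> R' 8 = SB + size stk1 -> rel2 W (c1, j1, stk1) (State R' m1).
      move=> R'5 R'8; split=> //=; first by rewrite R'5.
      split=> //; last by move=> h hs; apply: Hk1; rewrite in_cons hs orbT.
      by move=> i istk; rewrite Hstk1; [rewrite rev_cons nth_rcons size_rev istk | lia].
    eapply (ex_le (t' := k * (t_redraw + 20) + 59)).
    apply: ex_seq; apply: ex_op => /=; rewrite ?R1_8 ?R1_1; first lia.
    rewrite addnS subn1 /= addnC -addnA.
    apply: ex_seq; apply: ex_read => /=.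
    + by lia.
    + by rewrite (_ : size stk1 + _ = SB + size stk1) ?m1g; lia.
    rewrite (_ : size stk1 + _ = SB + size stk1) ?m1g; last lia.
    set R2' := update _ 37 g.
    have F2 : frame repair_regs R R2' by do ! [apply: frame_update => //].
    have CR2 : consts R2' by exact: CR1.
    apply: ex_seq; apply: (mono_ok (c := c1) (g := g)) => // R3' F3 R3_24.
    have F3' : frame repair_regs R R3'.
      by apply: frame_trans F2 _; apply: frameW F3 => x /=; lia.
    have CR3 : consts R3' by apply: consts_frame F3' _.
    have [[R3_1 _ _ _] R3_7 [R3_9 _ _ _]] := CR3.
    have H3 : rel2 W (c1, j1, stk1) (State R3' m1) by apply: Hpop; rewrite F3.
    have R3_6 : R3' 6 = M1 by rewrite F3.
    rewrite repair_cons in Efin.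
    apply: ex_seq; apply: ex_if => /= [h|h]; last first.
      have Emono : mono ed k c1 g = false by rewrite -R3_24 h.
      apply: ex_skip.
      apply: ex_op => /=; rewrite ?R3_7 ?F3 //=; first lia.
      exists (size stk1 + k * D * M1); first by lia.
      split=> //=; first by apply: frame_update.
      left; exists M1, c1, j1, stk1; split=> //=.
      * by rewrite /= in cap1; lia.
      * by split; [rewrite /R2' /=; lia | rewrite -Efin Emono].
    have Emono : mono ed k c1 g = true by rewrite -R3_24 h.
    rewrite Emono in Efin; apply: ex_if => /= [h6|h6]; rewrite R3_6 in h6.
      case: M1 R3_6 R1_6 M1N jB1 cap1 Efin h6 => // M1 R3_6 R1_6 M1N jB1 cap1 Efin _.
      apply: ex_seq; apply: ex_op => /=; rewrite R3_6 R3_1; first lia.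
      rewrite subn1 /=; set R4' := update _ 6 M1.
      have F4 : frame repair_regs R R4' by do ! [apply: frame_update => //].
      have CR4 : consts R4' by exact: CR3.
      have H4 : rel2 W (c1, j1, stk1) (State R4' m1) by apply: Hpop; rewrite /R4' /= F3.
      have R4_37 : R4' 37 = g by rewrite /R4' /= F3.
      have kDM : k * D * M1.+1 = k * D + k * D * M1 by rewrite mulnS.
      rewrite /= in cap1; rewrite mulSn in jB1.
      apply: exW (redraw_edge_ok CR4 H4 R4_37 sg WL _ _) => //=; [|lia|lia].
      move=> [R5' m5] [/= H5 F5].
      have F5' : frame repair_regs R R5'.
        apply: frame_trans F4 _; apply: frameW F5 => x /=.
        by rewrite /repair_regs /= !inE; lia.
      have [/= _ _ R5_8 [_ HW5 _]] := H5; have CR5 : consts R5' by apply: consts_frame F5' _.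
      have [_ R5_7 _] := CR5; have R5_6 : R5' 6 = M1 by rewrite F5.
      rewrite interp_bind in Efin; set S5 := interp _ _ in H5 R5_8 Efin.
      have [g1 g2] := redraws_grow (ed g) (c1, j1, stk1).
      rewrite -interp_foldT -/S5 /= sg in g1 g2.
      apply: ex_op => /=; rewrite R5_7 R5_8 /=; first lia.
      exists (size S5.2 + k * D * M1); first by rewrite /=; lia.
      split=> //=; first by apply: frame_update.
      left; exists M1, S5.1.1, S5.1.2, S5.2; split=> //=; try lia.
      by split=> //; lia.
    apply: ex_op => /=; rewrite ?R3_7 ?R3_9 ?addn0; first lia.
    apply: ex_op => /=; rewrite ?R3_7 ?ltnn; first lia.
    exists 0; first by rewrite /=.
    split=> //=; first by do ! [apply: frame_update => //].
    right; split=> //; case: M1 R3_6 R1_6 M1N jB1 cap1 Efin h6 => // _ _ _ _ _ Efin _.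
    by rewrite -Efin.
    by rewrite /t_redraw; lia.
  - move=> J [R1' m1] [/= F1 HW1 [|[_ ?] _]]; last by split.
    case=> M1 [c1 [j1 [stk1 [H1 _ _ _ [R1_16 Efin]]]]].
    rewrite R1_16 => /eqP; rewrite eqb0 -leqNgt leqn0 size_eq0 => /eqP stk0.
    by split=> //; rewrite -Efin stk0 repair_nil; case: H1.
  - split=> //=; first by apply: frame_update.
    left; exists M, c, j, stk; split=> //=.
    by split=> //; lia.
by rewrite /t_repair; have := leq_mul cap (leqnn (k * (t_redraw + 20) + 60)); lia.
Qed.

Hypothesis b0E : b0 = base B v0.

Definition t_settle := L * (t_redraw + 20) + t_repair + L * 20 + 50.

Lemma settle_ok (S : config * seq 'I_n) R m : consts R -> rel1 S (State R m) ->
  size S.2 <= L -> R 5 = b0 -> R 6 = N -> N * k + L <= B ->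
  ex t_settle p_settle (State R m) (fun st =>
    mem_config (memory st) (interp tp (settle ed inc k L N B v0 S)).2 /\
    frame repair_regs R (regs st)).
Proof.
case: S => c W CR [/= Hm _ R10 HW] WL R5 R6 NB.
have [[R1 R2 R3 R4] R7 [R9 R11 R12 R13]] := CR.
have DW : size W * D <= D * L by rewrite mulnC leq_mul.
rewrite /settle /= WL -b0E interp_bind interp_bind interp_foldT /=.
eapply ex_le.
  apply: ex_seq; apply: ex_op; rewrite /= ?R7 ?R9 ?addn0; first lia.
  set R' := update _ 8 _; have F' : frame repair_regs R R' by do ! [apply: frame_update => //].
  have CR' : consts R' by exact: CR.
  apply: ex_seq.
  eapply (ex_le (t' := L * (t_redraw + 9) + 6)).
  apply: (ex_for (md := [pred x | redraw_regs x || (x == 35) || (x == 36)]) (l := W)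
      (x0 := v0) (s0 := (c, 0, [::])) (g := fun S u => interp tp (redraw inc b0 S u))
      (Rel := rel2 W)) => //.
  - by lia.
  - move=> i R1' m1 iW R1i F1 H1; have CR1 : consts R1' by apply: consts_frame F1 _.
    have [[R1_1 R1_2 _ _] _ _] := CR1; have [_ _ _ [_ HW1 _]] := H1.
    have := redraws_grow (take i W) (c, 0, [::]); rewrite /= size_takel ?(ltnW iW) // => -[g1 g2].
    have := leq_mul iW (leqnn D); rewrite mulSn => iD.
    have vn := ltn_ord (nth v0 W i); rewrite /= in HW1.
    apply: ex_seq; apply: ex_op => /=; rewrite R1_2 R1i; first lia.
    apply: ex_seq; apply: ex_read => /=; rewrite ?HW1 //; [lia|lia|].
    set R2' := update _ 20 _.
    have F2 : frame [pred x | redraw_regs x || (x == 35) || (x == 36)] R' R2'.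
      by do ! [apply: frame_update => //].
    have CR2 : consts R2' by exact: CR1.
    apply: exW (redraw_ok (u := nth v0 W i) (R := R2') CR2 H1 _ WL _ _) => //; [|lia|lia].
    move=> [R5' m5] [/= H5 F5]; split=> //; first by rewrite F5.
    by apply: frame_trans F2 _; apply: frameW F5 => x /= ->.
  - split=> //=; by rewrite /R' /= ?addn0.
  - move=> R1' m1 F1; set S1 := foldl _ _ _ => H1.
    have [g1 g2] := redraws_grow W (c, 0, [::]); rewrite -/S1 /= in g1 g2.
    have F1' : frame repair_regs R R1'.
      apply: frame_trans F' _; apply: frameW F1 => x /=.
      by rewrite /repair_regs /= !inE; lia.
    have CR1 : consts R1' by apply: consts_frame F1' _.
    have R1_6 : R1' 6 = N by rewrite F1.
    have H1' : rel2 W (S1.1.1, S1.1.2, S1.2) (State R1' m1) by case: H1 => ? ? ? ?; split.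
    apply: ex_seq; apply: exW (repair_ok CR1 H1' R1_6 WL (leqnn N) _ _); [|lia|lia].
    move=> [R2' m2] /=; set fin := (interp _ (repair _ _ _ _ _ _ _ _)) => -[Hm2 HW2 F2].
    have F2' : frame repair_regs R R2' by apply: frame_trans F1' _.
    have CR2 : consts R2' by apply: consts_frame F2' _.
    eapply (ex_le (t' := L * 14 + 6)).
    apply: (ex_for (md := [pred x | (x \in [:: 20; 21; 35; 36])]) (l := W) (x0 := v0)
      (s0 := fin.2) (g := fun c w => upd c w (c w - 2))
      (Rel := fun c st => mem_config (memory st) c /\ mem_list W (memory st))) => //.
    + by have [[]] := CR2.
    + by rewrite F2'.
    + by lia.
    + move=> i R3' m3 iW R3i F3; set c3 := foldl _ _ _ => -[/= Hm3 HW3].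
      have CR3 : consts R3' by apply: consts_frame F3 _.
      have [[R3_1 R3_2 _ _] _ [_ _ R3_12 _]] := CR3.
      have vn := ltn_ord (nth v0 W i); have [mv c4] := Hm3 (nth v0 W i).
      apply: ex_seq; apply: ex_op => /=; rewrite R3_2 R3i; first lia.
      apply: ex_seq; apply: ex_read => /=; rewrite ?HW3 //; [lia|lia|].
      apply: ex_seq; apply: ex_read => /=; rewrite ?mv //; [lia|lia|].
      apply: ex_seq; apply: ex_op => /=; rewrite R3_12; first lia.
      apply: ex_write => /=; first lia.
      split=> //=; first by do ! [apply: frame_update => //].
      split.
        move=> x; rewrite /= /upd (inj_eq val_inj).
        by case: (eqVneq x _) => _; [split; lia | exact: Hm3].
      move=> j jW; have jn := ltn_ord (nth v0 W i); rewrite /= ifF; first exact: HW3.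
      by apply/negbTE; lia.
    + move=> R3' m3 F3 [/= Hm3 _]; split=> //=.
      apply: frame_trans F2' _; apply: frameW F3 => x /=.
      by rewrite /repair_regs /= !inE; lia.
    have := leq_mul WL (leqnn 14); lia.
have := leq_mul WL (leqnn (t_redraw + 9)); lia.
by rewrite /t_settle; lia.
Qed.

Variables (l cL cN cB : nat).
Hypothesis l_gt0 : 0 < l.
Hypothesis n_log : 2 ^ l.-1 <= n < 2 ^ l.
Hypothesis LE : L = cL * l.
Hypothesis NE : N = cN * l.
Hypothesis BE : B = cB * l.

Lemma l_le_n : l <= n.
Proof.
have /andP[H _] := n_log; apply: leq_trans H.
by have := ltn_expl l.-1 (leqnn 2); rewrite prednK.
Qed.

Lemma init_ok m (P : state -> Prop) :
  (forall R, consts R -> R 0 = v0 -> R 5 = b0 -> R 6 = N -> R 10 = 0 -> R 20 = v0 ->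
     P (State R m)) ->
  ex (l * 20 + 60) (p_init k T cL cN cB) (State (update (fun=> 0) 0 v0) m) P.
Proof.
move=> HP; have ln := l_le_n; have vn := ltn_ord v0.
have kk : k <= k * k by rewrite leq_pmulr.
have cLL : cL <= L by rewrite LE leq_pmulr.
have cNN : cN <= N by rewrite NE leq_pmulr.
have cBB : cB <= B by rewrite BE leq_pmulr.
have vB : v0 * B <= n * B by rewrite leq_mul2r ltnW ?orbT.
have vB' : v0 * B + B <= n * B by have := leq_mul vn (leqnn B); rewrite mulSn addnC.
eapply ex_le.
  apply: ex_seq; apply: ex_const; first lia.
  apply: ex_seq; apply: ex_const; first lia.
  apply: ex_seq; apply: ex_const; first lia.
  apply: ex_seq; apply: ex_const; first lia.
  apply: ex_seq; apply: ex_const; first lia.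
  apply: ex_seq; apply: ex_assign => [todo //||]; first lia.
  apply: ex_seq; apply: ex_op; rewrite /= ?addn0; first lia.
  set R' := update _ 40 _.
  apply: ex_seq.
  apply: (ex_while (J := l) (I := fun j st => exists2 a, j + a = l & [/\ memory st = m,
    frame [pred x | (x == 40) || (x == 41)] R' (regs st), regs st 41 = a,
    regs st 40 = n %/ 2 ^ a & (0 < a -> 2 ^ a.-1 <= n)])).
  - move=> j [R1 m1] [a ja [/= -> F1 R41 R40 Ha]] nz.
    have na : 2 ^ a <= n by rewrite leqNgt; apply: contra nz => h; rewrite R40 divn_small.
    have al : a < l.
      rewrite ltnNge; apply/negP => la; have /andP[_] := n_log; rewrite ltnNge => /negP; apply.
      by apply: leq_trans na; rewrite leq_exp2l.
    have dn : n %/ 2 ^ a <= n by apply: leq_div.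
    have R12 : R1 12 = 2 by rewrite F1.
    have R11 : R1 1 = 1 by rewrite F1.
    apply: ex_seq; apply: ex_op => /=; rewrite R40 R12.
      by have := leq_div (n %/ 2 ^ a) 2; lia.
    apply: ex_op => /=; rewrite R41 R11; first by lia.
    exists j.-1; first lia.
    exists a.+1; first lia.
    split=> //=; first by do ! [apply: frame_update => //].
      by rewrite addn1.
    by rewrite -divnMA -expnSr.
  - move=> j [R1 m1] [a ja [/= -> F1 R41 R40 Ha]] z.
    have na : n < 2 ^ a.
      by rewrite ltnNge; apply/negP => h; have := divn_gt0 n (expn_gt0 2 a); rewrite -R40 z h.
    have {na} al : a = l.
      apply/eqP; rewrite eqn_leq; apply/andP; split; first by lia.
      have /andP[H _] := n_log; have := leq_ltn_trans H na; rewrite ltn_exp2l //.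
      by lia.
    rewrite al in R41 ja Ha.
    have [R1_0 R1_1 R1_2 R1_9] : [/\ R1 0 = v0, R1 1 = 1, R1 2 = n & R1 9 = 0].
      by split; rewrite F1.
    apply: ex_seq; apply: ex_const; first lia.
    apply: ex_seq; apply: ex_op => /=; rewrite R41 -?LE; first lia.
    apply: ex_seq; apply: ex_const; first lia.
    apply: ex_seq; apply: ex_op => /=; rewrite R41 -?NE; first lia.
    apply: ex_seq; apply: ex_const; first lia.
    apply: ex_seq; apply: ex_op => /=; rewrite R41 -?BE; first lia.
    apply: ex_seq; apply: ex_op => /=; rewrite ?R1_0 ?R1_1 ?R1_2; first lia.
    apply: ex_seq; apply: ex_op => /=; rewrite ?R1_0 ?R1_1 ?R1_2; first lia.
    apply: ex_seq; apply: ex_op => /=; rewrite ?R1_0 ?R1_1 ?R1_2; first lia.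
    apply: ex_seq; apply: ex_op => /=; rewrite ?R1_0 ?R1_1 ?R1_2; first lia.
    apply: ex_op => /=; rewrite R1_0 R1_9 ?addn0; first lia.
    apply: HP => //=; rewrite ?F1 //.
    by split; [split|..|split] => //=; rewrite ?F1.
  - exists 0; first by rewrite addn0.
    by split=> //=; rewrite ?expn0 ?divn1.
by lia.
Qed.

Definition t_query := l * 20 + t_touch + t_explore + t_settle + 100.

Lemma query_ok m c : mem_config m c -> N * k + L <= B ->
  ex t_query (p_query k T cL cN cB) (State (update (fun=> 0) 0 v0) m) (fun st =>
    let c' := (interp tp (query ed inc k T L N B v0 c)).2 in
    mem_config (memory st) c' /\ (regs st 0 != 0) = (1 < c' v0)).
Proof.
move=> Hm NB; rewrite /query interp_bind interp_bind; have vn := ltn_ord v0.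
eapply ex_le.
  apply: ex_seq; apply: init_ok => R CR R0 R5 R6 R10 R20.
  have H0 : rel1 (c, [::]) (State R m) by split.
  apply: ex_seq; apply: exW (touch_ok CR H0 R20) => -[R1 m1] [/= H1 F1].
  have CR1 : consts R1 by apply: consts_frame F1 _.
  apply: ex_seq; apply: exW (explore_ok CR1 H1) => -[R2 m2] [/=].
  set S := interp _ _ => H2 F2.
  have CR2 : consts R2 by apply: consts_frame F2 _.
  have [[R2_1 R2_2 R2_3 R2_4] _ _] := CR2; have [/= Hm2 sS R2_10 _] := H2.
  have R2_5 : R2 5 = b0 by rewrite F2 // F1.
  have R2_6 : R2 6 = N by rewrite F2 // F1.
  have R2_0 : R2 0 = v0 by rewrite F2 // F1.
  apply: ex_seq; apply: ex_op => /=; rewrite ?R2_4 ?R2_1; first lia.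
  apply: ex_seq; apply: ex_op => /=; rewrite ?R2_10 addn1 ltnS; first lia.
  set R3 := update _ 16 _; set c' := (interp tp (settle _ _ _ _ _ _ _ _)).2.
  have CR3 : consts R3 by exact: CR2.
  have R3_16 : R3 16 = (size S.2 <= L) by [].
  have Hfin R4 m4 : mem_config m4 c' -> frame repair_regs R3 R4 ->
      ex 3 (ReadMem 0 0 ;; Op OpSub 0 0 1) (State R4 m4) (fun st =>
        mem_config (memory st) c' /\ (regs st 0 != 0) = (1 < c' v0)).
    move=> Hm4 F4; have CR4 : consts R4 by apply: consts_frame F4 _.
    have [[R4_1 _ _ _] _ _] := CR4.
    have R4_0 : R4 0 = v0 by rewrite F4.
    have [mv c4] := Hm4 v0.
    apply: (@ex_le _ _ _ _ _ _ (1 + 1).+1) => //.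
    apply: ex_seq; apply: ex_read; rewrite R4_0 ?mv; [lia|lia|].
    apply: ex_op => /=; rewrite R4_1; first lia.
    by split=> //; lia.
  apply: ex_seq; apply: ex_if => /=; rewrite R3_16 ?eqb0 ?negbK => h.
    have [Hm2' ? ? ?] := H2.
    apply: exW (settle_ok (S := S) (R := R3) (m := m2) _ _ _ _ _ _) => //.
    by move=> [R4 m4] [/= Hm4 F4]; apply: Hfin.
  have {}h : (size S.2 <= L) = false by move/eqP: h; rewrite eqb0 => /negPf.
  by apply: ex_skip; apply: Hfin => //; rewrite /c' /settle h.
by rewrite /t_query /t_touch; lia.
Qed.

End Refinement.

(** * The threshold *)

(** Multiplied by 75 and exponentiated, this is the sign of the entropy gap at 17/75; the factor 2
    in 116 = 2 * 58 comes from the term with ln 2. Likewise [pow_upper] at 5/22, with 34 = 2 * 17.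
    The two fractions enclose the root and lie within 1/2000 of 0.227. *)
Lemma pow_lower : (75 ^ (17 + 58) < 17 ^ 17 * 116 ^ 58)%N.
Proof. lia. Qed.

Lemma pow_upper : (5 ^ 5 * 34 ^ 17 < 22 ^ (5 + 17))%N.
Proof. lia. Qed.

Section Threshold.
Variable R : realType.
Local Open Scope ring_scope.

Lemma ln_le_subr1 (y : R) : 0 < y -> ln y <= y - 1.
Proof. by move=> y0; have := expR_ge1Dx (ln y); rewrite lnK ?posrE //; lra. Qed.

Lemma ln2_gt0 : 0 < ln 2 :> R.
Proof. by apply: ln_gt0; lra. Qed.

(** This is ln 2 times 1 - a - H(a). *)
Definition entropy_gap (a : R) : R := (1 - a) * ln 2 + a * ln a + (1 - a) * ln (1 - a).

Lemma entropy_gapP (a : R) : (a = 1 - binary_entropy a) <-> entropy_gap a = 0.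
Proof.
rewrite /binary_entropy /log2 /entropy_gap; have l2 := ln2_gt0.
have -> : - a * (ln a / ln 2) - (1 - a) * (ln (1 - a) / ln 2) =
  - (a * ln a + (1 - a) * ln (1 - a)) / ln 2 by field; lra.
split=> [H|H].
  have : 1 - a = - (a * ln a + (1 - a) * ln (1 - a)) / ln 2 by lra.
  move=> /(congr1 (fun x => x * ln 2)); rewrite divfK; first by lra.
  by rewrite gt_eqF.
have -> : - (a * ln a + (1 - a) * ln (1 - a)) = (1 - a) * ln 2 by lra.
by rewrite mulfK ?gt_eqF //; lra.
Qed.

(** Relative entropy is nonnegative, by ln y <= y - 1 at b / a and at (1 - b) / (1 - a). *)
Lemma gibbs (a b : R) : 0 < a < 1 -> 0 < b < 1 ->
  a * ln b + (1 - a) * ln (1 - b) <= a * ln a + (1 - a) * ln (1 - a).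
Proof.
move=> /andP[a0 a1] /andP[b0 b1].
have a1' : 0 < 1 - a by lra. have b1' : 0 < 1 - b by lra.
have H1 : a * (ln b - ln a) <= b - a.
  rewrite -ln_div ?posrE //; have := ln_le_subr1 (divr_gt0 b0 a0).
  move=> /(ler_wpM2l (ltW a0)).
  by rewrite [X in _ <= X]mulrBr mulr1 [X in _ <= X - _]mulrC divfK ?gt_eqF.
have H2 : (1 - a) * (ln (1 - b) - ln (1 - a)) <= (1 - b) - (1 - a).
  rewrite -ln_div ?posrE //; have := ln_le_subr1 (divr_gt0 b1' a1').
  move=> /(ler_wpM2l (ltW a1')).
  rewrite [X in _ <= X]mulrBr mulr1 [X in _ <= X - _]mulrC divfK ?gt_eqF //.
by lra.
Qed.

(* Dividing the gap by 1 - a makes it strictly monotone. *)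
Lemma entropy_gap_unique (a b : R) : 0 < a < 1 -> 0 < b < 1 ->
  entropy_gap a = 0 -> entropy_gap b = 0 -> a = b.
Proof.
wlog ab : a b / a < b.
  move=> H Ha Hb ga gb; case: (ltgtP a b) => // h; first exact: H.
  by apply/esym; apply: H.
move=> Ha Hb ga gb; exfalso; have G := gibbs Ha Hb.
have /andP[a0 a1] := Ha; have /andP[b0 b1] := Hb.
have lb : ln b < 0 by apply: ln_lt0; rewrite b0.
have H1 : (1 - b) * ((1 - a) * ln 2) <=
          (1 - b) * - (a * ln b + (1 - a) * ln (1 - b)).
  by apply: ler_wpM2l; [lra|move: ga; rewrite /entropy_gap; lra].
have H2 : (1 - a) * ((1 - b) * ln 2) = (1 - a) * - (b * ln b + (1 - b) * ln (1 - b)).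
  by congr (_ * _); move: gb; rewrite /entropy_gap; lra.
have H3 : 0 < (b - a) * - ln b by apply: mulr_gt0; lra.
by nra.
Qed.

Lemma ln_lincomb (i j a b : nat) : (0 < a)%N -> (0 < b)%N ->
  i%:R * ln a%:R + j%:R * ln b%:R = ln (a ^ i * b ^ j)%:R :> R.
Proof.
move=> a0 b0; rewrite !mulr_natl -!lnXn ?ltr0n // -lnM ?posrE ?exprn_gt0 ?ltr0n //.
by rewrite natrM !natrX.
Qed.

Lemma ltr_ln_nat (i j a b c : nat) : (0 < a)%N -> (0 < b)%N -> (0 < c)%N ->
  (c ^ (i + j) < a ^ i * b ^ j)%N ->
  (i + j)%:R * ln c%:R < i%:R * ln a%:R + j%:R * ln b%:R :> R.
Proof.
move=> a0 b0 c0 H; rewrite ln_lincomb // natrD mulrDl ln_lincomb // -expnD.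
by rewrite ltr_ln ?posrE ?ltr0n ?muln_gt0 ?expn_gt0 ?a0 ?b0 ?c0 // ltr_nat.
Qed.

Lemma gtr_ln_nat (i j a b c : nat) : (0 < a)%N -> (0 < b)%N -> (0 < c)%N ->
  (a ^ i * b ^ j < c ^ (i + j))%N ->
  i%:R * ln a%:R + j%:R * ln b%:R < (i + j)%:R * ln c%:R :> R.
Proof.
move=> a0 b0 c0 H; rewrite ln_lincomb // natrD mulrDl ln_lincomb // -expnD.
by rewrite ltr_ln ?posrE ?ltr0n ?muln_gt0 ?expn_gt0 ?a0 ?b0 ?c0 // ltr_nat.
Qed.

Lemma entropy_gap_lower : 0 < entropy_gap (17 / 75).
Proof.
have E : entropy_gap (17 / 75) = (17 * ln 17 + 58 * ln 116 - 75 * ln 75) / 75.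
  rewrite /entropy_gap (_ : 1 - 17 / 75 = 58 / 75); last by field.
  rewrite !ln_div ?posrE // (_ : 116 = 58 * 2); last by ring.
  by rewrite lnM ?posrE //; field.
rewrite E divr_gt0 // subr_gt0; apply: (@ltr_ln_nat 17 58 17 116 75 isT isT isT).
exact: pow_lower.
Qed.

Lemma entropy_gap_upper : entropy_gap (5 / 22) < 0.
Proof.
have E : entropy_gap (5 / 22) = (5 * ln 5 + 17 * ln 34 - 22 * ln 22) / 22.
  rewrite /entropy_gap (_ : 1 - 5 / 22 = 17 / 22); last by field.
  rewrite !ln_div ?posrE // (_ : 34 = 17 * 2); last by ring.
  by rewrite lnM ?posrE //; field.
rewrite E pmulr_llt0 ?invr_gt0 // subr_lt0.
apply: (@gtr_ln_nat 5 17 5 34 22 isT isT isT).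
exact: pow_upper.
Qed.

Lemma entropy_gap_root : exists2 a : R, 17 / 75 <= a <= 5 / 22 & entropy_gap a = 0.
Proof.
have le : 17 / 75 <= 5 / 22 :> R by lra.
have [||a] := @IVT R entropy_gap _ _ 0 le.
- apply: continuous_in_subspaceT => x; rewrite inE /= in_itv /= => /andP[x1 x2].
  have cl : {for x, continuous (@ln R)} by apply: continuous_ln; lra.
  have cl1 : {for x, continuous (fun y : R => ln (1 - y))}.
    apply: (@continuous_comp _ _ _ (fun y : R => 1 - y) (@ln R)).
      by apply: cvgB; [exact: cvg_cst | exact: cvg_id].
    by apply: continuous_ln; lra.
  have c1 : {for x, continuous (fun y : R => 1 - y)}.
    by apply: cvgB; [exact: cvg_cst | exact: cvg_id].
  apply: cvgD; last by apply: cvgM.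
  apply: cvgD; last by apply: cvgM => //; exact: cvg_id.
  by apply: cvgM => //; exact: cvg_cst.
- have := entropy_gap_lower; have := entropy_gap_upper => u v.
  by rewrite ge_min le_max (ltW u) (ltW v) orbT.
by rewrite in_itv /= => H1 H2; exists a.
Qed.

End Threshold.

(** * The local computation algorithm *)

Section Input.
Context {n : nat} {E : hypergraph n} (G : representation E).
Variables (k D : nat).
Hypothesis k_gt0 : 0 < k.
Hypothesis E_uniform : uniform k E.
Hypothesis E_degree : max_edge_degree E + 1 <= D.

Local Notation ed := (edge_verts G).
Local Notation inc := (incident G).

Lemma edge_verts_default g : size (edge_list G) <= g -> ed g = [::].
Proof. exact: nth_default. Qed.

Lemma edge_verts_lt u g : u \in ed g -> g < size (edge_list G).
Proof. by rewrite ltnNge; apply: contraL => /edge_verts_default ->. Qed.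

Lemma edge_verts_uniq g : uniq (ed g).
Proof.
have [gE|/edge_verts_default -> //] := ltnP g (size (edge_list G)).
exact: (allP (edge_list_uniq G)) (mem_nth _ gE).
Qed.

Lemma edge_verts_in g : g < size (edge_list G) -> [set v in ed g] \in E.
Proof.
move=> gE; rewrite -mem_enum -(perm_mem (edge_listP G)).
by apply: map_f; apply: mem_nth.
Qed.

Lemma edge_verts_ex f : f \in E -> exists2 g, g < size (edge_list G) & f = [set v in ed g].
Proof.
rewrite -mem_enum -(perm_mem (edge_listP G)) => /mapP[e /(nthP [::])[g gE <-] ->].
by exists g.
Qed.

Lemma edge_verts_size g : g < size (edge_list G) -> size (ed g) = k.
Proof.
move=> gE; rewrite -(eqP (forall_inP E_uniform _ (edge_verts_in gE))) cardsE.
by apply/esym/card_uniqP; exact: edge_verts_uniq.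
Qed.

Lemma incidentE u g : (g \in inc u) = (u \in ed g).
Proof.
rewrite (perm_mem (incidence_listP G u)) mem_filter mem_iota add0n.
by apply: andb_idr => /edge_verts_lt.
Qed.

Lemma size_incident_card u : size (inc u) = #|[set f in E | u \in f]|.
Proof.
rewrite (perm_size (incidence_listP G u)) size_filter.
have -> : count (fun j => u \in nth [::] (edge_list G) j) (iota 0 (size (edge_list G))) =
          count (fun e : seq 'I_n => u \in e) (edge_list G).
  by rewrite -[in RHS](mkseq_nth [::] (edge_list G)) count_map.
have -> : count (fun e : seq 'I_n => u \in e) (edge_list G) =
          count (fun f : {set 'I_n} => u \in f) (enum E).
  rewrite -(permP (edge_listP G)) count_map; apply: eq_count => e /=.
  by rewrite finset.inE.
rewrite -size_filter -(card_uniqP (filter_uniq _ (enum_uniq _))).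
by apply: eq_card => f; rewrite finset.inE mem_filter mem_enum andbC.
Qed.

(** All the edges at [u] meet one another, so for a fixed [f] among them the others count in the
    edge degree of [f]. *)
Lemma size_incident u : size (inc u) <= D.
Proof.
rewrite size_incident_card; apply: leq_trans E_degree.
have [->|[f]] := set_0Vmem [set f in E | u \in f]; first by rewrite cards0.
rewrite finset.inE => /andP[fE uf].
apply: (@leq_trans (edge_degree E f + 1)); last first.
  by rewrite leq_add2r /max_edge_degree (bigD1 f) //= leq_maxl.
rewrite addn1 /edge_degree (cardsD1 f) finset.inE fE uf /= add1n ltnS.
apply: subset_leq_card; apply/fintype.subsetP => h.
rewrite !finset.inE => /and3P[hf -> uh]; rewrite hf /=.
by apply/pred0Pn; exists u; rewrite /= uh.
Qed.

Lemma size_edge_list : size (edge_list G) <= n * D.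
Proof.
have sub : {subset iota 0 (size (edge_list G)) <= flatten [seq inc u | u <- enum 'I_n]}.
  move=> g; rewrite mem_iota add0n => gE; apply/flattenP.
  have := edge_verts_size gE; case Eg : (ed g) => [|u f] /= sz; first by move: k_gt0; rewrite -sz.
  exists (inc u); last by rewrite incidentE Eg mem_head.
  by apply: map_f; rewrite mem_enum.
have := uniq_leq_size (iota_uniq 0 _) sub; rewrite size_iota => /leq_trans; apply.
by apply: leq_trans (size_flatten_le _ size_incident) _; rewrite size_enum_ord.
Qed.

End Input.

(** * The constants, and the answers of the machine *)

Section Algorithm.
Variables (k T D : nat).

Local Notation Q := (k * D).

Definition lg n := (trunc_log 2 n).+1.
(** Certificates of length [lg n] call for L = lg n * Q * k. [cN] gives N = 2 L + 2 lg n, so that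
    4^L / 2^N = 2^(-2 lg n). [cB] provides one bit for each frozen vertex and [k] bits for each
    resampling. *)
Definition cL := Q * k.
Definition cN := 2 * cL + 2.
Definition cB := cL + cN * k.
Definition lim_frozen n := cL * lg n.
Definition lim_redraw n := cN * lg n.
Definition block_size n := cB * lg n.
Definition space n := n + lim_frozen n + 1 + D * lim_frozen n + k * D * lim_redraw n.
Definition time n := t_query k (lim_frozen n) (lim_redraw n) D (lg n) + 1.

Definition cspace := cL + 1 + D * cL + Q * cN.
(** All the numbers in use, including the tape addresses up to n + n B, are at most a constant times
    (2^(lg n))^2. The 2 in [factor.+2] covers the square and [factor] the constant. *)
Definition factor := 4 + 2 * cB + cL + cN + cspace + 2 * D + k * k + k + T + 9.

Definition algorithm := Program (p_query k T cL cN cB) factor.+2.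

Lemma lg_bounds n : 0 < n -> 2 ^ (lg n).-1 <= n < 2 ^ lg n.
Proof. by move=> n0; rewrite trunc_logP //= trunc_log_ltn. Qed.

Lemma time_linear : exists K, forall n, (time n <= K * lg n).
Proof.
pose a := (k * (t_redraw D + 20) + 60).
exists (20 + t_touch k D + cL * (t_sweep k D + 20) + cL * (t_redraw D + 20) +
  (D * cL + k * D * cN) * a + cL * 20 + 300) => n.
rewrite /time /t_query /t_explore /t_settle /t_repair /lim_frozen /lim_redraw -/a.
have l1 : (0 < lg n) by [].
have := leq_mul (leqnn (t_touch k D)) l1.
move: cL cN (t_touch k D) (t_sweep k D) (t_redraw D) a (lg n) l1 => b c x y z t l; nia.
Qed.

Lemma space_linear : exists K, forall n, (0 < n) -> (space n <= K * n).
Proof.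
exists (1 + cspace) => n n0; rewrite /space /lim_frozen /lim_redraw /cspace.
have ln : (lg n <= n).
  have /andP[H _] := lg_bounds n0; apply: leq_trans H.
  exact: ltn_expl (trunc_log 2 n) (leqnn 2).
have c1 a : (a * lg n <= a * n) by rewrite leq_mul2l ln orbT.
have := c1 cL; have := c1 (D * cL); have := c1 (k * D * cN).
move: cL cN (lg n) => b c l; lia.
Qed.

Hypothesis k_gt0 : 0 < k.
Hypothesis T_gt0 : 0 < T.
Hypothesis D_gt0 : 0 < D.

Section Run.
Context {n : nat} {E : hypergraph n} (G : representation E).
Hypothesis E_uniform : uniform k E.
Hypothesis E_degree : max_edge_degree E + 1 <= D.

Local Notation ed := (edge_verts G).
Local Notation inc := (incident G).
Local Notation w := (word_bits algorithm n).
Local Notation L := (lim_frozen n).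
Local Notation N := (lim_redraw n).
Local Notation B := (block_size n).

Lemma word_capacity : factor * 2 ^ lg n * 2 ^ lg n < 2 ^ w.
Proof.
rewrite /word_bits /= -/(lg n); have ff := ltn_expl factor (leqnn 2).
apply: (@leq_trans (2 ^ factor * 2 ^ lg n * 2 ^ lg n)).
  by rewrite !ltn_pmul2r ?expn_gt0.
rewrite -!expnD leq_exp2l //; have := leq_pmulr factor (ltn0Sn (trunc_log 2 n)).
by rewrite -/(lg n); move: factor => f; lia.
Qed.

Lemma range_ok : 0 < n ->
  n + n * B + B + L + N + space n + D + k * k + k + T + size (edge_list G) + 9 < 2 ^ w.
Proof.
move=> n0; apply: leq_ltn_trans word_capacity.
have /andP[_ n2] := lg_bounds n0; set P := 2 ^ lg n in n2 *.
have lP : lg n <= P by apply: ltnW; apply: ltn_expl.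
have P0 : 0 < P by rewrite expn_gt0.
have PP a : a <= P -> a <= P * P by move=> /leq_trans; apply; rewrite leq_pmulr.
have nP := PP n (ltnW n2); have lPP := PP _ lP.
have P1 : 1 <= P * P by rewrite muln_gt0 P0.
have nl : n * lg n <= P * P by apply: leq_mul => //; apply: ltnW.
have nD : size (edge_list G) <= D * (P * P).
  apply: leq_trans (size_edge_list G k_gt0 E_uniform E_degree) _.
  by rewrite mulnC leq_mul2l nP orbT.
have c1 a b : b <= P * P -> a * b <= a * (P * P) by move=> h; rewrite leq_mul2l h orbT.
have hB := c1 cB _ lPP; have hL := c1 cL _ lPP; have hN := c1 cN _ lPP.
have hnB : n * B <= cB * (P * P) by rewrite /block_size mulnCA; apply: c1.
have hs : space n <= (1 + cspace) * (P * P).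
  have h1 := c1 (D * cL) _ lPP; have h2 := c1 (Q * cN) _ lPP.
  have -> : space n = n + cL * lg n + 1 + D * cL * lg n + Q * cN * lg n.
    by rewrite /space /lim_frozen /lim_redraw !mulnA.
  move: h1 h2 hL nP P1; rewrite /cspace; move: cL cN (lg n) (P * P) => a b l x; lia.
have hD := c1 D _ P1; have hkk := c1 (k * k) _ P1; have hk := c1 k _ P1; have hT := c1 T _ P1.
have h9 := c1 9 _ P1; rewrite !muln1 in hD hkk hk hT h9.
rewrite -mulnA /factor; move: hB hL hN hnB hs hD hkk hk hT h9 nD nP.
rewrite /block_size /lim_frozen /lim_redraw.
move: cL cN cB cspace (space n) (P * P) (lg n) (size (edge_list G)) => a b c e f x l z; lia.
Qed.

Implicit Types (c : 'I_n -> nat) (mem : store).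

Lemma budget : N * k + L <= B.
Proof. by rewrite /block_size /lim_frozen /lim_redraw /cB mulnDl addnC mulnAC. Qed.

Lemma query_answer (v : 'I_n) (r : tape w) mem c : mem_config mem c ->
  let c' := (interp (nth false r) (query ed inc k T L N B v c)).2 in
  exists2 mem', answer_query (time n) (space n) G r mem v = Some (1 < c' v, mem') &
                mem_config mem' c'.
Proof.
move=> Hm c'; have vn := ltn_ord v; have n0 : 0 < n by apply: leq_ltn_trans vn.
have rng := range_ok n0.
have w0 : 0 < w by rewrite /word_bits.
have b_le : base B v + B <= n + n * B.
  by rewrite /base -addnA leq_add2l addnC -mulSn leq_mul2r vn orbT.
have inc_lt u g : g \in inc u -> g < size (edge_list G).
  by rewrite incidentE => /edge_verts_lt.
have inc_edge u g : g \in inc u -> size (ed g) = k.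
  by move=> gu; apply: edge_verts_size => //; apply: inc_lt gu.
have [st' [Hm' Hans] [t0 t0le Hrun]] := query_ok r w0 rng (leqnn _) T_gt0 inc_lt inc_edge
  (size_incident G E_degree) b_le k_gt0 (erefl _) (ltn0Sn _) (lg_bounds n0)
  (erefl _) (erefl _) (erefl _) Hm budget.
exists (memory st') => //; rewrite /answer_query /set_reg modn_small; last first.
  by apply: leq_trans rng; lia.
have t0lt : t0 < time n by rewrite /time addn1 ltnS.
have -> : time n = t0 + (time n - t0).-1.+1.
  by rewrite prednK ?subn_gt0 // subnKC // ltnW.
by rewrite Hrun /= Hans.
Qed.

Lemma answers_defined qs (r : tape w) mem c : mem_config mem c ->
  answers_from (A := algorithm) (time n) (space n) G r mem qs != None.
Proof.
elim: qs mem c => //= v qs IH mem c Hm.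
have [mem' -> Hm'] := query_answer v r Hm; rewrite /=.
by have := IH _ _ Hm'; case: answers_from.
Qed.

Lemma edge_size_in u g : u \in ed g -> size (ed g) = k.
Proof. by move=> ug; apply: edge_verts_size => //; apply: edge_verts_lt ug. Qed.

(** A nonzero color never changes in a successful run, so every answer already is the final color.
    The queries [qs2] are only part of the analysis. *)
Lemma answers_final qs1 qs2 (r : tape w) mem c cf : query_inv ed T c -> mem_config mem c ->
  interp (nth false r) (queries ed inc k T L N B (qs1 ++ qs2) c) = (true, cf) ->
  answers_from (A := algorithm) (time n) (space n) G r mem qs1 =
    Some [seq 1 < cf v | v <- qs1].
Proof.
elim: qs1 mem c => //= v qs IH mem c Hc Hm; rewrite interp_bind.
have [mem' -> Hm'] := query_answer v r Hm; rewrite /=.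
have H := leaves_interp (nth false r)
  (query_leaves L N B (incidentE G) (edge_verts_uniq G) T_gt0 edge_size_in v Hc).
case: (interp _ (query _ _ _ _ _ _ _ _ c)) H Hm' => -[] c' //= /(_ isT)[Hc' c'v _] Hm' Hq.
rewrite (IH _ _ Hc' Hm' Hq) /=.
have := leaves_interp (nth false r)
  (queries_leaves L N B (incidentE G) (edge_verts_uniq G) T_gt0 edge_size_in (qs ++ qs2) Hc').
by rewrite Hq /= => /(_ isT)[_ rf _]; rewrite rf.
Qed.

Lemma query_inv0 : query_inv ed T (fun=> 0).
Proof.
split=> // g; right; rewrite /colored /num !(eq_count (a2 := pred0)) ?count_pred0 //.
Qed.

Hypothesis T_lt_k : T < k.

(** All k > T vertices of an edge have a final color, which leaves only the first alternative of
    [slack]. *)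
Lemma final_proper c : query_inv ed T c -> (forall v, c v != 0) ->
  proper_coloring E [ffun v => 1 < c v].
Proof.
move=> [c2 sl] c0; apply/forall_inP => f /(edge_verts_ex G)[g gE ->].
have sz := edge_verts_size E_uniform gE.
have tw : two_colored ed c g.
  have [//|] := sl g; have := @num_partition n c (ed g).
  rewrite sz => H; have {}H : num c 1 (ed g) + num c 2 (ed g) + num c 3 (ed g) = k.
    by apply: H => u _; rewrite lt0n c0 (leq_trans (c2 u)).
  have n3 : num c 3 (ed g) = 0.
    by apply/eqP; rewrite -leqn0 leqNgt -has_count; apply/hasPn => u _; have := c2 u; lia.
  by rewrite /colored; lia.
have /andP[/num_gt0P[u ug cu] /num_gt0P[x xg cx]] := tw.
apply/existsP => -[b /forall_inP H].
have := H u; have := H x; rewrite !finset.inE !ffunE ug xg cu cx => /(_ isT)/eqP <-.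
by move=> /(_ isT).
Qed.

Section Probability.
Variable R : realType.
Local Open Scope ring_scope.

(** The queries [enum 'I_n] are never put to the machine; they extend its coloring to a total
    one. *)
Lemma consistent_prob qs :
  1 - Ex (@failure n R) (queries ed inc k T L N B (qs ++ enum 'I_n) (fun=> 0%N)) <=
  tape_prob R (consistent (A := algorithm) (time n) (space n) G qs).
Proof.
set m := queries _ _ _ _ _ _ _ _ _; rewrite /tape_prob.
have cN0 : #|{: (2 ^ w).-tuple bool}|%:R != 0 :> R.
  by rewrite card_tuple card_bool pnatr_eq0 expn_eq0.
have cP : 0 < #|{: (2 ^ w).-tuple bool}|%:R :> R by rewrite lt0r cN0 ler0n.
have B_ge : (L + N * k <= B)%N by rewrite addnC budget.
have fr := queries_fresh (incidentE G) (edge_verts_uniq G) T_gt0 edge_size_in B_ge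
  (qs ++ enum 'I_n) query_inv0.
rewrite ler_pdivlMr // mulrBl mul1r mulrC.
rewrite -(sum_tape (N := 2 ^ w) (@failure n R) fr); last first.
  move=> x [[u _ ->]|[_ [u _ /andP[_ xu]]]]; have un := ltn_ord u;
    have n0 : (0 < n)%N by apply: leq_ltn_trans un.
    by have := range_ok n0; lia.
  apply: leq_trans xu _; apply: ltnW; apply: leq_ltn_trans (range_ok n0).
  by rewrite /base; have := leq_mul un (leqnn B); rewrite mulSn; lia.
have -> : #|{: (2 ^ w).-tuple bool}|%:R = \sum_(r : (2 ^ w).-tuple bool) 1 :> R.
  by rewrite sumr_const.
rewrite -sumrB -sum1_card natr_sum [leRHS]big_mkcond /=; apply: ler_sum => r _.
rewrite finset.inE /failure; case Em : (interp _ m) => [[] cf] /=; last first.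
  by rewrite subrr; case: ifP.
rewrite subr0 ifT //; have := leaves_interp (nth false r)
  (queries_leaves L N B (incidentE G) (edge_verts_uniq G) T_gt0 edge_size_in (qs ++ enum 'I_n) query_inv0).
rewrite -/m Em /= => /(_ isT)[If _ nz].
apply/existsP; exists [ffun v => (1 < cf v)%N]; rewrite final_proper //=; last first.
  by move=> v; apply: nz; rewrite mem_cat mem_enum orbT.
rewrite /answers (answers_final (mem := fun=> 0%N) query_inv0 _ Em) //.
by apply/eqP; congr Some; apply: eq_map => v; rewrite ffunE.
Qed.

Hypothesis cert_le : (64 * Q ^ 3 <= 2 ^ T)%N.
Hypothesis repair_le : (16 * Q <= 2 ^ (k - T))%N.

(** The constants 64 and 16 make each edge of a certificate cost 1/8 and each resampling 1/2. For P
    = 2^(lg n) > n the sum is at most 4 n / P^3 + n / P^2 <= 5 / P. *)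
Lemma Ex_failure_le qs : (0 < n)%N ->
  Ex (@failure n R) (queries ed inc k T L N B qs (fun=> 0%N)) <= 5 / n.+1%:R.
Proof.
move=> n0; have Q0 : (0 < Q)%N by rewrite muln_gt0 k_gt0.
have p_le : 4 * (2 / 2 ^+ (k - T)) * Q%:R <= 1 / 2 :> R.
  have : 16 * Q%:R <= 2 ^+ (k - T) :> R by rewrite -natrX -natrM ler_nat.
  have : 0 < 2 ^+ (k - T) :> R by rewrite exprn_gt0.
  set y := 2 ^+ _; move=> y0 H; rewrite (_ : 4 * (2 / y) * Q%:R = 8 * Q%:R / y); last by field; lra.
  by rewrite ler_pdivrMr //; lra.
have L_ge : (lg n * Q * k <= L)%N by rewrite /lim_frozen /cL -mulnA mulnC.
apply: le_trans (queries_failure N B (incidentE G) (edge_verts_uniq G) T_gt0 edge_size_in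
  (size_incident G E_degree) L_ge Q0 p_le qs query_inv0) _.
have /andP[_ nP] := lg_bounds n0; pose P : R := 2 ^+ lg n.
have PnR : n.+1%:R <= P by rewrite /P -natrX ler_nat.
have P0 : 0 < P by rewrite exprn_gt0.
have errE : err L N R = (P ^+ 2)^-1.
  rewrite /err (_ : N = 2 * L + lg n * 2)%N; last first.
    by rewrite /lim_redraw /lim_frozen /cN mulnDl mulnA [(2 * lg n)%N]mulnC.
  rewrite exprD exprM exprM (_ : 2 ^+ 2 = 4 :> R); last by rewrite -natrX.
  by rewrite invfM mulrA divff ?mul1r // expf_neq0.
have pot : potential ed inc T R (lg n) (fun=> 0%N) <= n%:R * (4 * (P ^+ 3)^-1).
  apply: le_trans (potential_init T_gt0 edge_size_in (size_incident G E_degree) R (lg n) Q0) _.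
  rewrite ler_wpM2l // ler_wpM2l //.
  have -> : (P ^+ 3)^-1 = (8^-1) ^+ lg n.
    rewrite /P -exprM mulnC exprM exprVn (_ : 2 ^+ 3 = 8 :> R) //.
    by rewrite -natrX.
  rewrite lerXn2r ?nnegrE ?mulr_ge0 ?invr_ge0 ?exprn_ge0 //.
  have : 64 * (Q ^ 3)%:R <= 2 ^+ T :> R by rewrite -natrX -natrM ler_nat.
  have T0 : 0 < 2 ^+ T :> R by rewrite exprn_gt0.
  by move=> H; rewrite mulrA ler_pdivrMr //; lra.
have unt : (untouched (fun _ : 'I_n => 0%N) <= n)%N.
  by rewrite /untouched; apply: leq_trans (max_card _) _; rewrite card_ord.
rewrite /bound errE; apply: le_trans (_ : n%:R * (4 * (P ^+ 3)^-1) + n%:R * (P ^+ 2)^-1 <= _).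
  by apply: lerD => //; rewrite ler_wpM2r ?invr_ge0 ?exprn_ge0 ?ler_nat // ltW.
have nR : n%:R <= P by apply: le_trans PnR; rewrite ler_nat.
have P1 : 1 <= P by rewrite exprn_ege1 // ler1n.
apply: (@le_trans _ _ (5 / P)); last first.
  by rewrite ler_pM2l // lef_pV2 ?posrE ?ltr0n.
have h2 : n%:R * (P ^+ 2)^-1 <= P^-1.
  rewrite expr2 invfM mulrA -[leRHS]mul1r ler_wpM2r ?invr_ge0 ?(ltW P0) //.
  by rewrite ler_pdivrMr // mul1r.
have h3 : n%:R * (P ^+ 3)^-1 <= P^-1.
  apply: le_trans h2; rewrite ler_wpM2l // lef_pV2 ?posrE ?exprn_gt0 //.
  by rewrite ler_weXn2l.
lra.
Qed.

End Probability.
End Run.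

Section LCA.
Variable R : realType.
Local Open Scope ring_scope.
Hypothesis T_lt_k : (T < k)%N.
Hypothesis cert_le : (64 * Q ^ 3 <= 2 ^ T)%N.
Hypothesis repair_le : (16 * Q <= 2 ^ (k - T))%N.

Lemma algorithm_LCA (C : forall n, hypergraph n -> Prop) :
  (forall n (E : hypergraph n), C n E -> uniform k E /\ (max_edge_degree E + 1 <= D)%N) ->
  two_coloring_LCA C algorithm time space (fun n => 5 / n.+1%:R : R).
Proof.
move=> HC n E G qs /HC[uE dE]; have m0 : mem_config (n := n) (fun=> 0%N) (fun=> 0%N) by [].
split=> [r|]; first exact: (answers_defined G uE dE qs r m0).
(* For n = 0 the allowed error is 5, so the bound is trivial. *)
have [n0|n0] := posnP n.
  apply: (@le_trans _ _ 0); first by rewrite subr_le0 {1}n0 divr1 ler1n.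
  by rewrite divr_ge0.
apply: le_trans (consistent_prob G uE dE T_lt_k R qs).
by rewrite lerB // Ex_failure_le.
Qed.

End LCA.
End Algorithm.

(** * Asymptotics and the choice of parameters *)

Section Asymptotics.
Variable R : realType.
Local Open Scope ring_scope.

Lemma big_O_near (f g : nat -> R) (K : R) : 0 < K ->
  (forall n, (2 <= n)%N -> `|f n| <= K * `|g n|) -> big_O f g.
Proof.
move=> K0 H; apply/eqO_exP; exists K => //=.
by exists 2 => // n /= n2; apply: H.
Qed.

Lemma lg_ln n : (2 <= n)%N -> (lg n)%:R <= 2 / ln 2 * ln n%:R :> R.
Proof.
move=> n2; have n0 : (0 < n)%N by apply: ltnW.
have l2 := ln2_gt0 R; have nR : 2 <= n%:R :> R by rewrite (ler_nat _ 2).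
have h1 : ln 2 <= ln n%:R :> R by rewrite ler_ln ?posrE //; lra.
have h2 : (trunc_log 2 n)%:R * ln 2 <= ln n%:R :> R.
  rewrite mulr_natl -lnXn // ler_ln ?posrE ?exprn_gt0 //; last by lra.
  by rewrite -natrX ler_nat; have /andP[] := lg_bounds n0.
rewrite mulrAC ler_pdivlMr // /lg -natr1 mulrDl mul1r; lra.
Qed.

Lemma polylog_linear (t : nat -> nat) K :
  (forall n, (t n <= K * lg n)%N) -> polylog R t.
Proof.
move=> tK; exists 1%N; have l2 := ln2_gt0 R.
apply: (@big_O_near _ _ (K.+1%:R * (2 / ln 2))).
  by rewrite mulr_gt0 ?ltr0n ?divr_gt0.
move=> n n2; rewrite expr1 ger0_norm //.
have lnn : 0 <= ln n%:R :> R by apply: ln_ge0; rewrite (ler_nat _ 1) ltnW.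
rewrite ger0_norm // -mulrA; apply: (@le_trans _ _ (K%:R * (lg n)%:R)).
  by rewrite -natrM ler_nat.
apply: ler_pM => //; first by rewrite ler_nat.
exact: lg_ln.
Qed.

Lemma big_O_linear (s : nat -> nat) K : (forall n, (0 < n)%N -> (s n <= K * n)%N) ->
  big_O (fun n => (s n)%:R) (fun n => n%:R : R).
Proof.
move=> sK; apply: (@big_O_near _ _ K.+1%:R); first by rewrite ltr0n.
move=> n n2; rewrite !ger0_norm // -natrM ler_nat.
by apply: leq_trans (sK n (ltnW n2)) _; rewrite leq_mul2r leqnSn orbT.
Qed.

Lemma big_O_inv (a : R) : 0 < a -> big_O (fun n => a / n.+1%:R) (fun n => n%:R^-1).
Proof.
move=> a0; apply: (@big_O_near _ _ a) => // n n2.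
have nR : 2 <= n%:R :> R by rewrite (ler_nat _ 2).
rewrite !ger0_norm ?invr_ge0 ?divr_ge0 ?(ltW a0) //.
by rewrite ler_pM2l // lef_pV2 ?posrE ?ltr0n ?(ltnW n2) // ler_nat.
Qed.

End Asymptotics.

(** Here k/4 - 5k/22 = k/44, and 44 is a common multiple of both denominators. For k = 44 (j + 25) +
    f the exponents differ by at least j + 15 after rounding, while 16 k <= 704 (j + 26); at j = 0
    this is 704 * 26 <= 2^15. *)
Lemma exponent_gap k : 1100 <= k -> 16 * (k * 2 ^ (5 * k %/ 22).+1) <= 2 ^ (k %/ 4).
Proof.
move=> k0; have [j [f [kE f44]]] : exists j f, k = 44 * (j + 25) + f /\ f < 44.
  exists (k %/ 44 - 25), (k %% 44); have := divn_eq k 44; have := ltn_pmod k (isT : 0 < 44).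
  by have := leq_div2r 44 k0; rewrite (_ : 1100 %/ 44 = 25) //; lia.
have pow i : 704 * (i + 26) <= 2 ^ (i + 15).
  elim: i => [|i IH]; first by rewrite !add0n; lia.
  by rewrite addSn expnS; move: (2 ^ _) IH => x; lia.
apply: (@leq_trans (704 * (j + 26) * 2 ^ (5 * k %/ 22).+1)).
  by rewrite mulnA leq_mul2r kE; apply/orP; right; lia.
apply: leq_trans (leq_mul (pow j) (leqnn _)) _; rewrite -expnD leq_exp2l // kE.
by lia.
Qed.

(** Rounding the exponent up gives an integral bound that does not depend on alpha; it becomes the
    parameter [D] of the program. *)
Lemma problem_class_degree (R : realType) (alpha : R) k n (E : hypergraph n) :
  (alpha <= 5 / 22)%R -> in_problem_class alpha k E ->
  uniform k E /\ max_edge_degree E + 1 <= 2 ^ (5 * k %/ 22).+1.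
Proof.
move=> alpha_le [unif _ deg]; split=> //; rewrite -(ler_nat R).
have e1 : (1 <= expR 1 :> R)%R by rewrite -(expR0 R) ler_expR.
have le1 : (2 `^ (alpha * k%:R) <= 2 `^ ((5 * k %/ 22).+1%:R) :> R)%R.
  apply: ler_powR; first by lra.
  apply: (@le_trans _ _ (5 / 22 * k%:R)%R); first by rewrite ler_wpM2r.
  have := ltn_ceil (5 * k) (isT : 0 < 22); rewrite -(ltr_nat R) !natrM => H.
  by lra.
rewrite powR_mulrn // -natrX in le1.
have le2 : ((max_edge_degree E + 1)%:R <= 2 * expR 1 * (max_edge_degree E + 1)%:R :> R)%R.
  by rewrite -[leLHS]mul1r ler_wpM2r //; lra.
by apply: le_trans le2 _; apply: le_trans (ltW deg) le1.
Qed.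

Local Open Scope ring_scope.

Theorem theorem3 (R : realType) :
  exists alpha_star : R,
    [/\ unique (fun a : R => 0 < a < 1 /\ a = 1 - binary_entropy a) alpha_star,
        `|alpha_star - 227 / 1000| <= 1 / 2000
      & forall alpha : R, alpha < alpha_star ->
        exists k0 : nat, forall k : nat, (k0 <= k)%N ->
        exists (A : program) (t s : nat -> nat) (delta : nat -> R),
          [/\ two_coloring_LCA (in_problem_class alpha k) A t s delta,
              polylog R t,
              big_O (fun n => (s n)%:R) (fun n => n%:R : R)
            & big_O delta (fun n => n%:R^-1)]].
Proof.
have [a /andP[a1 a2] gap] := entropy_gap_root R.
have a01 : 0 < a < 1 by apply/andP; split; lra.
exists a; split.
- split=> [|b [b01 /entropy_gapP bgap]]; first by split=> //; apply/entropy_gapP.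
  exact: entropy_gap_unique.
- by rewrite ler_norml; apply/andP; split; lra.
move=> alpha alpha_a; exists 1100%N => k k_ge.
have gapk := exponent_gap k_ge.
(* [T] is three times the rounded quarter, so that [cert_le] follows from the cube of [gapk], as 64
   <= 16^3. Rounding down only helps the repair, since k - T >= k %/ 4. *)
pose D := (2 ^ (5 * k %/ 22).+1)%N; pose T := (3 * (k %/ 4))%N; rewrite -/D in gapk.
have k0 : (0 < k)%N by lia.
have T0 : (0 < T)%N by rewrite /T; lia.
have Tk : (T < k)%N by rewrite /T; lia.
have D0 : (0 < D)%N by rewrite expn_gt0.
have cert_le : (64 * (k * D) ^ 3 <= 2 ^ T)%N.
  have H : ((16 * (k * D)) ^ 3 <= (2 ^ (k %/ 4)) ^ 3)%N by rewrite leq_exp2r.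
  rewrite expnMn -expnM [(k %/ 4 * 3)%N]mulnC -/T in H; apply: leq_trans H.
  by rewrite leq_mul2r; apply/orP; right.
have repair_le : (16 * (k * D) <= 2 ^ (k - T))%N.
  by apply: leq_trans gapk _; rewrite leq_exp2l // /T; lia.
have HC n (E : hypergraph n) : in_problem_class alpha k E ->
    uniform k E /\ (max_edge_degree E + 1 <= D)%N.
  by apply: problem_class_degree; lra.
exists (algorithm k T D), (time k D), (space k D), (fun n => 5 / n.+1%:R); split.
- exact: algorithm_LCA.
- have [K HK] : exists K, forall n, (time k D n <= K * lg n)%N by apply: time_linear.
  exact: polylog_linear HK.
- have [K HK] : exists K, forall n, (0 < n)%N -> (space k D n <= K * n)%N.
    by apply: space_linear.
  exact: big_O_linear HK.
- exact: big_O_inv.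
Qed.
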